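(* Assume the standing assumptions (A0)–(A3) described in the context, that $r>-1$, and that the moment condition (M$_p$) holds for some $p>\max\{2,1+r\}$. Let $M_1:=\max_{\tau_0\le t<\tau_1}X_t$. Then for any $\varepsilon>0$, for all $x$ sufficiently large, $$x^{-1-r}(\log x)^{-\varepsilon}\le\mathbb{P}[M_1\ge x]\le x^{-1-r}(\log x)^{1+\varepsilon}.$$ In particular $\mathbb{E}[M_1^{1+r}]=\infty$ but $\mathbb{E}[M_1^{1+r-\varepsilon}]<\infty$ for every $\varepsilon>0$.
   Context: $\mathbb{N}=\{1,2,\dots\}$. (A0): $\mathbb{S}$ is a locally finite (every bounded set meets it in finitely many points), unbounded subset of $[0,\infty)$ with $0\in\mathbb{S}$; $(X_t)_{t\in\mathbb{N}}$ is an $\mathbb{S}$-valued process adapted to a filtration $(\mathcal{F}_t)_{t\in\mathbb{N}}$ with $\mathbb{P}[X_1=0]=1$. (A1): for each $x,y\in\mathbb{S}$ there exist $m(x,y)\in\mathbb{N}$, $\varphi(x,y)>0$ with $\mathbb{P}[X_{t+m(X_t,y)}=y\mid\mathcal{F}_t]\ge\varphi(X_t,y)$ a.s. for all $t$. Write $\Delta_t:=X_{t+1}-X_t$. (A2): there are $c\in\mathbb{R}$, $s^2\in(0,\infty)$ with, as $X_t\to\infty$, $\mathbb{E}[\Delta_t\mid\mathcal{F}_t]=cX_t^{-1}+o(X_t^{-1}(\log X_t)^{-1})$ and $\mathbb{E}[\Delta_t^2\mid\mathcal{F}_t]=s^2+o((\log X_t)^{-1})$ a.s., where the implicit constants in $o(\cdot)$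 are non-random and uniform in $t$ and in the sample point. Set $r:=-2c/s^2$. Excursions: $\tau_0:=1$, $\tau_n:=\min\{t>\tau_{n-1}:X_t=0\}$ ($\min\emptyset=\infty$), $\eta_n:=\tau_n-\tau_{n-1}$, $\mathcal{E}_n:=(X_t)_{\tau_{n-1}\le t\le\tau_n-1}$, $N:=\min\{n\in\mathbb{N}:\tau_n=\infty\}$. (A3): (a) on $\{N=\infty\}$, $(\mathcal{E}_n)_{n\in\mathbb{N}}$ is i.i.d.; (b) $\mathbb{P}[\eta_{n+1}<\infty\mid\tau_n<\infty]=\mathbb{P}[\eta_1<\infty]$ for all $n$. (M$_p$): there exist $\delta>0$, $C<\infty$ with $\mathbb{E}[|\Delta_t|^p\mid\mathcal{F}_t]\le C(1+X_t)^{p-2-\delta}$ a.s. for all $t$. *)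

(* Defs.v *)
From HB Require Import structures.
From mathcomp Require Import all_boot all_order all_algebra.
From mathcomp Require Import all_classical all_reals all_analysis.
From mathcomp Require Import measurable_realfun.
Set Implicit Arguments. Unset Strict Implicit. Unset Printing Implicit Defensive.
Import Order.TTheory GRing.Theory Num.Theory.
Local Open Scope classical_set_scope.
Local Open Scope ring_scope.

(* S is a locally finite, unbounded subset of [0,oo) with 0 in S.
   (A bounded subset of [0,oo) is contained in some [0,b].) *)
Definition state_space {R : realType} (S : set R) : Prop :=
  [/\ S 0, (forall x, S x -> 0 <= x),
      (forall b : R, finite_set (S `&` [set x | x <= b])) &
      (forall b : R, exists2 x, S x & b < x)].

Definition sub_sigma_algebra {d} {T : measurableType d} (G : set (set T)) :=
  sigma_algebra setT G /\ G `<=` measurable.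

Definition filtration {d} {T : measurableType d} (F : nat -> set (set T)) :=
  (forall t, sub_sigma_algebra (F t)) /\ (forall t, F t `<=` F t.+1).

Definition G_measR {d} {T : measurableType d} {R : realType}
    (G : set (set T)) (f : T -> R) :=
  forall B : set R, measurable B -> G (f @^-1` B).

Definition G_measE {d} {T : measurableType d} {R : realType}
    (G : set (set T)) (f : T -> \bar R) :=
  forall B : set (\bar R), measurable B -> G (f @^-1` B).

(* Z is a version of E[Y | G] for a nonnegative (extended-real) Y:
   Z is nonnegative, G-measurable and has the same integrals as Y on G-sets.
   (Such a version always exists for measurable Y >= 0.) *)
Definition cond_exp_nng {d} {T : measurableType d} {R : realType}
    (P : probability T R) (G : set (set T)) (Y Z : T -> \bar R) : Prop :=
  [/\ (forall w, (0 <= Z w)%E), G_measE G Z &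
      forall A, G A -> (\int[P]_(w in A) Y w = \int[P]_(w in A) Z w)%E].

Lemma ex_asbool (P : nat -> Prop) :
  (exists n, P n) -> exists n, `[< P n >].
Proof. by case=> n Pn; exists n; apply/asboolP. Qed.

Definition first_time (P : nat -> Prop) : option nat :=
  match pselect (exists n, P n) with
  | left h => Some (@ex_minn (fun n => `[< P n >]) (ex_asbool h))
  | right _ => None
  end.

(* Times are re-indexed to start at 0 (paper: t = 1,2,...; here t = 0,1,...).
   tau X n w = Some t  means tau_n = t,  None means tau_n = infinity.
   tau_0 = first time (0 here, 1 in the paper),
   tau_n = min { t > tau_{n-1} : X_t = 0 }. *)
Fixpoint tau {T : Type} {R : realType} (X : nat -> T -> R) (n : nat) (w : T)
  : option nat :=
  match n with
  | 0 => Some 0%N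
  | n'.+1 => match tau X n' w with
             | None => None
             | Some s => first_time (fun t => (s < t)%N /\ X t w = 0)
             end
  end.

Definition N_infinite {T : Type} {R : realType} (X : nat -> T -> R) : set T :=
  [set w | forall n, tau X n w <> None].

(* the n-th excursion E_n = (X_t)_{tau_{n-1} <= t <= tau_n - 1}, n >= 1,
   as a finite sequence (meaningful when tau_{n-1}, tau_n are finite) *)
Definition excursion {T : Type} {R : realType} (X : nat -> T -> R) (n : nat)
    (w : T) : seq R :=
  match tau X n.-1 w, tau X n w with
  | Some s, Some e => [seq X t w | t <- iota s (e - s)]
  | _, _ => [::]
  end.

(* M_1 = max_{tau_0 <= t < tau_1} X_t  (extended real: sup, may be +oo if tau_1 = oo) *)
Definition M1 {T : Type} {R : realType} (X : nat -> T -> R) (w : T) : \bar R :=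
  ereal_sup [set (X t w)%:E | t in
     [set t : nat | match tau X 1 w with Some e => (t < e)%N | None => True end]].

Definition pr {d} {T : measurableType d} {R : realType}
    (P : probability T R) (A : set T) : R := fine (P A).

(* Main.v *)
Require Import Defs.
From HB Require Import structures.
From mathcomp Require Import all_boot all_order all_algebra.
From mathcomp Require Import all_classical all_reals all_analysis.
From mathcomp Require Import measurable_realfun.
From mathcomp Require Import ring lra zify.
Set Implicit Arguments. Unset Strict Implicit. Unset Printing Implicit Defensive.
Import Order.TTheory GRing.Theory Num.Theory.
Import numFieldNormedType.Exports.
Local Open Scope classical_set_scope.
Local Open Scope ring_scope.

(** Put [g = 1 + r > 0] and [F(x) = x^g (log x)^n].  The drift of [F(X_t)] at a
    high level [y] is [F(y) y^-2 (log y)^-1 (n g s^2 / 2 + o(1))], because [c] is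
    such that [x^g] itself is harmonic to leading order.  So [F] is
    superharmonic at infinity for [n < 0] and subharmonic for [n > 0].

    Assumption (A1) bounds the expected number of visits of one excursion to
    any bounded set.  Hence, for [n < 0], the expectation of [F(X)] at the first
    exit of the excursion from [(0, x)] is bounded uniformly in [x], which gives
    [P[M_1 >= x] <= K / F(x)] and, on letting [x] tend to infinity, recurrence.
    For [n > 0] the truncation [F(min(max(X, A), 2 x)) - F(A)] is a nonnegative
    submartingale up to that exit, bounded by [F(2 x)] and vanishing at [0]; it
    gives [P[M_1 >= x] >= k / F(2 x)] once the first excursion is known to
    reach high levels with positive probability.  Some excursion does so by
    (A1), and then so does the first one by (A3).  The moment statements follow
    from these tails by dyadic summation. *)

Section powlog.
Context {R : realType}.
Implicit Types a b x y z : R.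

Definition powlog a b x := expR (a * ln x + b * ln (ln x)).

Lemma powlog_gt0 a b x : 0 < powlog a b x.
Proof. exact: expR_gt0. Qed.

Lemma powlogD a b a' b' x :
  powlog (a + a') (b + b') x = powlog a b x * powlog a' b' x.
Proof. by rewrite /powlog -expRD; congr expR; ring. Qed.

Lemma powlog_powR a x : 0 < x -> powlog a 0 x = x `^ a.
Proof. by move=> x0; rewrite /powlog mul0r addr0 /powR gt_eqF. Qed.

Lemma powlog_lnpow b x : 1 < x -> powlog 0 b x = ln x `^ b.
Proof. by move=> x1; rewrite /powlog mul0r add0r /powR gt_eqF// ln_gt0. Qed.

Lemma powlogE a b x : 1 < x -> powlog a b x = x `^ a * ln x `^ b.
Proof.
move=> x1; rewrite -powlog_powR ?(lt_trans _ x1)// -powlog_lnpow//.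
by rewrite -powlogD addr0 add0r.
Qed.

Lemma powlog_pred_pow a b x : 0 < x -> powlog (a - 1) b x = powlog a b x / x.
Proof.
move=> x0; rewrite -[b in LHS]addr0 powlogD powlog_powR//.
by rewrite powR_inv1// ltW.
Qed.

Lemma powlog_pred_log a b x : 1 < x -> powlog a (b - 1) x = powlog a b x / ln x.
Proof.
move=> x1; rewrite -[a in LHS]addr0 powlogD powlog_lnpow//.
by rewrite powR_inv1// ltW// ln_gt0.
Qed.

Lemma is_derive_powlog a b x : 1 < x ->
  is_derive x 1 (powlog a b)
    (a * powlog (a - 1) b x + b * powlog (a - 1) (b - 1) x).
Proof.
move=> x1; have x0 : 0 < x by lra.
have l0 : 0 < ln x by exact: ln_gt0.
rewrite powlog_pred_log// powlog_pred_pow//.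
have d1 : is_derive x 1 (@ln R) x^-1 by exact: is_derive1_ln.
have d2 : is_derive (ln x) 1 (@ln R) (ln x)^-1 by exact: is_derive1_ln.
have d3 : is_derive x 1 (@ln R \o @ln R) ((ln x)^-1 * x^-1).
  by apply: is_derive1_comp.
have d4 : is_derive x 1 (fun z => a * ln z + b * ln (ln z))
    (a * x^-1 + b * ((ln x)^-1 * x^-1)).
  by apply: is_deriveD; apply: is_deriveZ.
have d5 : is_derive x 1 (expR \o (fun z => a * ln z + b * ln (ln z)))
    (expR (a * ln x + b * ln (ln x)) * (a * x^-1 + b * ((ln x)^-1 * x^-1))).
  by apply: is_derive1_comp.
apply: (is_derive_eq d5).
rewrite -/(powlog a b x); set p := powlog _ _ _; field.
by rewrite !gt_eqF.
Qed.

Lemma ln_ln_sub y z : 1 < y -> y <= z ->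
  ln (ln z) - ln (ln y) <= (ln z - ln y) / ln y.
Proof.
move=> y1 yz; have ly : 0 < ln y by exact: ln_gt0.
have lz : ln y <= ln z by rewrite ler_ln ?posrE//; lra.
have lz0 : 0 < ln z by lra.
rewrite -ln_div ?posrE//.
have -> : ln z / ln y = 1 + (ln z - ln y) / ln y by field; rewrite gt_eqF.
apply: le_ln1Dx.
by apply: (@lt_le_trans _ _ 0); [lra | rewrite divr_ge0//; lra].
Qed.

Lemma powlog_le g n y z : 1 < y -> `|n| <= g * ln y -> y <= z ->
  powlog g n y <= powlog g n z.
Proof.
move=> y1 ng yz; rewrite /powlog ler_expR.
have ly : 0 < ln y by exact: ln_gt0.
have lz : ln y <= ln z by rewrite ler_ln ?posrE//; lra.
have lly : ln (ln y) <= ln (ln z) by rewrite ler_ln ?posrE//; lra.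
have h := ln_ln_sub y1 yz.
have h1 : `|n| * (ln (ln z) - ln (ln y)) <= g * (ln z - ln y).
  apply: (@le_trans _ _ (`|n| * ((ln z - ln y) / ln y))); first exact: ler_wpM2l.
  have -> : g * (ln z - ln y) = g * ln y * ((ln z - ln y) / ln y).
    by field; rewrite gt_eqF.
  by apply: ler_wpM2r => //; rewrite divr_ge0//; lra.
have h2 : - n * (ln (ln z) - ln (ln y)) <= `|n| * (ln (ln z) - ln (ln y)).
  by apply: ler_wpM2r; [lra | rewrite -normrN ler_norm].
lra.
Qed.

Lemma powlogN a b x : powlog (- a) (- b) x = (powlog a b x)^-1.
Proof. by rewrite /powlog -expRN; congr expR; ring. Qed.

Lemma powlog_ge g n y z : 1 < y -> `|n| <= - g * ln y -> y <= z ->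
  powlog g n z <= powlog g n y.
Proof.
move=> y1 ng yz; have E x : powlog g n x = (powlog (- g) (- n) x)^-1.
  by rewrite powlogN invrK.
by rewrite !E lef_pV2 ?posrE ?powlog_gt0//; apply: powlog_le => //; rewrite normrN.
Qed.

Lemma powlog_doubling a b y z : 4 <= y -> y / 2 <= z <= 2 * y ->
  powlog a b z <= expR ((`|a| + `|b|) * ln 2) * powlog a b y.
Proof.
move=> y4 /andP[yz zy]; rewrite /powlog -expRD ler_expR.
have l2 : 0 < ln (2 : R) by apply: ln_gt0; lra.
have l4 : ln (4 : R) = 2 * ln 2.
  by rewrite (_ : 4 = 2 * 2); [rewrite lnM ?posrE//; ring | ring].
have ly4 : 2 * ln 2 <= ln y by rewrite -l4 ler_ln ?posrE//; lra.
have h1 : ln z - ln y <= ln 2.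
  have : ln z <= ln (2 * y) by rewrite ler_ln ?posrE//; lra.
  by rewrite lnM ?posrE//; lra.
have h2 : - ln 2 <= ln z - ln y.
  have : ln (y / 2) <= ln z by rewrite ler_ln ?posrE//; lra.
  by rewrite ln_div ?posrE//; lra.
have h3 : ln (ln z) - ln (ln y) <= ln 2.
  have : ln (ln z) <= ln (2 * ln y) by rewrite ler_ln ?posrE//; lra.
  by rewrite lnM ?posrE//; lra.
have h4 : - ln 2 <= ln (ln z) - ln (ln y).
  have : ln (ln y / 2) <= ln (ln z) by rewrite ler_ln ?posrE//; lra.
  by rewrite ln_div ?posrE//; lra.
have aux (k u : R) : `|u| <= ln 2 -> k * u <= `|k| * ln 2.
  by move=> hu; apply: (le_trans (ler_norm _)); rewrite normrM ler_wpM2l.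
have := aux a (ln z - ln y); rewrite ler_norml h1 h2 => /(_ isT).
have := aux b (ln (ln z) - ln (ln y)); rewrite ler_norml h3 h4 => /(_ isT).
lra.
Qed.

Lemma near_ln_ge (M : R) : \forall y \near +oo, M <= ln y.
Proof.
near=> y; rewrite -(expRK M) ler_ln ?posrE ?expR_gt0//.
Unshelve. all: by end_near. Qed.

Lemma powlog_near0 a b (e : R) : a < 0 -> 0 < e ->
  \forall y \near +oo, powlog a b y <= e.
Proof.
move=> a0 e0; pose eta := - a / (2 * (`|b| + 1)).
have b1 : 0 < `|b| + 1 by have := normr_ge0 b; lra.
have eta0 : 0 < eta by rewrite divr_gt0//; lra.
near=> y.
have ly1 : 1 <= ln y by near: y; exact: near_ln_ge.
have lly : 0 <= ln (ln y) by rewrite ln_ge0.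
have h : ln (ln y) <= eta * ln y - ln eta.
  have -> : ln (ln y) = ln (eta * ln y) - ln eta.
    by rewrite lnM ?posrE//; lra.
  have : ln (eta * ln y) < eta * ln y by apply: ln_sublinear; rewrite mulr_gt0//; lra.
  lra.
rewrite -[e]lnK ?posrE// /powlog ler_expR.
have hb : b * ln (ln y) <= (`|b| + 1) * (eta * ln y - ln eta).
  apply: (@le_trans _ _ ((`|b| + 1) * ln (ln y))).
    by apply: ler_wpM2r => //; have := ler_norm b; lra.
  by apply: ler_wpM2l => //; lra.
have E : (`|b| + 1) * eta = - a / 2 by rewrite /eta; field; rewrite gt_eqF.
have ly2 : (2 / - a) * (- ln e - (`|b| + 1) * ln eta) <= ln y.
  by near: y; exact: near_ln_ge.
have h3 : - ln e - (`|b| + 1) * ln eta <= - a / 2 * ln y.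
  have -> : - ln e - (`|b| + 1) * ln eta =
     (- a / 2) * ((2 / - a) * (- ln e - (`|b| + 1) * ln eta)).
    by field; lra.
  by apply: ler_wpM2l => //; lra.
rewrite mulrBr mulrA E in hb.
lra.
Unshelve. all: by end_near. Qed.

Lemma taylor2_bound (f f1 f2 f3 : R -> R) (y z : R) (M : R) :
  (forall x, Num.min y z <= x <= Num.max y z -> is_derive x 1 f (f1 x)) ->
  (forall x, Num.min y z <= x <= Num.max y z -> is_derive x 1 f1 (f2 x)) ->
  (forall x, Num.min y z <= x <= Num.max y z -> is_derive x 1 f2 (f3 x)) ->
  (forall x, Num.min y z <= x <= Num.max y z -> `|f3 x| <= M) ->
  `|f z - f y - f1 y * (z - y) - f2 y / 2 * (z - y) ^+ 2| <= M * `|z - y| ^+ 3.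
Proof.
move=> d1 d2 d3 hM.
have mvt (g dg : R -> R) (v : R) : Num.min y z <= v <= Num.max y z ->
    (forall x, Num.min y z <= x <= Num.max y z -> is_derive x 1 g (dg x)) ->
    exists2 x, Num.min y z <= x <= Num.max y z & `|x - y| <= `|v - y| /\
       g v - g y = dg x * (v - y).
  move=> vyz dgx.
  have cg (u w : R) : Num.min y z <= u -> w <= Num.max y z ->
     {within `[u, w], continuous g}.
    move=> hu hw; apply: derivable_within_continuous => x.
    rewrite in_itv/= => /andP[ux xw].
    have := dgx x; rewrite (le_trans hu ux) (le_trans xw hw) => /(_ isT).
    by case.
  have yl : Num.min y z <= y by rewrite ge_min lexx.
  have yr : y <= Num.max y z by rewrite le_max lexx.
  move/andP: vyz => [v1 v2].
  have [yv|/ltW vy] := leP y v.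
    have [x|x] := @MVT_segment R g dg y v yv _ (cg _ _ yl v2).
      rewrite in_itv/= => /andP[yx xv]; apply: dgx.
      by rewrite (le_trans yl (ltW yx)) (le_trans (ltW xv) v2).
    rewrite in_itv/= => /andP[yx xv] E; exists x.
      by rewrite (le_trans yl yx) (le_trans xv v2).
    by split => //; rewrite !ger0_norm; lra.
  have [x|x] := @MVT_segment R g dg v y vy _ (cg _ _ v1 yr).
    rewrite in_itv/= => /andP[vx xy]; apply: dgx.
    by rewrite (le_trans v1 (ltW vx)) (le_trans (ltW xy) yr).
  rewrite in_itv/= => /andP[vx xy] E; exists x.
    by rewrite (le_trans v1 vx) (le_trans xy yr).
  by split; [rewrite !ler0_norm; lra | lra].
pose h v := f v - f1 y * v - f2 y / 2 * (v - y) ^+ 2.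
pose h1 v := f1 v - f1 y - f2 y * (v - y).
have zz : Num.min y z <= z <= Num.max y z by rewrite ge_min le_max lexx !orbT.
have dh x : Num.min y z <= x <= Num.max y z -> is_derive x 1 h (h1 x).
  move=> /d1 dx; rewrite /h /h1.
  apply: is_derive_eq.
  by rewrite /GRing.scale/=; lra.
have dh1 x : Num.min y z <= x <= Num.max y z -> is_derive x 1 h1 (f2 x - f2 y).
  move=> /d2 dx; rewrite /h1.
  apply: is_derive_eq.
  by rewrite /GRing.scale/=; lra.
have [x xI [xz E]] := mvt h h1 z zz dh.
have [x' x'I [xz' E']] := mvt h1 _ x xI dh1.
have [x'' x''I [xz'' E'']] := mvt f2 f3 x' x'I d3.
have -> : f z - f y - f1 y * (z - y) - f2 y / 2 * (z - y) ^+ 2 = h z - h y.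
  by rewrite /h subrr expr0n /=; ring.
rewrite E; have -> : h1 x = h1 x - h1 y by rewrite /h1; ring.
rewrite E' E'' !normrM !exprS expr0 mulr1 !mulrA.
have M0 : 0 <= M by apply: le_trans (hM _ x''I).
apply: ler_wpM2r => //; apply: ler_pM => //.
by apply: ler_pM => //; [exact: hM | exact: le_trans xz' _].
Qed.

End powlog.

Section powlog_expansion.
Context {R : realType}.
Implicit Types a b g n x y z : R.

Lemma eq_powlog a b a' b' x : a = a' -> b = b' -> powlog a b x = powlog a' b' x.
Proof. by move=> -> ->. Qed.

Lemma powlog_split a b a1 b1 a2 b2 x : a = a1 + a2 -> b = b1 + b2 ->
  powlog a b x = powlog a1 b1 x * powlog a2 b2 x.
Proof. by move=> -> ->; exact: powlogD. Qed.

Definition powlog1 a b x :=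
  a * powlog (a - 1) b x + b * powlog (a - 1) (b - 1) x.
Definition powlog2 a b x :=
  a * powlog1 (a - 1) b x + b * powlog1 (a - 1) (b - 1) x.
Definition powlog3 a b x :=
  a * powlog2 (a - 1) b x + b * powlog2 (a - 1) (b - 1) x.

Lemma is_derive_powlog1 a b x : 1 < x ->
  is_derive x 1 (powlog1 a b) (powlog2 a b x).
Proof.
move=> x1; have d1 := is_derive_powlog (a - 1) b x1.
have d2 := is_derive_powlog (a - 1) (b - 1) x1.
by rewrite /powlog1 /powlog2; apply: is_deriveD; apply: is_deriveZ.
Qed.

Lemma is_derive_powlog2 a b x : 1 < x ->
  is_derive x 1 (powlog2 a b) (powlog3 a b x).
Proof.
move=> x1; have d1 := is_derive_powlog1 (a - 1) b x1.
have d2 := is_derive_powlog1 (a - 1) (b - 1) x1.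
by rewrite /powlog2 /powlog3; apply: is_deriveD; apply: is_deriveZ.
Qed.

Lemma ln_ge1_gt1 x : 1 <= ln x -> 1 < x.
Proof. by move=> l1; rewrite ltNge; apply/negP => /ln_le0; lra. Qed.

Lemma powlog_pred_log_le a b x : 1 <= ln x ->
  powlog a (b - 1) x <= powlog a b x.
Proof.
move=> l1; have x1 := ln_ge1_gt1 l1.
rewrite powlog_pred_log// ler_pdivrMr; last lra.
by rewrite ler_peMr// ltW// powlog_gt0.
Qed.

Let comb_bound a b (f g' h : R -> R) (K1 K2 : R) :
  0 <= K1 -> 0 <= K2 ->
  (forall x, 1 <= ln x -> 0 <= h x) ->
  (forall x, 1 <= ln x -> `|f x| <= K1 * h x) ->
  (forall x, 1 <= ln x -> `|g' x| <= K2 * h x) ->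
  exists2 K, 0 <= K & forall x, 1 <= ln x -> `|a * f x + b * g' x| <= K * h x.
Proof.
move=> K10 K20 h0 hf hg; exists (`|a| * K1 + `|b| * K2).
  by rewrite addr_ge0// mulr_ge0.
move=> x x1; apply: (le_trans (ler_normD _ _)); rewrite !normrM mulrDl.
by apply: lerD; rewrite -mulrA ler_wpM2l//; [apply: hf | apply: hg].
Qed.

Lemma powlog1_bound a b :
  exists2 K, 0 <= K & forall x, 1 <= ln x -> `|powlog1 a b x| <= K * powlog (a - 1) b x.
Proof.
apply: (@comb_bound _ _ _ _ _ 1 1) => // x x1.
- by rewrite ltW// powlog_gt0.
- by rewrite mul1r gtr0_norm// powlog_gt0.
- by rewrite mul1r gtr0_norm ?powlog_gt0// powlog_pred_log_le.
Qed.

Lemma powlog2_bound a b :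
  exists2 K, 0 <= K & forall x, 1 <= ln x -> `|powlog2 a b x| <= K * powlog (a - 2) b x.
Proof.
have [K1 K10 h1] := powlog1_bound (a - 1) b.
have [K2 K20 h2] := powlog1_bound (a - 1) (b - 1).
have E : a - 1 - 1 = a - 2 by ring.
rewrite E in h1 h2.
apply: (@comb_bound a b (powlog1 (a - 1) b) (powlog1 (a - 1) (b - 1)) (powlog (a - 2) b) K1 K2) => // x x1.
- by rewrite ltW// powlog_gt0.
- by apply: (le_trans (h2 _ x1)); rewrite ler_wpM2l// powlog_pred_log_le.
Qed.

Lemma powlog3_bound a b :
  exists2 K, 0 <= K & forall x, 1 <= ln x -> `|powlog3 a b x| <= K * powlog (a - 3) b x.
Proof.
have [K1 K10 h1] := powlog2_bound (a - 1) b.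
have [K2 K20 h2] := powlog2_bound (a - 1) (b - 1).
have E : a - 1 - 2 = a - 3 by ring.
rewrite E in h1 h2.
apply: (@comb_bound a b (powlog2 (a - 1) b) (powlog2 (a - 1) (b - 1)) (powlog (a - 3) b) K1 K2) => // x x1.
- by rewrite ltW// powlog_gt0.
- by apply: (le_trans (h2 _ x1)); rewrite ler_wpM2l// powlog_pred_log_le.
Qed.

Definition powlog_taylor g n y z :=
  powlog g n y + powlog1 g n y * (z - y) + powlog2 g n y / 2 * (z - y) ^+ 2.

Lemma near_small_step (kap : R) : 0 < kap ->
  \forall y \near +oo, powlog (1 - kap) 0 y <= y / 2.
Proof.
move=> k0; near=> y.
have l1 : 1 <= ln y by near: y; exact: near_ln_ge.
have y1 := ln_ge1_gt1 l1.
have h : powlog (- kap) 0 y <= 1 / 2 by near: y; apply: powlog_near0; lra.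
have -> : powlog (1 - kap) 0 y = y * powlog (- kap) 0 y.
  rewrite -[X in powlog (_ - _) X _](addr0 0) powlogD.
  by rewrite [powlog 1 0 y]powlog_powR ?powRr1//; lra.
by rewrite ler_wpM2l//; lra.
Unshelve. all: by end_near. Qed.

Lemma powlog_taylor_small g n (kap : R) : 0 < kap ->
  exists2 K, 0 <= K & \forall y \near +oo, forall z,
    `|z - y| <= powlog (1 - kap) 0 y ->
    `|powlog g n z - powlog_taylor g n y z|
      <= K * powlog (g - 2 - kap) n y * (z - y) ^+ 2.
Proof.
move=> k0; have [K3 K30 h3] := powlog3_bound g n.
pose D := expR ((`|g - 3| + `|n|) * ln (2 : R)).
have D0 : 0 < D by exact: expR_gt0.
exists (K3 * D); first by rewrite mulr_ge0// ltW.
near=> y; move=> z hz.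
have y4 : 4 <= y by near: y; apply: nbhs_pinfty_ge; rewrite num_real.
have l2 : 1 + ln 2 <= ln y by near: y; exact: near_ln_ge.
have hL : powlog (1 - kap) 0 y <= y / 2 by near: y; exact: near_small_step.
have hzy : `|z - y| <= y / 2 by lra.
have inI x : Num.min y z <= x <= Num.max y z -> y / 2 <= x <= 2 * y.
  by move: hzy; rewrite ler_norml; rewrite ge_min le_max; case: (leP y z); lra.
have xl1 x : y / 2 <= x <= 2 * y -> 1 <= ln x.
  move=> /andP[yx _]; have : ln (y / 2) <= ln x by rewrite ler_ln ?posrE; lra.
  by rewrite ln_div ?posrE; lra.
have := @taylor2_bound R (powlog g n) (powlog1 g n) (powlog2 g n) (powlog3 g n)
  y z (K3 * (D * powlog (g - 3) n y)).
have -> : powlog g n z - powlog_taylor g n y z =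
  powlog g n z - powlog g n y - powlog1 g n y * (z - y) -
   powlog2 g n y / 2 * (z - y) ^+ 2 by rewrite /powlog_taylor; ring.
move=> H; apply: le_trans (H _ _ _ _) _ => {H}.
- by move=> x /inI/xl1/ln_ge1_gt1; exact: is_derive_powlog.
- by move=> x /inI/xl1/ln_ge1_gt1; exact: is_derive_powlog1.
- by move=> x /inI/xl1/ln_ge1_gt1; exact: is_derive_powlog2.
- move=> x /inI xI; apply: (le_trans (h3 _ (xl1 _ xI))).
  by rewrite ler_wpM2l// powlog_doubling.
have -> : powlog (g - 2 - kap) n y = powlog (g - 3) n y * powlog (1 - kap) 0 y.
  by apply: powlog_split; ring.
rewrite -[(z - y) ^+ 2]real_normK ?num_real//.
have -> : K3 * (D * powlog (g - 3) n y) * `|z - y| ^+ 3 =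
  (K3 * D * powlog (g - 3) n y * `|z - y| ^+ 2) * `|z - y| by ring.
have -> : K3 * D * (powlog (g - 3) n y * powlog (1 - kap) 0 y) * `|z - y| ^+ 2 =
  (K3 * D * powlog (g - 3) n y * `|z - y| ^+ 2) * powlog (1 - kap) 0 y by ring.
by rewrite ler_wpM2l// !mulr_ge0 ?exprn_ge0// ltW// powlog_gt0.
Unshelve. all: by end_near. Qed.

Lemma powlog_doubling_ex a b : exists2 D, 0 < D &
  forall y z, 4 <= y -> y / 2 <= z <= 2 * y -> powlog a b z <= D * powlog a b y.
Proof.
exists (expR ((`|a| + `|b|) * ln (2 : R))); first exact: expR_gt0.
exact: powlog_doubling.
Qed.

Lemma powlog_large_jumpE g n p (kap y z u : R) : 0 < y -> 0 <= u ->
  `|z - y| = u * powlog (1 - kap) 0 y ->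
  powlog (g + kap * p - p) n y * `|z - y| `^ p = powlog g n y * u `^ p.
Proof.
move=> y0 u0 ->; have L0 := powlog_gt0 (1 - kap) 0 y.
rewrite (powRM _ u0 (ltW L0)).
have -> : powlog (1 - kap) 0 y `^ p = powlog ((1 - kap) * p) 0 y.
  by rewrite !powlog_powR// powRrM.
have -> : powlog g n y = powlog (g + kap * p - p) n y * powlog ((1 - kap) * p) 0 y.
  by apply: powlog_split; ring.
by ring.
Qed.

Lemma powlog_taylor_large g n p (kap : R) : 2 < p -> 0 < kap ->
  exists2 K, 0 <= K & \forall y \near +oo, forall z,
    powlog (1 - kap) 0 y <= `|z - y| ->
    `|powlog_taylor g n y z| <= K * powlog (g + kap * p - p) n y * `|z - y| `^ p.
Proof.
move=> p2 k0.
have [K1 K10 h1] := powlog1_bound g n.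
have [K2 K20 h2] := powlog2_bound g n.
exists (1 + K1 + K2); first lra.
near=> y; move=> z hz.
have l1 : 1 <= ln y by near: y; exact: near_ln_ge.
have hk : powlog (- kap) 0 y <= 1 by near: y; apply: powlog_near0; lra.
have y0 : 0 < y by have := ln_ge1_gt1 l1; lra.
have L0 := powlog_gt0 (1 - kap) 0 y.
have [u Eu] : exists u, `|z - y| = u * powlog (1 - kap) 0 y.
  by exists (`|z - y| / powlog (1 - kap) 0 y); field; rewrite gt_eqF.
have u1 : 1 <= u by rewrite -(ler_pM2r L0) mul1r -Eu.
have u0 : 0 <= u by lra.
rewrite -mulrA (powlog_large_jumpE _ _ _ y0 u0 Eu).
have u2 : u ^+ 2 <= u `^ p.
  by rewrite -(powR_mulrn 2 u0) ler_powR// ltW.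
have uu : u <= u ^+ 2 by rewrite expr2 ler_peMr.
have E1 : powlog (g - 1) n y * powlog (1 - kap) 0 y = powlog g n y * powlog (- kap) 0 y.
  by rewrite -!powlogD; apply: eq_powlog; ring.
have E2 : powlog (g - 2) n y * powlog (1 - kap) 0 y ^+ 2 =
   powlog g n y * powlog (- kap) 0 y ^+ 2.
  by rewrite !expr2 !mulrA -!powlogD; apply: eq_powlog; ring.
have h1' := h1 _ l1; have h2' := h2 _ l1.
have k00 := powlog_gt0 (- kap) 0 y.
have F0 := powlog_gt0 g n y.
have b1 : `|powlog1 g n y * (z - y)| <= K1 * (powlog g n y * u).
  rewrite normrM Eu; apply: (@le_trans _ _
    (K1 * powlog (g - 1) n y * (u * powlog (1 - kap) 0 y))).
    by rewrite ler_wpM2r// mulr_ge0// ltW.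
  have -> : K1 * powlog (g - 1) n y * (u * powlog (1 - kap) 0 y) =
    K1 * ((powlog (g - 1) n y * powlog (1 - kap) 0 y) * u) by ring.
  rewrite E1 ler_wpM2l// ler_wpM2r//.
  by rewrite ler_piMr// ltW.
have b2 : `|powlog2 g n y / 2 * (z - y) ^+ 2| <= K2 * (powlog g n y * u ^+ 2).
  rewrite normrM normrX Eu normrM [`|2^-1|]ger0_norm//.
  apply: (@le_trans _ _ (K2 * powlog (g - 2) n y * (u * powlog (1 - kap) 0 y) ^+ 2)).
    rewrite ler_wpM2r// ?exprn_ge0//; first by rewrite mulr_ge0// ltW.
    apply: le_trans h2'; rewrite ler_piMr//; lra.
  have -> : K2 * powlog (g - 2) n y * (u * powlog (1 - kap) 0 y) ^+ 2 =
     K2 * (powlog (g - 2) n y * powlog (1 - kap) 0 y ^+ 2 * u ^+ 2) by ring.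
  rewrite E2 ler_wpM2l// ler_wpM2r// ?exprn_ge0//.
  by rewrite ler_piMr ?exprn_ile1// ltW.
have Fu3 : powlog g n y * u ^+ 2 <= powlog g n y * u `^ p by rewrite ler_pM2l.
have Fu2 : powlog g n y * u <= powlog g n y * u `^ p.
  by rewrite ler_pM2l// (le_trans uu).
have Fu1 : powlog g n y <= powlog g n y * u `^ p.
  by rewrite ler_peMr ?(le_trans u1)// ?(le_trans uu)// ltW.
have k1 : K1 * (powlog g n y * u) <= K1 * (powlog g n y * u `^ p) by rewrite ler_wpM2l.
have k2 : K2 * (powlog g n y * u ^+ 2) <= K2 * (powlog g n y * u `^ p).
  by rewrite ler_wpM2l.
rewrite /powlog_taylor.
apply: (le_trans (ler_normD _ _)); apply: (le_trans (lerD (ler_normD _ _) (lexx _))).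
have -> : (1 + K1 + K2) * (powlog g n y * u `^ p) = powlog g n y * u `^ p +
  K1 * (powlog g n y * u `^ p) + K2 * (powlog g n y * u `^ p) by ring.
rewrite (gtr0_norm F0).
by apply: lerD (lerD Fu1 (le_trans b1 k1)) (le_trans b2 k2).
Unshelve. all: by end_near. Qed.

Lemma powlog_max_large g n p (kap B : R) : 0 < g -> g < p -> 0 < kap ->
  1 < B -> `|n| <= g * ln B ->
  exists2 K, 0 <= K & \forall y \near +oo, forall z,
    powlog (1 - kap) 0 y <= `|z - y| ->
    powlog g n (Num.max z B) <= K * powlog (g + kap * p - p) n y * `|z - y| `^ p.
Proof.
move=> g0 gp k0 B1 nB.
have [D D0 hD] := powlog_doubling_ex g n.
exists D; first exact: ltW.
have nB' (v : R) : B <= v -> `|n| <= g * ln v.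
  move=> Bv; apply: (le_trans nB); rewrite ler_wpM2l ?(ltW g0)//.
  by rewrite ler_ln ?posrE//; lra.
near=> y; move=> z hz.
have y4 : 4 <= y by near: y; apply: nbhs_pinfty_ge; rewrite num_real.
have yB : B <= y by near: y; apply: nbhs_pinfty_ge; rewrite num_real.
have l2 : `|n| / (p - g) <= ln y by near: y; exact: near_ln_ge.
have y0 : 0 < y by lra.
have L0 := powlog_gt0 (1 - kap) 0 y.
rewrite -mulrA.
have [z2y|z2y] := leP z (2 * y).
  have [u Eu] : exists u, `|z - y| = u * powlog (1 - kap) 0 y.
    by exists (`|z - y| / powlog (1 - kap) 0 y); field; rewrite gt_eqF.
  have u1 : 1 <= u by rewrite -(ler_pM2r L0) mul1r -Eu.
  have u0 : 0 <= u by lra.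
  rewrite (powlog_large_jumpE _ _ _ y0 u0 Eu).
  apply: (@le_trans _ _ (powlog g n (2 * y))).
    apply: powlog_le.
    - by rewrite lt_max B1 orbT.
    - by apply: nB'; rewrite le_max lexx orbT.
    - by rewrite ge_max z2y/=; lra.
  apply: (@le_trans _ _ (D * powlog g n y)); first by apply: hD => //; lra.
  rewrite ler_pM2l// ler_peMr ?(ltW (powlog_gt0 _ _ _))//.
  by rewrite -(powRr0 u) ler_powR//; lra.
have -> : Num.max z B = z by apply/max_idPl; lra.
have -> : `|z - y| = z - y by rewrite gtr0_norm; lra.
apply: (@le_trans _ _ (powlog g n (2 * (z - y)))).
  by apply: powlog_le; [lra | apply: nB'; lra | lra].
apply: (@le_trans _ _ (D * powlog g n (z - y))).
  by apply: hD; lra.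
rewrite ler_pM2l// -powlog_powR; last lra.
have -> : powlog g n (z - y) = powlog (g - p) n (z - y) * powlog p 0 (z - y).
  by apply: powlog_split; ring.
rewrite ler_pM2r ?powlog_gt0//.
apply: (@le_trans _ _ (powlog (g - p) n y)).
  apply: powlog_ge; [lra | | lra].
  by rewrite -ler_pdivrMl; [rewrite opprB mulrC | lra].
have -> : powlog (g + kap * p - p) n y = powlog (g - p) n y * powlog (kap * p) 0 y.
  by apply: powlog_split; ring.
rewrite ler_peMr ?(ltW (powlog_gt0 _ _ _))//.
rewrite powlog_powR// -(powRr0 y); apply: ler_powR; first lra.
by rewrite mulr_ge0//; lra.
Unshelve. all: by end_near. Qed.

End powlog_expansion.

Section powlog_drift.
Context {R : realType}.
Implicit Types g n c p delta C kap y z : R.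

Lemma powlog1E g n y : 1 < y ->
  powlog1 g n y = powlog (g - 2) (n - 1) y * (y * (g * ln y + n)).
Proof.
move=> y1; have l0 : 0 < ln y by exact: ln_gt0.
have y0 : 0 < y by lra.
rewrite /powlog1 powlog_pred_log//.
have -> : powlog (g - 2) (n - 1) y = powlog (g - 1) n y / y / ln y.
  rewrite powlog_pred_log//; congr (_ / _).
  by rewrite -powlog_pred_pow//; apply: eq_powlog => //; ring.
by field; rewrite !gt_eqF.
Qed.

Lemma powlog2E g n y : 1 < y ->
  powlog2 g n y = powlog (g - 2) (n - 1) y *
    (g * (g - 1) * ln y + n * (2 * g - 1) + n * (n - 1) / ln y).
Proof.
move=> y1; have l0 : 0 < ln y by exact: ln_gt0.
have E : g - 1 - 1 = g - 2 by ring.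
rewrite /powlog2 /powlog1 E (powlog_pred_log _ (n - 1))// powlog_pred_log//.
by field; rewrite gt_eqF.
Qed.

Let error_terms g n c y (s2 Q l q e1 e2 eps M : R) :
  0 < g -> 0 <= Q -> 0 < y -> 1 <= l -> 0 <= q -> 0 <= eps -> c = s2 * (1 - g) / 2 ->
  M = g + `|n| + `|g * (g - 1)| + `|n * (2 * g - 1)| + `|n * (n - 1)| ->
  `|e1 - c / y * q| <= eps / (y * l) * q ->
  `|e2 - s2 * q| <= eps / l * q ->
  `|Q * (y * (g * l + n)) * e1
    + Q * (g * (g - 1) * l + n * (2 * g - 1) + n * (n - 1) / l) / 2 * e2
    - n * g * s2 / 2 * Q * q|
  <= (M * eps + `|s2 * n * (n - 1)| / l) * (Q * q).
Proof.
move=> g0 Q0 y0 l1 q0 eps0 -> EM he1 he2.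
have l0 : 0 < l by lra.
set F2 := g * (g - 1) * l + n * (2 * g - 1) + n * (n - 1) / l.
have -> : Q * (y * (g * l + n)) * e1 + Q * F2 / 2 * e2 - n * g * s2 / 2 * Q * q =
   Q * (y * (g * l + n)) * (e1 - s2 * (1 - g) / 2 / y * q)
   + (Q * F2 / 2 * (e2 - s2 * q) + s2 * n * (n - 1) / (2 * l) * (Q * q)).
  by rewrite /F2; field; rewrite !gt_eqF.
have Qq : 0 <= Q * q by rewrite mulr_ge0.
have b1 : `|Q * (y * (g * l + n)) * (e1 - s2 * (1 - g) / 2 / y * q)|
    <= (g + `|n|) * eps * (Q * q).
  rewrite !normrM (ger0_norm Q0) (gtr0_norm y0).
  have h : `|g * l + n| <= (g + `|n|) * l.
    apply: (le_trans (ler_normD _ _)); rewrite normrM (gtr0_norm g0) (gtr0_norm l0).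
    by rewrite mulrDl lerD2l ler_peMr.
  apply: (@le_trans _ _ (Q * (y * ((g + `|n|) * l)) * (eps / (y * l) * q))).
    by rewrite ler_pM ?mulr_ge0 ?(ltW y0)// ler_wpM2l// ler_wpM2l// ltW.
  rewrite [leLHS](_ : _ = (g + `|n|) * eps * (Q * q))//.
  by field; rewrite !gt_eqF.
have hF2 : `|F2| <= (`|g * (g - 1)| + `|n * (2 * g - 1)| + `|n * (n - 1)|) * l.
  rewrite /F2; apply: (le_trans (ler_normD _ _)).
  apply: (le_trans (lerD (ler_normD _ _) (lexx _))).
  rewrite !mulrDl; apply: lerD; first apply: lerD.
  - by rewrite [`|_ * l|]normrM (gtr0_norm l0).
  - by rewrite ler_peMr.
  - rewrite [`|_ / l|]normrM [`|l^-1|]gtr0_norm ?invr_gt0// ler_wpM2l//.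
    by apply: (@le_trans _ _ 1) => //; rewrite invf_le1.
have [A EA] : exists A, A = `|g * (g - 1)| + `|n * (2 * g - 1)| + `|n * (n - 1)|.
  by eexists; reflexivity.
rewrite -EA in hF2.
have b2 : `|Q * F2 / 2 * (e2 - s2 * q)| <= A * eps * (Q * q).
  rewrite !normrM (ger0_norm Q0) [`|2^-1|]ger0_norm//.
  have -> : A * eps * (Q * q) = Q * (A * l) * (eps / l * q).
    by field; rewrite gt_eqF.
  rewrite ler_pM ?mulr_ge0//.
  by rewrite -mulrA ler_wpM2l//; apply: (le_trans _ hF2); rewrite ler_piMr//; lra.
have b3 : `|s2 * n * (n - 1) / (2 * l) * (Q * q)| <= `|s2 * n * (n - 1)| / l * (Q * q).
  rewrite normrM (ger0_norm Qq) ler_wpM2r//.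
  rewrite normrM [`|(2 * l)^-1|]gtr0_norm ?invr_gt0; last lra.
  by rewrite ler_wpM2l// lef_pV2 ?posrE; lra.
apply: (le_trans (ler_normD _ _)).
apply: (le_trans (lerD (lexx _) (ler_normD _ _))).
apply: (le_trans (lerD b1 (lerD b2 b3))).
rewrite [leLHS](_ : _ = (M * eps + `|s2 * n * (n - 1)| / l) * (Q * q))//.
have -> : M = g + `|n| + A by rewrite EM EA; lra.
ring.
Qed.

Lemma powlog_moments g n c p delta C kap (s2 K1 K2 : R) :
  0 < g -> n != 0 -> 0 < s2 -> c = s2 * (1 - g) / 2 -> 2 < p -> 0 < delta ->
  kap = delta / (2 * p) -> 0 <= K1 -> 0 <= K2 ->
  exists2 eps, 0 < eps & \forall y \near +oo, forall q e1 e2 ep : R,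
    0 <= q ->
    `|e1 - c / y * q| <= eps / (y * ln y) * q ->
    `|e2 - s2 * q| <= eps / ln y * q ->
    ep <= C * (1 + y) `^ (p - 2 - delta) * q ->
    `|powlog1 g n y * e1 + powlog2 g n y / 2 * e2
      - n * g * s2 / 2 * powlog (g - 2) (n - 1) y * q|
    + (K1 * powlog (g - 2 - kap) n y * e2 + K2 * powlog (g + kap * p - p) n y * ep)
    <= `|n| * g * s2 / 2 * powlog (g - 2) (n - 1) y * q.
Proof.
move=> g0 n0 s20 Ec p2 d0 Ek K10 K20.
have [M EM] : exists M,
    M = g + `|n| + `|g * (g - 1)| + `|n * (2 * g - 1)| + `|n * (n - 1)|.
  by eexists; reflexivity.
have [th Eth] : exists th, th = `|n| * g * s2 / 8 by eexists; reflexivity.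
have nn0 : 0 < `|n| by rewrite normr_gt0.
have th0 : 0 < th by rewrite Eth divr_gt0// !mulr_gt0.
have M0 : 0 < M by rewrite EM -!addrA ltr_pwDl// !addr_ge0.
have [D D0 hD] := powlog_doubling_ex (p - 2 - delta) 0.
have k0 : 0 < kap by rewrite Ek divr_gt0//; lra.
exists (Num.min 1 (th / M)); first by rewrite lt_min ltr01 divr_gt0.
set eps := Num.min _ _.
have eps0 : 0 <= eps by rewrite /eps le_min ler01 divr_ge0// ltW.
have eps1 : eps <= 1 by rewrite /eps ge_min lexx.
have epsM : M * eps <= th.
  by rewrite mulrC -ler_pdivlMr// /eps ge_min lexx orbT.
move: eps eps0 eps1 epsM => eps eps0 eps1 epsM.
near=> y; move=> q e1 e2 ep q0 he1 he2 hep.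
have y4 : 4 <= y by near: y; apply: nbhs_pinfty_ge; rewrite num_real.
have l1 : 1 <= ln y by near: y; exact: near_ln_ge.
have y1 : 1 < y by apply: lt_le_trans y4; lra.
have y0 : 0 < y by exact: lt_trans y1.
have l0 : 0 < ln y by exact: lt_le_trans l1.
have p0 : p != 0 by rewrite gt_eqF// (lt_trans _ p2).
have y01 : 0 < 1 + y by rewrite addr_gt0.
have y12 : y / 2 <= 1 + y <= 2 * y by clear -y4; lra.
have l2 : `|s2 * n * (n - 1)| / th <= ln y by near: y; exact: near_ln_ge.
have h1 : powlog (- kap) 1 y <= th / (K1 * (s2 + 1) + 1).
  near: y; apply: powlog_near0; first lra.
  by rewrite divr_gt0// ltr_wpDl// mulr_ge0//; lra.
have h2 : powlog (- (delta / 2)) 1 y <= th / (K2 * (`|C| * D) + 1).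
  near: y; apply: powlog_near0; first lra.
  by rewrite divr_gt0// ltr_wpDl// !mulr_ge0// ltW.
have Q0 : 0 < powlog (g - 2) (n - 1) y := powlog_gt0 _ _ _.
rewrite powlog1E// powlog2E//.
have -> : powlog (g - 2 - kap) n y = powlog (g - 2) (n - 1) y * powlog (- kap) 1 y.
  by apply: powlog_split; ring.
have hyp : C * (1 + y) `^ (p - 2 - delta) <= `|C| * D * powlog (p - 2 - delta) 0 y.
  apply: (@le_trans _ _ (`|C| * (1 + y) `^ (p - 2 - delta))).
    by rewrite ler_wpM2r ?powR_ge0// ler_norm.
  by rewrite -mulrA ler_wpM2l// -powlog_powR//; exact: hD.
have EpQ : powlog (g + kap * p - p) n y * powlog (p - 2 - delta) 0 y =
    powlog (g - 2) (n - 1) y * powlog (- (delta / 2)) 1 y.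
  rewrite -!powlogD; apply: eq_powlog; last ring.
  by rewrite Ek; field.
move: (powlog (g - 2) (n - 1) y) Q0 EpQ => Q Q0 EpQ.
have Qq : 0 <= Q * q by rewrite mulr_ge0// ltW.
have b1 := error_terms g0 (ltW Q0) y0 l1 q0 eps0 Ec EM he1 he2.
have b1' : (M * eps + `|s2 * n * (n - 1)| / ln y) * (Q * q) <= 2 * th * (Q * q).
  rewrite ler_wpM2r//.
  have : `|s2 * n * (n - 1)| / ln y <= th.
    by rewrite ler_pdivrMr// [th * _]mulrC -ler_pdivrMr.
  by clear -epsM; lra.
have he2' : e2 <= (s2 + 1) * q.
  move: he2; rewrite ler_norml => /andP[_ H].
  have : eps / ln y * q <= 1 * q.
    by rewrite ler_wpM2r// ler_pdivrMr// mul1r (le_trans eps1).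
  by clear -H; lra.
have b2 : K1 * (Q * powlog (- kap) 1 y) * e2 <= th * (Q * q).
  apply: (@le_trans _ _ (K1 * (Q * powlog (- kap) 1 y) * ((s2 + 1) * q))).
    by rewrite ler_wpM2l// !mulr_ge0 ?(ltW Q0)// ltW// powlog_gt0.
  have -> : K1 * (Q * powlog (- kap) 1 y) * ((s2 + 1) * q) =
     (powlog (- kap) 1 y * (K1 * (s2 + 1))) * (Q * q) by ring.
  rewrite ler_wpM2r//.
  have K10' : 0 <= K1 * (s2 + 1) by rewrite mulr_ge0// ltW// addr_gt0.
  have H := powlog_gt0 (- kap) 1 y.
  have K1p : 0 < K1 * (s2 + 1) + 1 by rewrite ltr_wpDl.
  by move: h1; rewrite ler_pdivlMr// mulrDr mulr1; clear -H; lra.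
have b3 : K2 * powlog (g + kap * p - p) n y * ep <=
    K2 * powlog (g + kap * p - p) n y * (`|C| * D * powlog (p - 2 - delta) 0 y * q).
  rewrite ler_wpM2l// ?mulr_ge0// ?(ltW (powlog_gt0 _ _ _))//.
  by apply: (le_trans hep); rewrite ler_wpM2r.
have b4 : K2 * powlog (g + kap * p - p) n y * (`|C| * D * powlog (p - 2 - delta) 0 y * q)
    <= th * (Q * q).
  have -> : K2 * powlog (g + kap * p - p) n y * (`|C| * D * powlog (p - 2 - delta) 0 y * q)
    = K2 * (`|C| * D) * (powlog (g + kap * p - p) n y * powlog (p - 2 - delta) 0 y) * q by ring.
  rewrite EpQ.
  have -> : K2 * (`|C| * D) * (Q * powlog (- (delta / 2)) 1 y) * q =
    (powlog (- (delta / 2)) 1 y * (K2 * (`|C| * D))) * (Q * q) by ring.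
  rewrite ler_wpM2r//.
  have K20' : 0 <= K2 * (`|C| * D) by rewrite !mulr_ge0// ltW.
  have H := powlog_gt0 (- (delta / 2)) 1 y.
  have K2p : 0 < K2 * (`|C| * D) + 1 by rewrite ltr_wpDl.
  by move: h2; rewrite ler_pdivlMr// mulrDr mulr1; clear -H; lra.
have -> : `|n| * g * s2 / 2 * Q * q = 4 * th * (Q * q) by rewrite Eth; field.
apply: (le_trans (lerD (le_trans b1 b1') (lerD b2 (le_trans b3 b4)))).
by clear; lra.
Unshelve. all: by end_near. Qed.

End powlog_drift.

Section powlog_test_functions.
Context {R : realType}.
Implicit Types g n c p delta C kap y z : R.

Lemma powlog_superharmonic g n c p delta C (s2 B : R) :
  0 < g -> n < 0 -> 0 < s2 -> c = s2 * (1 - g) / 2 -> 2 < p -> g < p -> 0 < delta ->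
  1 < B -> `|n| <= g * ln B ->
  exists2 eps, 0 < eps & \forall y \near +oo, exists a b k : R,
    (forall z, powlog g n (Num.max z B)
       <= powlog g n y + a * (z - y) + b * (z - y) ^+ 2 + k * `|z - y| `^ p) /\
    (forall q e1 e2 ep : R, 0 <= q ->
      `|e1 - c / y * q| <= eps / (y * ln y) * q ->
      `|e2 - s2 * q| <= eps / ln y * q ->
      ep <= C * (1 + y) `^ (p - 2 - delta) * q ->
      a * e1 + b * e2 + k * ep <= 0).
Proof.
move=> g0 n0 s20 Ec p2 gp d0 B1 nB.
have [kap Ek] : exists kap, kap = delta / (2 * p) by eexists; reflexivity.
have k0 : 0 < kap by rewrite Ek divr_gt0//; lra.
have [K1 K10 [M1 [_ H1]]] := @powlog_taylor_small R g n kap k0.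
have [K2 K20 [M2 [_ H2]]] := @powlog_taylor_large R g n p kap p2 k0.
have [K3 K30 [M3 [_ H3]]] := @powlog_max_large R g n p kap B g0 gp k0 B1 nB.
have K230 : 0 <= K2 + K3 by rewrite addr_ge0.
have [eps eps0 [M [_ H]]] := @powlog_moments R g n c p delta C kap s2 K1 (K2 + K3) g0 (ltr0_neq0 n0)
  s20 Ec p2 d0 Ek K10 K230.
exists eps => //; near=> y.
have yB : 2 * B <= y by near: y; apply: nbhs_pinfty_ge; rewrite num_real.
have hL : powlog (1 - kap) 0 y <= y / 2 by near: y; exact: near_small_step.
have h1 : M1 < y by near: y; apply: nbhs_pinfty_gt; rewrite num_real.
have h2 : M2 < y by near: y; apply: nbhs_pinfty_gt; rewrite num_real.
have h3 : M3 < y by near: y; apply: nbhs_pinfty_gt; rewrite num_real.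
have h : M < y by near: y; apply: nbhs_pinfty_gt; rewrite num_real.
have P1 := powlog_gt0 (g - 2 - kap) n y.
have P2 := powlog_gt0 (g + kap * p - p) n y.
exists (powlog1 g n y), (powlog2 g n y / 2 + K1 * powlog (g - 2 - kap) n y),
  ((K2 + K3) * powlog (g + kap * p - p) n y); split => [z|q e1 e2 ep q0 he1 he2 hep].
  have p0 : 0 <= `|z - y| `^ p by exact: powR_ge0.
  have [hz|/ltW hz] := leP `|z - y| (powlog (1 - kap) 0 y).
    have zB : Num.max z B = z.
      by apply/max_idPl; move: (le_trans hz hL); rewrite ler_norml; clear -yB; lra.
    rewrite zB; have := H1 _ h1 z hz; rewrite ler_norml => /andP[_].
    have : 0 <= (K2 + K3) * powlog (g + kap * p - p) n y * `|z - y| `^ p.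
      by rewrite !mulr_ge0// ltW.
    by rewrite /powlog_taylor; clear; lra.
  have := H3 _ h3 z hz; have := H2 _ h2 z hz; rewrite ler_norml => /andP[+ _].
  have : 0 <= K1 * powlog (g - 2 - kap) n y * (z - y) ^+ 2.
    by apply: mulr_ge0 (sqr_ge0 _); apply: mulr_ge0 => //; exact: ltW.
  by rewrite /powlog_taylor; clear; lra.
have := H _ h q e1 e2 ep q0 he1 he2 hep.
rewrite (ltr0_norm n0).
have := ler_norm (powlog1 g n y * e1 + powlog2 g n y / 2 * e2
  - n * g * s2 / 2 * powlog (g - 2) (n - 1) y * q).
by clear; lra.
Unshelve. all: by end_near. Qed.

Lemma powlog_subharmonic g n c p delta C (s2 : R) :
  0 < g -> 0 < n -> 0 < s2 -> c = s2 * (1 - g) / 2 -> 2 < p -> 0 < delta ->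
  exists2 eps, 0 < eps & \forall y \near +oo, exists a b k : R,
    (forall z v, 0 <= v -> (y / 2 <= z <= 2 * y -> powlog g n z <= v) ->
       powlog g n y + a * (z - y) + b * (z - y) ^+ 2 + k * `|z - y| `^ p <= v) /\
    (forall q e1 e2 ep : R, 0 <= q ->
      `|e1 - c / y * q| <= eps / (y * ln y) * q ->
      `|e2 - s2 * q| <= eps / ln y * q ->
      ep <= C * (1 + y) `^ (p - 2 - delta) * q ->
      0 <= a * e1 + b * e2 + k * ep).
Proof.
move=> g0 n0 s20 Ec p2 d0.
have [kap Ek] : exists kap, kap = delta / (2 * p) by eexists; reflexivity.
have k0 : 0 < kap by rewrite Ek divr_gt0//; lra.
have [K1 K10 [M1 [_ H1]]] := @powlog_taylor_small R g n kap k0.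
have [K2 K20 [M2 [_ H2]]] := @powlog_taylor_large R g n p kap p2 k0.
have [eps eps0 [M [_ H]]] := @powlog_moments R g n c p delta C kap s2 K1 K2 g0 (lt0r_neq0 n0)
  s20 Ec p2 d0 Ek K10 K20.
exists eps => //; near=> y.
have y0 : 0 <= y by near: y; apply: nbhs_pinfty_ge; rewrite num_real.
have hL : powlog (1 - kap) 0 y <= y / 2 by near: y; exact: near_small_step.
have h1 : M1 < y by near: y; apply: nbhs_pinfty_gt; rewrite num_real.
have h2 : M2 < y by near: y; apply: nbhs_pinfty_gt; rewrite num_real.
have h : M < y by near: y; apply: nbhs_pinfty_gt; rewrite num_real.
have P1 := powlog_gt0 (g - 2 - kap) n y.
have P2 := powlog_gt0 (g + kap * p - p) n y.
exists (powlog1 g n y), (powlog2 g n y / 2 - K1 * powlog (g - 2 - kap) n y),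
  (- (K2 * powlog (g + kap * p - p) n y)); split => [z v v0 hv|q e1 e2 ep q0 he1 he2 hep].
  have p0 : 0 <= `|z - y| `^ p by exact: powR_ge0.
  have [hz|/ltW hz] := leP `|z - y| (powlog (1 - kap) 0 y).
    have /hv {}hv : y / 2 <= z <= 2 * y.
      by move: (le_trans hz hL); rewrite ler_norml; clear -y0; lra.
    have := H1 _ h1 z hz; rewrite ler_norml => /andP[+ _].
    have : 0 <= K2 * powlog (g + kap * p - p) n y * `|z - y| `^ p.
      by rewrite !mulr_ge0// ltW.
    by rewrite /powlog_taylor; clear -hv; lra.
  have := H2 _ h2 z hz; rewrite ler_norml => /andP[_ +].
  have : 0 <= K1 * powlog (g - 2 - kap) n y * (z - y) ^+ 2.
    by apply: mulr_ge0 (sqr_ge0 _); apply: mulr_ge0 => //; exact: ltW.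
  by rewrite /powlog_taylor; clear -v0; lra.
have := H _ h q e1 e2 ep q0 he1 he2 hep.
rewrite (gtr0_norm n0).
have := ler_norm (- (powlog1 g n y * e1 + powlog2 g n y / 2 * e2
  - n * g * s2 / 2 * powlog (g - 2) (n - 1) y * q)); rewrite normrN.
by clear; lra.
Unshelve. all: by end_near. Qed.

Lemma powlog_max_growth g n p (B A : R) : 0 < g -> g < p -> 1 < B ->
  `|n| <= g * ln B ->
  exists2 K, 0 <= K & forall y z, 0 <= y <= A ->
    powlog g n (Num.max z B) <= K * (1 + `|z - y| `^ p).
Proof.
move=> g0 gp B1 nB.
pose A' := Num.max (Num.max A B) (expR (`|n| / (p - g))).
have [A1 A2 A3] : [/\ A <= A', B <= A' & `|n| <= (p - g) * ln A'].
  split; [by rewrite !le_max lexx|by rewrite !le_max lexx orbT|].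
  rewrite -ler_pdivrMl ?subr_gt0// mulrC -[leLHS]expRK ler_ln ?posrE ?expR_gt0//.
    by rewrite /A' le_max lexx orbT.
  by rewrite /A' lt_max expR_gt0 orbT.
move: A' A1 A2 A3 => A' A1 A2 A3.
have P0 := powlog_gt0 g n (2 * A').
have P1 := powlog_gt0 (g - p) n A'.
have P2 : 0 < (2 : R) `^ p by apply: powR_gt0.
exists (powlog g n (2 * A') + powlog (g - p) n A' * 2 `^ p).
  by rewrite addr_ge0// ?mulr_ge0// ltW.
move=> y z /andP[y0 yA].
have p0 : 0 <= `|z - y| `^ p by exact: powR_ge0.
have [zA|zA] := leP z (2 * A').
  apply: (@le_trans _ _ (powlog g n (2 * A'))).
    apply: powlog_le; [by rewrite lt_max B1 orbT | |rewrite ge_max zA; lra].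
    apply: (le_trans nB); rewrite ler_wpM2l ?(ltW g0)//.
    by rewrite ler_ln ?posrE ?le_max ?lt_max ?lexx ?orbT//; lra.
  apply: (@le_trans _ _ (powlog g n (2 * A') * 1)); first by rewrite mulr1.
  apply: ler_pM => //; [exact: ltW | | by rewrite lerDl].
  by rewrite lerDl mulr_ge0// ltW.
have -> : Num.max z B = z by apply/max_idPl; lra.
have -> : powlog g n z = powlog (g - p) n z * z `^ p.
  by rewrite -powlog_powR; [apply: powlog_split; ring | lra].
apply: (@le_trans _ _ (powlog (g - p) n A' * (2 `^ p * `|z - y| `^ p))).
  apply: ler_pM; [by rewrite ltW// powlog_gt0 | exact: powR_ge0 | |].
    by apply: powlog_ge; [lra | rewrite opprB | lra].
  rewrite -powRM//; apply: ge0_ler_powR; rewrite ?nnegrE ?mulr_ge0//; try lra.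
  by rewrite ger0_norm; lra.
rewrite mulrA; apply: ler_pM => //; first by rewrite mulr_ge0// ltW.
  by rewrite lerDr ltW.
by rewrite lerDr.
Qed.

End powlog_test_functions.

Section conditional_integrals.
Context {R : realType} {d : measure_display} {T : measurableType d}.
Context (P : probability T R).

Definition integrableR (D : set T) (f : T -> R) :=
  integrable P D (EFin \o f).

Lemma prE (A : set T) : measurable A -> P A = (pr P A)%:E.
Proof. by move=> mA; rewrite /pr fineK// fin_num_measure. Qed.

Lemma pr_ge0 (A : set T) : 0 <= pr P A.
Proof. by rewrite /pr fine_ge0. Qed.

Lemma pr_le1 (A : set T) : measurable A -> pr P A <= 1.
Proof. by move=> mA; rewrite -lee_fin -prE// probability_le1. Qed.

Lemma le_pr (A B : set T) : measurable A -> measurable B -> A `<=` B ->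
  pr P A <= pr P B.
Proof.
by move=> mA mB AB; rewrite -lee_fin -!prE// le_measure// inE.
Qed.

Lemma prU (A B : set T) : measurable A -> measurable B -> A `&` B = set0 ->
  pr P (A `|` B) = pr P A + pr P B.
Proof.
move=> mA mB AB; apply: EFin_inj.
by rewrite EFinD -!prE// ?measureU//; exact: measurableU.
Qed.

Lemma EFin_Rintegral (D : set T) (f : T -> R) : measurable D -> integrableR D f ->
  (\int[P]_(w in D) f w)%:E = (\int[P]_(w in D) (f w)%:E)%E.
Proof. by move=> mD fi; rewrite /Rintegral fineK//; exact: integrable_fin_num. Qed.

Lemma Rintegral_cstE (D : set T) (k : R) : measurable D ->
  \int[P]_(w in D) k = k * pr P D.
Proof. by move=> mD; rewrite (Rintegral_cst P mD k). Qed.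

Lemma integrableR_cst (D : set T) (k : R) : measurable D ->
  integrableR D (fun=> k).
Proof. by move=> mD; exact: finite_measure_integrable_cst. Qed.

Lemma Rintegral_const_on (D : set T) (f : T -> R) (k : R) : measurable D ->
  (forall w, D w -> f w = k) ->
  integrableR D f /\ \int[P]_(w in D) f w = k * pr P D.
Proof.
move=> mD fk; split.
  apply: (@eq_integrable _ _ _ P D mD (EFin \o cst k)).
    by move=> w /set_mem /fk /= ->.
  exact: finite_measure_integrable_cst.
rewrite -(Rintegral_cstE k mD); apply: eq_Rintegral => w /set_mem; exact: fk.
Qed.

Lemma integrableRD (D : set T) (f g : T -> R) : measurable D ->
  integrableR D f -> integrableR D g -> integrableR D (fun w => f w + g w).
Proof. by move=> mD fi gi; have := integrableD mD fi gi. Qed.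

Lemma integrableRZ (D : set T) (f : T -> R) (k : R) : measurable D ->
  integrableR D f -> integrableR D (fun w => k * f w).
Proof. by move=> mD fi; have := integrableZl mD k fi. Qed.

Lemma integrableR_le (D : set T) (f g : T -> R) : measurable D ->
  measurable_fun D f -> (forall w, D w -> `|f w| <= g w) ->
  integrableR D g -> integrableR D f.
Proof.
move=> mD mf fg gi; apply: (le_integrable mD _ _ gi).
  exact/measurable_EFinP.
by move=> w Dw; rewrite lee_fin (le_trans (fg _ Dw))// ler_norm.
Qed.

Lemma integrableRU (A B : set T) (f : T -> R) : measurable A -> measurable B ->
  A `&` B = set0 -> integrableR A f -> integrableR B f -> integrableR (A `|` B) f.
Proof.
move=> mA mB AB /integrableP[mfA iA] /integrableP[mfB iB].
have mf : measurable_fun (A `|` B) (EFin \o f) by apply/measurable_funU.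
apply/integrableP; split => //.
rewrite ge0_integral_setU//; first by rewrite lte_add_pinfty.
- by apply: measurableT_comp.
- by apply/disj_setPS; rewrite AB.
Qed.

Lemma Rintegral_setUE (A B : set T) (f : T -> R) : measurable A -> measurable B ->
  A `&` B = set0 -> integrableR A f -> integrableR B f ->
  \int[P]_(w in A `|` B) f w = \int[P]_(w in A) f w + \int[P]_(w in B) f w.
Proof.
move=> mA mB AB fA fB; apply: Rintegral_setU => //; first exact: integrableRU.
by apply/disj_setPS; rewrite AB.
Qed.

Lemma Rintegral_subset (A B : set T) (f : T -> R) : measurable A -> measurable B ->
  A `<=` B -> (forall w, 0 <= f w) -> integrableR B f ->
  integrableR A f /\ \int[P]_(w in A) f w <= \int[P]_(w in B) f w.
Proof.
move=> mA mB AB f0 iB; have mBA := measurableD mB mA.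
have iA : integrableR A f by exact: (integrableS mB mA AB iB).
have iBA : integrableR (B `\` A) f.
  by apply: (integrableS mB mBA _ iB); exact: subDsetl.
split => //; have <- : A `|` (B `\` A) = B by exact: setDUK.
rewrite Rintegral_setUE//; last exact: setDIK.
by rewrite lerDl; apply: Rintegral_ge0.
Qed.

Lemma G_measE_measurable (G : set (set T)) (Z : T -> \bar R) :
  Defs.sub_sigma_algebra G -> G_measE G Z -> measurable_fun setT Z.
Proof. by move=> [_ Gm] GZ _ B mB; rewrite setTI; apply/Gm/GZ. Qed.

Lemma cond_exp_ae_le (G : set (set T)) (Yp Ym Zp Zm : T -> \bar R) (D : set T) (a b : R) :
  Defs.sub_sigma_algebra G -> cond_exp_nng P G Yp Zp -> cond_exp_nng P G Ym Zm ->
  G D -> 0 <= a -> 0 <= b ->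
  {ae P, forall w, D w -> (Zp w + a%:E <= Zm w + b%:E)%E} ->
  (\int[P]_(w in D) Yp w + (a * pr P D)%:E <= \int[P]_(w in D) Ym w + (b * pr P D)%:E)%E.
Proof.
move=> HG [Zp0 mZp EZp] [Zm0 mZm EZm] GD a0 b0 h.
have mD : measurable D by exact: HG.2.
have mp := measurable_funS measurableT (@subsetT _ D) (G_measE_measurable HG mZp).
have mm := measurable_funS measurableT (@subsetT _ D) (G_measE_measurable HG mZm).
have E (k : R) : (k * pr P D)%:E = (\int[P]_(w in D) (cst k%:E) w)%E.
  by rewrite integral_cst// EFinM -prE.
rewrite !E EZp// EZm// -!ge0_integralD//.
apply: ae_ge0_le_integral => //.
- by move=> w _; rewrite adde_ge0.
- exact: emeasurable_funD.
- by move=> w _; rewrite adde_ge0.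
- exact: emeasurable_funD.
Qed.

Lemma cond_exp0 (G : set (set T)) : sigma_algebra setT G ->
  cond_exp_nng P G (fun=> 0%E) (fun=> 0%E).
Proof.
move=> [G0 GC _]; split => // B mB.
rewrite preimage_cst; case: ifP => _ //.
by rewrite -setC0 -setTD; exact: GC.
Qed.

End conditional_integrals.
Arguments integrableR {R d T} P D f.

Section adapted_process.
Context {R : realType} {d : measure_display} {T : measurableType d}.
Context {P : probability T R} {S : set R} {F : nat -> set (set T)} {X : nat -> T -> R}.
Context (SS : state_space S) (FF : filtration F).
Context (XF : forall t, G_measR (F t) (X t)) (XS : forall t w, S (X t w)).

Lemma F_measurable t A : F t A -> measurable A.
Proof. by case: FF => h _; case: (h t) => _; exact. Qed.

Lemma F_setC t A : F t A -> F t (~` A).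
Proof. by case: FF => h _; case: (h t) => -[_ + _] _ => /[apply]; rewrite setTD. Qed.

Lemma F_setU t A B : F t A -> F t B -> F t (A `|` B).
Proof.
case: FF => h _; case: (h t) => -[G0 _ GU] _ FA FB.
by rewrite -bigcup2E; apply: GU => -[|[|n]].
Qed.

Lemma F_setI t A B : F t A -> F t B -> F t (A `&` B).
Proof.
by move=> FA FB; rewrite -[A `&` B]setCK setCI; apply/F_setC/F_setU; exact: F_setC.
Qed.

Lemma F_le s t : (s <= t)%N -> F s `<=` F t.
Proof.
elim: t => [|t IH]; first by rewrite leqn0 => /eqP ->.
rewrite leq_eqVlt => /predU1P[-> //|]; rewrite ltnS => /IH st A /st.
by case: FF => _; exact.
Qed.

Lemma X_measurable t : measurable_fun setT (X t).
Proof. by move=> _ B mB; rewrite setTI; apply: (@F_measurable t); exact: XF. Qed.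

Lemma X_ge0 t w : 0 <= X t w.
Proof. by case: SS => _ + _ _; apply; exact: XS. Qed.

Lemma F_eq t y : F t [set w | X t w = y].
Proof. by rewrite (_ : [set _ | _] = X t @^-1` [set y])//; exact: XF. Qed.

Lemma F_lt t y : F t [set w | X t w < y].
Proof.
rewrite (_ : [set _ | _] = X t @^-1` [set` `]-oo, y[ ]); first exact: XF.
by apply/seteqP; split => w /=; rewrite in_itv/=.
Qed.

Lemma F_gtlt t y z : F t [set w | y < X t w < z].
Proof.
rewrite (_ : [set _ | _] = X t @^-1` [set` `]y, z[ ]); first exact: XF.
by apply/seteqP; split => w /=; rewrite in_itv/=.
Qed.

Lemma F_le_const t y : F t [set w | X t w <= y].
Proof.
rewrite (_ : [set _ | _] = X t @^-1` [set` `]-oo, y] ]); first exact: XF.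
by apply/seteqP; split => w /=; rewrite in_itv/=.
Qed.

Lemma finite_values_ind (Q : set T -> Prop) t b :
  (forall A B, F t A -> F t B -> A `&` B = set0 -> Q A -> Q B -> Q (A `|` B)) ->
  (forall D y, F t D -> S y -> (forall w, D w -> X t w = y) ->
     (forall w, D w -> X t w < b) -> Q D) ->
  forall D, F t D -> (forall w, D w -> X t w < b) -> Q D.
Proof.
move=> QU Qy D FD Db.
have /finite_seqP[s Es] : finite_set (S `&` [set x | x <= b]) by case: SS.
have : forall w, D w -> X t w \in s.
  move=> w Dw; have : [set` s] (X t w).
    by rewrite -Es; split => //=; rewrite ltW// Db.
  by [].
have sS y : y \in s -> S y.
  by move=> ys; have : [set` s] y by []; rewrite -Es => -[].
move: sS {Es}; elim: s D FD Db => [|y s IH] D FD Db sS Ds.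
  apply: (Qy _ 0) => //; first by case: SS.
  by move=> w /Ds; rewrite in_nil.
rewrite (_ : D = (D `&` [set w | X t w = y]) `|` (D `&` ~` [set w | X t w = y])); last first.
  by rewrite -setIUr setUv setIT.
have F1 : F t (D `&` [set w | X t w = y]) by apply: F_setI => //; exact: F_eq.
have F2 : F t (D `&` ~` [set w | X t w = y]).
  by apply: F_setI => //; apply: F_setC; exact: F_eq.
apply: QU => //.
- by rewrite setIACA setICr setI0.
- apply: (Qy _ y) => //; first by apply: sS; rewrite mem_head.
    by move=> w [].
  by move=> w [/Db].
apply: IH => //; first by move=> w [/Db].
  by move=> z zs; apply: sS; rewrite in_cons zs orbT.
move=> w [/Ds]; rewrite in_cons => /orP[/eqP E|//] H.
by exfalso; apply: H.
Qed.

Lemma step_p_moment t D y p delta C :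
  0 <= C ->
  (exists Zq, cond_exp_nng P (F t) (fun w => (`|X t.+1 w - X t w| `^ p)%:E) Zq /\
     {ae P, forall w, (Zq w <= (C * (1 + X t w) `^ (p - 2 - delta))%:E)%E}) ->
  F t D -> (forall w, D w -> X t w = y) ->
  integrableR P D (fun w => `|X t.+1 w - y| `^ p) /\
  \int[P]_(w in D) (`|X t.+1 w - y| `^ p) <= C * (1 + y) `^ (p - 2 - delta) * pr P D.
Proof.
move=> C0 [Zq [cZ hZ]] FD Dy.
have [hF _] := FF; have mD := F_measurable FD.
have k0 : 0 <= C * (1 + y) `^ (p - 2 - delta) by rewrite mulr_ge0// powR_ge0.
have : (\int[P]_(w in D) (`|X t.+1 w - X t w| `^ p)%:E + (0 * pr P D)%:E <=
   \int[P]_(w in D) 0 + (C * (1 + y) `^ (p - 2 - delta) * pr P D)%:E)%E.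
  apply: (@cond_exp_ae_le _ _ _ _ (F t) _ _ _ _ _ _ _ (hF t) cZ (cond_exp0 _ (hF t).1)) => //.
  apply: filterS hZ => w + Dw; rewrite (Dy _ Dw) adde0 add0e; exact.
rewrite mul0r adde0 integral0 add0e.
rewrite (eq_integral (fun w => (`|X t.+1 w - y| `^ p)%:E)); last first.
  by move=> w /set_mem /Dy ->.
move=> H.
have mf : measurable_fun D (EFin \o (fun w => `|X t.+1 w - y| `^ p)).
  apply/measurable_EFinP; apply: (measurable_funS measurableT) => //.
  apply: (measurableT_comp (measurable_powR p)).
  apply: measurableT_comp => //; apply: measurable_funB => //; exact: X_measurable.
have iD : integrableR P D (fun w => `|X t.+1 w - y| `^ p).
  apply/integrableP; split => //.
  under eq_integral do rewrite gee0_abs ?lee_fin ?powR_ge0//.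
  by apply: (le_lt_trans H); rewrite ltry.
split => //.
by rewrite -lee_fin EFin_Rintegral.
Qed.

End adapted_process.

Section conditional_moments.
Context {R : realType} {d : measure_display} {T : measurableType d}.
Context {P : probability T R}.

Lemma cond_exp_diff_le (G : set (set T)) (fp fm : T -> R) (Zp Zm : T -> \bar R)
    (D : set T) (k : R) :
  Defs.sub_sigma_algebra G ->
  cond_exp_nng P G (fun w => (fp w)%:E) Zp -> cond_exp_nng P G (fun w => (fm w)%:E) Zm ->
  G D -> integrableR P D fp -> integrableR P D fm ->
  {ae P, forall w, D w -> [/\ Zp w \is a fin_num, Zm w \is a fin_num &
     fine (Zp w) - fine (Zm w) <= k]} ->
  \int[P]_(w in D) fp w - \int[P]_(w in D) fm w <= k * pr P D.
Proof.
move=> HG cp cm GD ip im h; have mD : measurable D by exact: HG.2.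
have [a0 b0] : 0 <= Num.max (- k) 0 /\ 0 <= Num.max k 0.
  by rewrite !le_max lexx !orbT.
have kE : k = Num.max k 0 - Num.max (- k) 0.
  by case: (leP k 0) => k0; case: (leP (- k) 0) => ?; lra.
have /(cond_exp_ae_le HG cp cm GD a0 b0) : {ae P, forall w, D w ->
    (Zp w + (Num.max (- k) 0)%:E <= Zm w + (Num.max k 0)%:E)%E}.
  apply: filterS h => w + Dw => /(_ Dw)[fZp fZm].
  rewrite -(fineK fZp) -(fineK fZm) -!EFinD lee_fin !fineK//.
  by rewrite {1}kE; lra.
rewrite -!EFin_Rintegral// -!EFinD lee_fin.
by rewrite {3}kE mulrBl; lra.
Qed.

Lemma powR_le1D (u p : R) : 0 <= u -> 1 <= p -> u <= 1 + u `^ p.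
Proof.
move=> u0 p1; have up : 0 <= u `^ p by exact: powR_ge0.
have [u1|/ltW u1] := leP u 1; first lra.
by have := le1r_powR u1 p1; lra.
Qed.

Lemma powR_sqr_le1D (u p : R) : 0 <= u -> 2 <= p -> u ^+ 2 <= 1 + u `^ p.
Proof.
move=> u0 p2; have up : 0 <= u `^ p by exact: powR_ge0.
have [u1|/ltW u1] := leP u 1.
  by apply: (@le_trans _ _ 1); [exact: exprn_ile1 | rewrite lerDl].
by have := ler_powR u1 p2; rewrite powR_mulrn//; lra.
Qed.

Context {S : set R} {F : nat -> set (set T)} {X : nat -> T -> R}.
Context (SS : state_space S) (FF : filtration F).
Context (XF : forall t, G_measR (F t) (X t)) (XS : forall t w, S (X t w)).

Let mX t : measurable_fun setT (X t) := X_measurable FF XF t.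
Let mXD t (D : set T) : measurable_fun D (X t).
Proof. by apply: (measurable_funS measurableT) => //; exact: mX. Qed.

Lemma step_integrable t D y p : 2 < p -> F t D ->
  integrableR P D (fun w => `|X t.+1 w - y| `^ p) ->
  integrableR P D (fun w => X t.+1 w - y) /\
  integrableR P D (fun w => (X t.+1 w - y) ^+ 2).
Proof.
move=> p2 FD iD; have mD := F_measurable FF FD.
have i1 : integrableR P D (fun w => 1 + `|X t.+1 w - y| `^ p).
  by apply: integrableRD => //; exact: integrableR_cst.
split; apply: (integrableR_le _ _ _ i1) => //.
- by apply: measurable_funB.
- by move=> w _; apply: powR_le1D => //; lra.
- by apply: measurable_funX; apply: measurable_funB.
- by move=> w _; rewrite normrX; apply: powR_sqr_le1D => //; lra.
Qed.

Lemma step_first_moment t D y (Zp Zm : T -> \bar R) (m0 e : R) :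
  cond_exp_nng P (F t) (fun w => (Num.max (X t.+1 w - X t w) 0)%:E) Zp ->
  cond_exp_nng P (F t) (fun w => (Num.max (X t w - X t.+1 w) 0)%:E) Zm ->
  {ae P, forall w, D w -> [/\ Zp w \is a fin_num, Zm w \is a fin_num &
     `|fine (Zp w) - fine (Zm w) - m0| <= e]} ->
  F t D -> (forall w, D w -> X t w = y) ->
  integrableR P D (fun w => X t.+1 w - y) ->
  `|\int[P]_(w in D) (X t.+1 w - y) - m0 * pr P D| <= e * pr P D.
Proof.
move=> cp cm h FD Dy iD; have mD := F_measurable FF FD.
have [hF _] := FF.
have iN : integrableR P D (fun w => `|X t.+1 w - y|) by exact: (integrable_norm iD).
have ip : integrableR P D (fun w => Num.max (X t.+1 w - X t w) 0).
  apply: (integrableR_le mD _ _ iN).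
    by apply: measurable_maxr => //; apply: measurable_funB.
  move=> w /Dy ->; rewrite ger0_norm ?le_max ?lexx ?orbT//.
  by rewrite ge_max normr_ge0 ler_norm.
have im : integrableR P D (fun w => Num.max (X t w - X t.+1 w) 0).
  apply: (integrableR_le mD _ _ iN).
    by apply: measurable_maxr => //; apply: measurable_funB.
  move=> w /Dy ->; rewrite ger0_norm ?le_max ?lexx ?orbT//.
  by rewrite ge_max normr_ge0 distrC ler_norm.
have E : \int[P]_(w in D) (X t.+1 w - y) =
    \int[P]_(w in D) (Num.max (X t.+1 w - X t w) 0) -
    \int[P]_(w in D) (Num.max (X t w - X t.+1 w) 0).
  rewrite -RintegralB//; apply: eq_Rintegral => w /set_mem/Dy ->.
  by case: (leP (X t.+1 w - y) 0) => ?; case: (leP (y - X t.+1 w) 0) => ?; lra.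
have h1 : {ae P, forall w, D w -> [/\ Zp w \is a fin_num, Zm w \is a fin_num &
     fine (Zp w) - fine (Zm w) <= m0 + e]}.
  apply: filterS h => w + Dw => /(_ Dw)[? ?]; rewrite ler_norml => /andP[? ?].
  by split => //; lra.
have h2 : {ae P, forall w, D w -> [/\ Zm w \is a fin_num, Zp w \is a fin_num &
     fine (Zm w) - fine (Zp w) <= - m0 + e]}.
  apply: filterS h => w + Dw => /(_ Dw)[? ?]; rewrite ler_norml => /andP[? ?].
  by split => //; lra.
have H1 := cond_exp_diff_le (hF t) cp cm FD ip im h1.
have H2 := cond_exp_diff_le (hF t) cm cp FD im ip h2.
by rewrite ler_norml E; lra.
Qed.

Lemma step_second_moment t D y (Z : T -> \bar R) (m0 e : R) :
  cond_exp_nng P (F t) (fun w => ((X t.+1 w - X t w) ^+ 2)%:E) Z ->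
  {ae P, forall w, D w -> Z w \is a fin_num /\ `|fine (Z w) - m0| <= e} ->
  F t D -> (forall w, D w -> X t w = y) ->
  integrableR P D (fun w => (X t.+1 w - y) ^+ 2) ->
  `|\int[P]_(w in D) ((X t.+1 w - y) ^+ 2) - m0 * pr P D| <= e * pr P D.
Proof.
move=> cp h FD Dy iD; have mD := F_measurable FF FD.
have [hF _] := FF.
have cm := cond_exp0 P (hF t).1.
have im := integrableR_cst P 0 mD.
have E : \int[P]_(w in D) ((X t.+1 w - y) ^+ 2) =
    \int[P]_(w in D) ((X t.+1 w - X t w) ^+ 2).
  by apply: eq_Rintegral => w /set_mem/Dy ->.
have ip : integrableR P D (fun w => (X t.+1 w - X t w) ^+ 2).
  by move: iD; apply: eq_integrable => // w /set_mem/Dy /= ->.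
have h1 : {ae P, forall w, D w -> [/\ Z w \is a fin_num, (0 : \bar R) \is a fin_num &
     fine (Z w) - fine (0 : \bar R) <= m0 + e]}.
  apply: filterS h => w + Dw => /(_ Dw)[?]; rewrite ler_norml => /andP[? ?].
  by split => //=; lra.
have h2 : {ae P, forall w, D w -> [/\ (0 : \bar R) \is a fin_num, Z w \is a fin_num &
     fine (0 : \bar R) - fine (Z w) <= - m0 + e]}.
  apply: filterS h => w + Dw => /(_ Dw)[?]; rewrite ler_norml => /andP[? ?].
  by split => //=; lra.
have H1 := cond_exp_diff_le (hF t) cp cm FD ip im h1.
have H2 := cond_exp_diff_le (hF t) cm cp FD im ip h2.
rewrite Rintegral_cstE// mul0r in H1 H2.
by rewrite ler_norml E; lra.
Qed.

Lemma Rintegral_quadratic t D y p (v a b k : R) : 2 < p -> F t D ->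
  integrableR P D (fun w => `|X t.+1 w - y| `^ p) ->
  integrableR P D (fun w => v + a * (X t.+1 w - y) + b * (X t.+1 w - y) ^+ 2
    + k * `|X t.+1 w - y| `^ p) /\
  \int[P]_(w in D) (v + a * (X t.+1 w - y) + b * (X t.+1 w - y) ^+ 2
    + k * `|X t.+1 w - y| `^ p) =
  v * pr P D + a * \int[P]_(w in D) (X t.+1 w - y)
   + b * \int[P]_(w in D) ((X t.+1 w - y) ^+ 2)
   + k * \int[P]_(w in D) (`|X t.+1 w - y| `^ p).
Proof.
move=> p2 FD ip; have mD := F_measurable FF FD.
have [i1 i2] := step_integrable p2 FD ip.
have j0 := integrableR_cst P v mD.
have j1 := integrableRZ a mD i1.
have j2 := integrableRZ b mD i2.
have jp := integrableRZ k mD ip.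
have k1 := integrableRD mD j0 j1.
have k2 := integrableRD mD k1 j2.
split; first exact: (integrableRD mD k2 jp).
rewrite (RintegralD mD k2 jp) (RintegralD mD k1 j2) (RintegralD mD j0 j1).
by rewrite Rintegral_cstE// !RintegralZl.
Qed.

End conditional_moments.

Section lyapunov_drift.
Context {R : realType} {d : measure_display} {T : measurableType d}.
Context {P : probability T R} {S : set R} {F : nat -> set (set T)} {X : nat -> T -> R}.
Context (SS : state_space S) (FF : filtration F).
Context (XF : forall t, G_measR (F t) (X t)) (XS : forall t w, S (X t w)).

(* Integrals are taken over [F t]-events on which [X t] is constant, so that no
   conditional expectation has to be manipulated. *)
Definition lamperti_increments (c s2 p delta C : R) :=
  (forall t D y, F t D -> (forall w, D w -> X t w = y) ->
     integrableR P D (fun w => `|X t.+1 w - y| `^ p) /\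
     \int[P]_(w in D) (`|X t.+1 w - y| `^ p) <= C * (1 + y) `^ (p - 2 - delta) * pr P D) /\
  (forall eps, 0 < eps -> exists x0, forall t D y,
     F t D -> (forall w, D w -> X t w = y) -> x0 <= y ->
     `|\int[P]_(w in D) (X t.+1 w - y) - c / y * pr P D| <= eps / (y * ln y) * pr P D /\
     `|\int[P]_(w in D) ((X t.+1 w - y) ^+ 2) - s2 * pr P D| <= eps / ln y * pr P D).

Lemma lamperti_incrementsP (c s2 p delta C : R) : 2 < p -> 0 <= C ->
  (exists Zp Zm : nat -> T -> \bar R,
     [/\ (forall t, cond_exp_nng P (F t)
                     (fun w => (Num.max (X t.+1 w - X t w) 0)%:E) (Zp t)),
         (forall t, cond_exp_nng P (F t)
                     (fun w => (Num.max (X t w - X t.+1 w) 0)%:E) (Zm t)) &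
         forall eps : R, 0 < eps -> exists x0 : R, forall t,
           {ae P, forall w, x0 <= X t w ->
              [/\ Zp t w \is a fin_num, Zm t w \is a fin_num &
                  `|fine (Zp t w) - fine (Zm t w) - c / X t w|
                     <= eps / (X t w * ln (X t w))]}]) ->
  (exists Z2 : nat -> T -> \bar R,
     (forall t, cond_exp_nng P (F t)
                 (fun w => ((X t.+1 w - X t w) ^+ 2)%:E) (Z2 t)) /\
     forall eps : R, 0 < eps -> exists x0 : R, forall t,
       {ae P, forall w, x0 <= X t w ->
          Z2 t w \is a fin_num /\ `|fine (Z2 t w) - s2| <= eps / ln (X t w)}) ->
  (exists Zq : nat -> T -> \bar R,
     (forall t, cond_exp_nng P (F t)
                 (fun w => (`|X t.+1 w - X t w| `^ p)%:E) (Zq t)) /\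
     (forall t, {ae P, forall w, (Zq t w <= (C * (1 + X t w) `^ (p - 2 - delta))%:E)%E})) ->
  lamperti_increments c s2 p delta C.
Proof.
move=> p2 C0 [Zp [Zm [cp cm h1]]] [Z2 [c2 h2]] [Zq [cq hq]].
have hp t D y : F t D -> (forall w, D w -> X t w = y) ->
     integrableR P D (fun w => `|X t.+1 w - y| `^ p) /\
     \int[P]_(w in D) (`|X t.+1 w - y| `^ p) <= C * (1 + y) `^ (p - 2 - delta) * pr P D.
  by move=> FD Dy; apply: (step_p_moment FF XF C0 _ FD Dy); exists (Zq t).
split => // eps eps0.
have [x1 hx1] := h1 _ eps0; have [x2 hx2] := h2 _ eps0.
exists (Num.max x1 x2) => t D y FD Dy; rewrite ge_max => /andP[x1y x2y].
have [ip _] := hp t D y FD Dy.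
have [i1 i2] := step_integrable FF XF p2 FD ip.
split.
  apply: (step_first_moment FF XF (cp t) (cm t) _ FD Dy i1).
  by apply: filterS (hx1 t) => w + Dw; rewrite (Dy _ Dw) => /(_ x1y).
apply: (step_second_moment FF (c2 t) _ FD Dy i2).
by apply: filterS (hx2 t) => w + Dw; rewrite (Dy _ Dw) => /(_ x2y).
Qed.

Lemma measurable_powlog (g n : R) : measurable_fun setT (powlog g n).
Proof.
apply: (measurableT_comp (@measurable_expR R)).
apply: measurable_funD; apply: measurable_funM => //.
by apply: measurableT_comp => //; exact: measurable_ln.
Qed.

Let mX t (D : set T) : measurable_fun D (X t).
Proof. by apply: (measurable_funS measurableT) => //; exact: (X_measurable FF XF). Qed.

Lemma measurable_comp_X (f : R -> R) t (D : set T) :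
  measurable_fun setT f -> measurable_fun D (fun w => f (X t w)).
Proof. by move=> mf; apply: (measurableT_comp mf); exact: mX. Qed.

Lemma measurable_powlog_max (g n B : R) :
  measurable_fun setT (fun z : R => powlog g n (Num.max z B)).
Proof.
apply: (measurableT_comp (measurable_powlog g n)).
exact: measurable_maxr.
Qed.

Let le_sum3 (u v w z : R) : v + w + z <= 0 -> u + v + w + z <= u.
Proof. by lra. Qed.

Let ge_sum3 (u v w z : R) : 0 <= v + w + z -> u <= u + v + w + z.
Proof. by lra. Qed.

Context {c s2 p delta C : R}.
Context (s20 : 0 < s2) (p2 : 2 < p) (d0 : 0 < delta) (C0 : 0 <= C).
Context (inc : lamperti_increments c s2 p delta C).

Lemma powlog_max_drift (g n B : R) :
  0 < g -> n < 0 -> c = s2 * (1 - g) / 2 -> g < p -> 1 < B -> `|n| <= g * ln B ->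
  exists A K : R, [/\ B <= A, 0 <= K & forall t D y, F t D -> S y ->
    (forall w, D w -> X t w = y) ->
    integrableR P D (fun w => powlog g n (Num.max (X t.+1 w) B)) /\
    \int[P]_(w in D) powlog g n (Num.max (X t.+1 w) B)
      <= (powlog g n (Num.max y B) + K * (y <= A)%R%:R) * pr P D].
Proof.
move=> g0 n0 Ec gp B1 nB.
have [eps eps0 [M [_ H]]] :=
  @powlog_superharmonic R g n c p delta C s2 B g0 n0 s20 Ec p2 gp d0 B1 nB.
have [hp hm] := inc; have [x0 hx0] := hm _ eps0.
pose A := Num.max B (Num.max M x0).
have [AB AM Ax] : [/\ B <= A, M <= A & x0 <= A] by rewrite /A !le_max !lexx !orbT.
move: A AB AM Ax => A AB AM Ax.
have [K K0 hK] := @powlog_max_growth R g n p B A g0 gp B1 nB.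
exists A, (K * (1 + C * (1 + A) `^ `|p - 2 - delta|)); split => //.
  by rewrite mulr_ge0// addr_ge0// mulr_ge0// powR_ge0.
move=> t D y FD Sy Dy; have mD := F_measurable FF FD.
have [ip hpb] := hp t D y FD Dy.
have y0 : 0 <= y by case: SS => _ + _ _; exact.
have f0 z : 0 <= powlog g n z by rewrite ltW// powlog_gt0.
have [yA|Ay] := leP y A.
  have i1 : integrableR P D (fun w => K * (1 + `|X t.+1 w - y| `^ p)).
    by apply: integrableRZ => //; apply: integrableRD => //; exact: integrableR_cst.
  have ij : integrableR P D (fun w => powlog g n (Num.max (X t.+1 w) B)).
    apply: (integrableR_le mD _ _ i1).
      exact: (measurable_comp_X t.+1 (measurable_powlog_max g n B)).
    by move=> w Dw; rewrite ger0_norm//; apply: hK; rewrite y0.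
  split => //.
  apply: (@le_trans _ _ (\int[P]_(w in D) (K * (1 + `|X t.+1 w - y| `^ p)))).
    by apply: (le_Rintegral mD ij i1) => w Dw; apply: hK; rewrite y0.
  rewrite RintegralZl//; last by apply: integrableRD => //; exact: integrableR_cst.
  rewrite RintegralD//; last exact: integrableR_cst.
  rewrite Rintegral_cstE// mul1r mulr1 mulrDl -mulrA.
  apply: (@le_trans _ _ (K * ((1 + C * (1 + A) `^ `|p - 2 - delta|) * pr P D))); last first.
    by rewrite lerDr mulr_ge0// pr_ge0.
  rewrite ler_wpM2l// mulrDl mul1r lerD2l; apply: (le_trans hpb).
  rewrite ler_wpM2r ?pr_ge0// ler_wpM2l//.
  apply: (@le_trans _ _ ((1 + y) `^ `|p - 2 - delta|)).
    by apply: ler_powR; [rewrite lerDl | exact: ler_norm].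
  by apply: ge0_ler_powR; rewrite ?nnegrE ?lerD2l// addr_ge0// (le_trans y0).
have yB : Num.max y B = y by apply/max_idPl; lra.
rewrite mulr0 addr0 yB.
have [a [b [k [hz hq]]]] := H y (le_lt_trans AM Ay).
have [iq Eq] := Rintegral_quadratic FF XF (powlog g n y) a b k p2 FD ip.
have ij : integrableR P D (fun w => powlog g n (Num.max (X t.+1 w) B)).
  apply: (integrableR_le mD _ _ iq).
    exact: (measurable_comp_X t.+1 (measurable_powlog_max g n B)).
  by move=> w Dw; rewrite ger0_norm.
split => //.
apply: (le_trans (le_Rintegral mD ij iq (fun w _ => hz (X t.+1 w)))).
have [h1 h2] := hx0 t D y FD Dy (le_trans Ax (ltW Ay)).
by rewrite Eq; apply: le_sum3; exact: hq (pr_ge0 P D) h1 h2 hpb.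
Qed.

Lemma powlog_supermartingale (g n B : R) :
  0 < g -> n < 0 -> c = s2 * (1 - g) / 2 -> g < p -> 1 < B -> `|n| <= g * ln B ->
  exists A K : R, 0 <= K /\ forall x t D, F t D -> (forall w, D w -> X t w < x) ->
    [/\ integrableR P D (fun w => powlog g n (Num.max (X t.+1 w) B)),
        integrableR P D (fun w => powlog g n (Num.max (X t w) B)) &
    \int[P]_(w in D) powlog g n (Num.max (X t.+1 w) B)
      <= \int[P]_(w in D) powlog g n (Num.max (X t w) B)
       + K * pr P (D `&` [set w | X t w <= A])].
Proof.
move=> g0 n0 Ec gp B1 nB.
have [A [K [AB K0 H]]] := powlog_max_drift g0 n0 Ec gp B1 nB.
exists A, K; split => // x t; apply: (finite_values_ind SS FF XF XS) => //.
- move=> D1 D2 F1 F2 D12 [i1 j1 h1] [i2 j2 h2].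
  have m1 := F_measurable FF F1; have m2 := F_measurable FF F2.
  have mA := F_measurable FF (F_le_const XF t A).
  split; [exact: integrableRU | exact: integrableRU |].
  rewrite !Rintegral_setUE// setIUl prU//; [|exact: measurableI|exact: measurableI|].
    by rewrite mulrDr addrACA lerD.
  by rewrite setIACA D12 set0I.
- move=> D y FD Sy Dy _; have mD := F_measurable FF FD.
  have [i1 h1] := H t D y FD Sy Dy.
  have [i2 ->] : integrableR P D (fun w => powlog g n (Num.max (X t w) B)) /\
      \int[P]_(w in D) powlog g n (Num.max (X t w) B) = powlog g n (Num.max y B) * pr P D.
    by apply: Rintegral_const_on => // w /Dy ->.
  split => //; apply: (le_trans h1).
  rewrite mulrDl lerD2l -mulrA ler_wpM2l//.
  have [yA|Ay] := leP y A.
    rewrite mul1r (_ : D `&` _ = D)//; apply/setIidPl => w Dw /=.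
    by rewrite (Dy _ Dw).
  by rewrite mul0r pr_ge0.
Qed.

Definition truncated_powlog (g n A x z : R) :=
  powlog g n (Num.min (Num.max z A) (2 * x)) - powlog g n A.

Lemma truncated_powlog_bound (g n A x z : R) : 1 < A -> `|n| <= g * ln A -> A <= x ->
  0 <= truncated_powlog g n A x z <= powlog g n (2 * x).
Proof.
move=> A1 nA Ax.
have h1 : A <= Num.min (Num.max z A) (2 * x).
  by rewrite le_min le_max lexx orbT/=; lra.
have h2 : Num.min (Num.max z A) (2 * x) <= 2 * x by rewrite ge_min lexx orbT.
have g0 : 0 <= g.
  by have := ln_gt0 A1; have := normr_ge0 n; have [//|] := leP 0 g; nra.
have nA' v : A <= v -> `|n| <= g * ln v.
  move=> Av; apply: (le_trans nA); rewrite ler_wpM2l//.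
  by rewrite ler_ln ?posrE//; lra.
have := powlog_le A1 nA h1.
have : powlog g n (Num.min (Num.max z A) (2 * x)) <= powlog g n (2 * x).
  by apply: powlog_le => //; [lra | exact: nA'].
have := powlog_gt0 g n A.
by rewrite /truncated_powlog; lra.
Qed.

Lemma measurable_truncated_powlog (g n A x : R) :
  measurable_fun setT (truncated_powlog g n A x).
Proof.
apply: measurable_funB => //; apply: (measurableT_comp (measurable_powlog g n)).
by apply: measurable_minr => //; exact: measurable_maxr.
Qed.

Lemma integrable_truncated_powlog (g n A x : R) t (D : set T) :
  1 < A -> `|n| <= g * ln A -> A <= x -> measurable D ->
  integrableR P D (fun w => truncated_powlog g n A x (X t w)).
Proof.
move=> A1 nA Ax mD.
apply: (integrableR_le mD _ _ (integrableR_cst P (powlog g n (2 * x)) mD)).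
  exact: (measurable_comp_X t (measurable_truncated_powlog g n A x)).
move=> w _; have /andP[h1 h2] := truncated_powlog_bound (X t w) A1 nA Ax.
by rewrite ger0_norm.
Qed.

Lemma powlog_submartingale (g n : R) :
  0 < g -> 0 < n -> c = s2 * (1 - g) / 2 ->
  exists A0, forall A x, A0 <= A -> A <= x ->
    [/\ 1 < A, `|n| <= g * ln A & forall t D, F t D -> (forall w, D w -> X t w < x) ->
    \int[P]_(w in D) truncated_powlog g n A x (X t w)
    <= \int[P]_(w in D) truncated_powlog g n A x (X t.+1 w)].
Proof.
move=> g0 n0 Ec.
have [eps eps0 [M [_ H]]] := @powlog_subharmonic R g n c p delta C s2 g0 n0 s20 Ec p2 d0.
have [hp hm] := inc; have [x0 hx0] := hm _ eps0.
exists (Num.max (Num.max 4 (2 * expR (`|n| / g))) (Num.max M x0)) => A x.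
rewrite !ge_max => /andP[/andP[A4 AE] /andP[AM Ax0]] Ax.
have nA' v : A / 2 <= v -> `|n| <= g * ln v.
  move=> Av; rewrite -ler_pdivrMl// mulrC -[leLHS]expRK.
  by rewrite ler_ln ?posrE ?expR_gt0//; lra.
have A1 : 1 < A by lra.
have nA : `|n| <= g * ln A by apply: nA'; lra.
split; [exact: A1 | exact: nA | move=> t].
apply: (finite_values_ind SS FF XF XS (Q := fun D =>
    \int[P]_(w in D) truncated_powlog g n A x (X t w)
    <= \int[P]_(w in D) truncated_powlog g n A x (X t.+1 w))).
  move=> D1 D2 F1 F2 D12 h1 h2.
  have m1 := F_measurable FF F1; have m2 := F_measurable FF F2.
  have i1 s := integrable_truncated_powlog s A1 nA Ax m1.
  have i2 s := integrable_truncated_powlog s A1 nA Ax m2.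
  rewrite (Rintegral_setUE m1 m2 D12 (i1 t) (i2 t)).
  by rewrite (Rintegral_setUE m1 m2 D12 (i1 t.+1) (i2 t.+1)) lerD.
move=> D y FD Sy Dy Dx; have mD := F_measurable FF FD.
have [_ ->] : integrableR P D (fun w => truncated_powlog g n A x (X t w)) /\
    \int[P]_(w in D) truncated_powlog g n A x (X t w) = truncated_powlog g n A x y * pr P D.
  by apply: Rintegral_const_on => // w /Dy ->.
have [->|/set0P[w0 Dw0]] := eqVneq D set0.
  by rewrite Rintegral_set0 /pr measure0 mulr0.
have yx : y < x by rewrite -(Dy _ Dw0); exact: Dx.
have [yA|Ay] := leP y A.
  have -> : truncated_powlog g n A x y = 0.
    rewrite /truncated_powlog (_ : Num.min _ _ = A) ?subrr//.
    rewrite (_ : Num.max y A = A); last by apply/max_idPr.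
    by apply/min_idPl; lra.
  rewrite mul0r; apply: Rintegral_ge0 => w _.
  by have /andP[] := truncated_powlog_bound (X t.+1 w) A1 nA Ax.
have [ip hpb] := hp t D y FD Dy.
have [a [b [k [hz hq]]]] := H y (le_lt_trans AM Ay).
have Ey : truncated_powlog g n A x y = powlog g n y - powlog g n A.
  rewrite /truncated_powlog (_ : Num.max y A = y); last by apply/max_idPl; lra.
  by rewrite (_ : Num.min _ _ = y)//; apply/min_idPl; lra.
have [iq Eq] := Rintegral_quadratic FF XF (powlog g n y - powlog g n A) a b k p2 FD ip.
have [h1 h2] := hx0 t D y FD Dy (le_trans Ax0 (ltW Ay)).
have hh := hq _ _ _ _ (pr_ge0 P D) h1 h2 hpb.
have ij := integrable_truncated_powlog t.+1 A1 nA Ax mD.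
apply: le_trans (le_Rintegral mD iq ij _); first by rewrite Eq Ey; exact: ge_sum3.
move=> w _; rewrite /truncated_powlog.
set v := powlog g n (Num.min _ _).
suff : powlog g n y + a * (X t.+1 w - y) + b * (X t.+1 w - y) ^+ 2 +
   k * `|X t.+1 w - y| `^ p <= v by lra.
apply: hz => [|/andP[z1 z2]]; first by rewrite ltW// powlog_gt0.
apply: powlog_le; [lra | apply: nA'; lra |].
by rewrite le_min le_max lexx/=; lra.
Qed.

End lyapunov_drift.

Section excursion_events.
Context {R : realType} {d : measure_display} {T : measurableType d}.
Context {P : probability T R} {S : set R} {F : nat -> set (set T)} {X : nat -> T -> R}.
Context (SS : state_space S) (FF : filtration F).
Context (XF : forall t, G_measR (F t) (X t)) (XS : forall t w, S (X t w)).
Context {m : R -> R -> nat} {phi : R -> R -> R}.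
Context (mphi : forall x y, S x -> S y -> (0 < m x y)%N /\ 0 < phi x y).
Context (A1 : forall y, S y -> forall t, exists Z : T -> \bar R,
     cond_exp_nng P (F t) (fun w => ((X (t + m (X t w) y)%N w == y)%:R)%:E) Z /\
     {ae P, forall w, ((phi (X t w) y)%:E <= Z w)%E}).

(* The excursion from [X 0 = 0] has not returned to [0] by time [t]; in [alive x t]
   it has moreover stayed below level [x]. *)
Fixpoint noret t : set T := if t is s.+1 then noret s `&` [set w | 0 < X t w]
  else [set w | X 0%N w = 0].

Fixpoint alive (x : R) t : set T := if t is s.+1 then alive x s `&` [set w | 0 < X t w < x]
  else [set w | X 0%N w = 0].

Definition hit (x : R) t := alive x t `&` [set w | x <= X t.+1 w].

Definition hits (x : R) N := \big[setU/set0]_(t < N) hit x t.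

Definition hit_level (x : R) := \bigcup_N hits x N.

Lemma F_gt t y : F t [set w | y < X t w].
Proof.
rewrite (_ : [set _ | _] = ~` [set w | X t w <= y]).
  exact/(F_setC FF)/(F_le_const XF).
by apply/seteqP; split => w /=; rewrite ltNge => /negP.
Qed.

Lemma F_ge t y : F t [set w | y <= X t w].
Proof.
rewrite (_ : [set _ | _] = ~` [set w | X t w < y]).
  exact/(F_setC FF)/(F_lt XF).
by apply/seteqP; split => w /=; rewrite leNgt => /negP.
Qed.

Lemma F_noret t : F t (noret t).
Proof.
elim: t => [|t IH]; first exact: (F_eq XF).
by apply: (F_setI FF); [apply: (F_le FF (leqnSn t)) | exact: F_gt].
Qed.

Lemma F_alive x t : F t (alive x t).
Proof.
elim: t => [|t IH]; first exact: (F_eq XF).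
by apply: (F_setI FF); [apply: (F_le FF (leqnSn t)) | exact: (F_gtlt XF)].
Qed.

Lemma measurable_noret t : measurable (noret t).
Proof. exact: (F_measurable FF (F_noret t)). Qed.

Lemma measurable_alive x t : measurable (alive x t).
Proof. exact: (F_measurable FF (F_alive x t)). Qed.

Lemma measurable_hit x t : measurable (hit x t).
Proof.
apply: measurableI; first exact: measurable_alive.
exact: (F_measurable FF (F_ge t.+1 x)).
Qed.

Lemma measurable_hits x N : measurable (hits x N).
Proof. by apply: bigsetU_measurable => i _; exact: measurable_hit. Qed.

Lemma measurable_hit_level x : measurable (hit_level x).
Proof. by apply: bigcup_measurable => i _; exact: measurable_hits. Qed.

Lemma noret_sub t : noret t.+1 `<=` noret t. Proof. by move=> w []. Qed.

Lemma alive_sub x t : alive x t.+1 `<=` alive x t. Proof. by move=> w []. Qed.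

Lemma noret_le s t : (s <= t)%N -> noret t `<=` noret s.
Proof.
elim: t => [|t IH]; first by rewrite leqn0 => /eqP ->.
rewrite leq_eqVlt => /predU1P[-> //|]; rewrite ltnS => /IH st w /noret_sub; exact: st.
Qed.

Lemma alive_le x s t : (s <= t)%N -> alive x t `<=` alive x s.
Proof.
elim: t => [|t IH]; first by rewrite leqn0 => /eqP ->.
rewrite leq_eqVlt => /predU1P[-> //|]; rewrite ltnS => /IH st w /alive_sub; exact: st.
Qed.

Lemma alive_noret x t : alive x t `<=` noret t.
Proof. by elim: t => [//|t IH] w [/IH ? /= /andP[? _]]; split. Qed.

Lemma alive_mono x x' t : x <= x' -> alive x t `<=` alive x' t.
Proof.
move=> xx'; elim: t => [//|t IH] w [/IH ? /= /andP[X0' Xx]]; split => //=.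
by rewrite X0' (lt_le_trans Xx).
Qed.

Lemma alive_lt x t w : 0 < x -> alive x t w -> X t w < x.
Proof. by move=> x0; case: t => [/= -> //|t [_ /= /andP[]]]. Qed.

Lemma hitsS x N : hits x N.+1 = hits x N `|` hit x N.
Proof. by rewrite /hits big_ord_recr. Qed.

Lemma hits_alive x N : hits x N `&` alive x N = set0.
Proof.
elim: N => [|N IH]; first by rewrite /hits big_ord0 set0I.
rewrite hitsS setIUl; apply/seteqP; split => // w [[h /alive_sub a]|].
  by have : (hits x N `&` alive x N) w by []; rewrite IH.
by move=> [[_ /= xX] [_ /= /andP[_]]]; rewrite ltNge xX.
Qed.

Lemma pr_hits x N : pr P (hits x N) = \sum_(t < N) pr P (hit x t).
Proof.
elim: N => [|N IH].
  by rewrite /hits !big_ord0 /pr measure0.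
rewrite hitsS big_ord_recr/= -IH prU//; [exact: measurable_hits|exact: measurable_hit|].
apply/seteqP; split => // w [h [a _]].
by have : (hits x N `&` alive x N) w by []; rewrite hits_alive.
Qed.

Lemma hits_mono x N : hits x N `<=` hits x N.+1.
Proof. by rewrite hitsS => w; left. Qed.

Lemma pr_hits_le x N : pr P (hits x N) <= pr P (hit_level x).
Proof.
apply: le_pr; [exact: measurable_hits | exact: measurable_hit_level |].
by move=> w hw; exists N.
Qed.

Lemma pr_hit_level_le x (K : R) : (forall N, pr P (hits x N) <= K) ->
  pr P (hit_level x) <= K.
Proof.
move=> hK; rewrite -lee_fin -prE; last exact: measurable_hit_level.
have cv : P (hits x N) @[N --> \oo] --> P (hit_level x).
  apply: nondecreasing_cvg_mu.
  - by move=> N; exact: measurable_hits.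
  - exact: measurable_hit_level.
  - apply/nondecreasing_seqP => N; rewrite subsetEset; exact: hits_mono.
rewrite -(cvg_lim _ cv)//; apply: lime_le; first by apply/cvg_ex; eexists; exact: cv.
apply: nearW => N; rewrite prE; first by rewrite lee_fin.
exact: measurable_hits.
Qed.

Lemma noret_cover x N : noret N `<=` alive x N `|` hits x N.
Proof.
elim: N => [|N IH]; first by move=> w; left.
move=> w [/IH [a|h] /= Xw]; last by right; exact: hits_mono.
have [xX|Xx] := leP x (X N.+1 w); last by left; split => //=; rewrite Xw.
by right; rewrite hitsS; right; split.
Qed.

Lemma transition_prob t (D : set T) (y z : R) : F t D -> S y -> S z ->
  (forall w, D w -> X t w = y) ->
  phi y z * pr P D <= pr P (D `&` [set w | X (t + m y z)%N w = z]).
Proof.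
move=> FD Sy Sz Dy; have mD := F_measurable FF FD; have [hF _] := FF.
have [Z [cZ hZ]] := A1 Sz t.
have [_ phi0] := mphi Sy Sz.
have mE : measurable [set w | X (t + m y z)%N w = z] := F_measurable FF (F_eq XF _ _).
have : (\int[P]_(w in D) 0 + (phi y z * pr P D)%:E <=
   \int[P]_(w in D) ((X (t + m (X t w) z)%N w == z)%:R)%:E + (0 * pr P D)%:E)%E.
  apply: (@cond_exp_ae_le _ _ _ _ (F t) _ _ _ _ _ _ _ (hF t) (cond_exp0 _ (hF t).1) cZ) => //.
    exact: ltW.
  by apply: filterS hZ => w + Dw; rewrite (Dy _ Dw) adde0 add0e; exact.
rewrite integral0 add0e mul0r adde0.
rewrite (eq_integral (fun w => (\1_[set w | X (t + m y z)%N w = z] w)%:E)); last first.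
  move=> w /set_mem /Dy ->; rewrite indicE; congr (_%:R%:E); congr nat_of_bool.
  by apply/idP/idP; rewrite inE/= => /eqP.
rewrite integral_indic// setIC => H.
by rewrite -lee_fin -prE; [exact: H | exact: measurableI].
Qed.

Lemma finite_states_bound (b : R) : exists M phi0, [/\ (0 < phi0 :> R) &
  forall y, S y -> y <= b -> (m y 0 <= M)%N /\ phi0 <= phi y 0].
Proof.
have /finite_seqP[s Es] : finite_set (S `&` [set x | x <= b]) by case: SS.
have S0 : S 0 by case: SS.
have sS y : y \in s -> S y.
  by move=> ys; have : [set` s] y by []; rewrite -Es => -[].
suff [M [phi0 [p0 H]]] : exists M phi0, [/\ (0 < phi0 :> R) &
    forall y, y \in s -> (m y 0 <= M)%N /\ phi0 <= phi y 0].
  exists M, phi0; split => // y Sy yb; apply: H.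
  by have : (S `&` [set x | x <= b]) y by []; rewrite Es.
move: sS {Es}; elim: s => [|y s IH] sS; first by exists 0%N, 1.
have [|M [phi0 [p0 H]]] := IH; first by move=> z zs; apply: sS; rewrite in_cons zs orbT.
have [_ py] := mphi (sS y (mem_head _ _)) S0.
exists (maxn M (m y 0)), (Num.min phi0 (phi y 0)); split; first by rewrite lt_min p0.
move=> z; rewrite in_cons => /predU1P[->|/H[h1 h2]].
  by rewrite leq_maxr ge_min lexx orbT.
by rewrite leq_max h1 ge_min h2.
Qed.

Lemma telescope_shift (a : nat -> R) (M n : nat) :
  (forall t, 0 <= a t <= 1) -> \sum_(t < n) (a t - a (t + M)%N) <= M%:R.
Proof.
move=> a01; elim: M => [|M IH].
  by rewrite big1// => t _; rewrite addn0 subrr.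
rewrite (eq_bigr (fun t : 'I_n => (a t - a (t + M)%N) + (a (t + M)%N - a (t + M.+1)%N))).
  rewrite big_split/= -natr1 lerD//.
  have -> : \sum_(t < n) (a (t + M)%N - a (t + M.+1)%N) = a M - a (n + M)%N.
    elim: n {IH} => [|n IHn]; first by rewrite big_ord0 add0n subrr.
    by rewrite big_ord_recr/= IHn addnS addSn; lra.
  by have := a01 M; have := a01 (n + M)%N; lra.
by move=> t _; lra.
Qed.

(* A visit to [[0, b]] is followed by a return to [0] within [M] steps with
   probability at least [phi0]; summing over the visits telescopes. *)
Lemma occupation_bound (b : R) : exists K, forall n,
  \sum_(t < n) pr P (noret t `&` [set w | X t w <= b]) <= K.
Proof.
have [M [phi0 [p0 H]]] := finite_states_bound b.
exists (M%:R / phi0) => n.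
have S0 : S 0 by case: SS.
have step t : phi0 * pr P (noret t `&` [set w | X t w <= b]) <=
    pr P (noret t) - pr P (noret (t + M)).
  have FD : F t (noret t `&` [set w | X t w <= b]).
    by apply: (F_setI FF); [exact: F_noret | exact: (F_le_const XF)].
  have mN s : measurable (~` noret s) by apply: measurableC; exact: measurable_noret.
  have h : phi0 * pr P (noret t `&` [set w | X t w <= b]) <=
      pr P ((noret t `&` [set w | X t w <= b]) `&` ~` noret (t + M)).
    have Q D : F t D -> (forall w, D w -> X t w <= b) ->
        phi0 * pr P D <= pr P (D `&` ~` noret (t + M)).
      move=> FD' Db.
      apply: (finite_values_ind SS FF XF XS (Q := fun D => (forall w, D w -> X t w <= b) ->
         phi0 * pr P D <= pr P (D `&` ~` noret (t + M))) (b := b + 1) _ _ FD' _ Db).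
      - move=> D1 D2 F1 F2 D12 h1 h2 D12b.
        have m1 := F_measurable FF F1; have m2 := F_measurable FF F2.
        rewrite setIUl !prU//; [|exact: measurableI|exact: measurableI|].
          by rewrite mulrDr lerD// ?h1 ?h2// => w Dw; apply: D12b; [left|right].
        by rewrite setIACA D12 set0I.
      - move=> D1 y F1 Sy Dy _ D1b; have m1 := F_measurable FF F1.
        have [->|/set0P[w0 Dw0]] := eqVneq D1 set0.
          by rewrite set0I /pr measure0 mulr0.
        have yb : y <= b by rewrite -(Dy _ Dw0); exact: D1b.
        have [hM hp] := H y Sy yb.
        apply: (@le_trans _ _ (phi y 0 * pr P D1)); first by rewrite ler_wpM2r// pr_ge0.
        apply: (le_trans (transition_prob F1 Sy S0 Dy)); apply: le_pr.
        + by apply: measurableI => //; exact: (F_measurable FF (F_eq XF _ _)).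
        + exact: measurableI.
        + move=> w [D1w /= X0w]; split => //= nr.
          have [mpos _] := mphi Sy S0.
          have /(_ w nr) : noret (t + M) `<=` noret (t + m y 0)%N.
            by apply: noret_le; rewrite leq_add2l.
          have : (0 < t + m y 0)%N by rewrite addn_gt0 mpos orbT.
          move: X0w; case: (t + m y 0)%N => // s /= -> _ [_ /=].
          by rewrite ltxx.
      - by move=> w /Db ?; rewrite ltr_pwDr.
    by apply: Q => // w [].
  apply: (le_trans h).
  have -> : pr P (noret t) = pr P (noret (t + M)) + pr P (noret t `&` ~` noret (t + M)).
    rewrite -prU.
    - congr (pr P _); apply/seteqP; split => w.
        by move=> nw; have [nn|nn] := pselect (noret (t + M) w); [left|right].
      by move=> [|[]//]; apply: noret_le; rewrite leq_addr.
    - exact: measurable_noret.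
    - by apply: measurableI => //; exact: measurable_noret.
    - by rewrite setICA setICr setI0.
  rewrite addrAC subrr add0r; apply: le_pr.
  - by apply: measurableI => //; exact: (F_measurable FF FD).
  - by apply: measurableI => //; exact: measurable_noret.
  - by move=> w [[]].
rewrite ler_pdivlMr// mulrC mulr_sumr.
apply: (le_trans (ler_sum _ (fun (t : 'I_n) _ => step t))).
apply: (telescope_shift (a := fun t => pr P (noret t))) => t; rewrite pr_ge0 pr_le1//; exact: measurable_noret.
Qed.

Lemma alive_vanish (x eta : R) : 0 < x -> 0 < eta ->
  exists N0, forall N, (N0 <= N)%N -> pr P (alive x N) <= eta.
Proof.
move=> x0 eta0; have [K hK] := occupation_bound x.
have K0 : 0 <= K by have := hK 0%N; rewrite big_ord0.
exists (Num.trunc (K / eta)).+1 => N hN.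
have h : N%:R * pr P (alive x N) <= K.
  apply: le_trans (hK N); have -> : N%:R * pr P (alive x N) = \sum_(t < N) pr P (alive x N).
    by rewrite sumr_const card_ord mulr_natl.
  apply: ler_sum => t _; apply: le_pr.
  - exact: measurable_alive.
  - apply: measurableI; first exact: measurable_noret.
    exact: (F_measurable FF (F_le_const XF _ _)).
  - move=> w aw; have atw := alive_le (ltnW (ltn_ord t)) aw.
    by split; [exact: alive_noret atw | exact/ltW/(alive_lt x0 atw)].
have N0 : K / eta < N%:R.
  apply: (lt_le_trans (truncnS_gt _)); by rewrite ler_nat.
have : K < N%:R * eta by rewrite -ltr_pdivrMr.
have := pr_ge0 P (alive x N).
have Npos : 0 < N%:R :> R by rewrite ltr0n (leq_trans _ hN).
move=> _ KN; rewrite -(ler_pM2l Npos); exact: le_trans h (ltW KN).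
Qed.

End excursion_events.
Arguments noret {R d T} X t.
Arguments alive {R d T} X x t.
Arguments hit {R d T} X x t.
Arguments hits {R d T} X x N.
Arguments hit_level {R d T} X x.

Section hitting_estimates.
Context {R : realType} {d : measure_display} {T : measurableType d}.
Context {P : probability T R} {S : set R} {F : nat -> set (set T)} {X : nat -> T -> R}.
Context (SS : state_space S) (FF : filtration F).
Context (XF : forall t, G_measR (F t) (X t)) (XS : forall t w, S (X t w)).
Context {m : R -> R -> nat} {phi : R -> R -> R}.
Context (mphi : forall x y, S x -> S y -> (0 < m x y)%N /\ 0 < phi x y).
Context (A1 : forall y, S y -> forall t, exists Z : T -> \bar R,
     cond_exp_nng P (F t) (fun w => ((X (t + m (X t w) y)%N w == y)%:R)%:E) Z /\
     {ae P, forall w, ((phi (X t w) y)%:E <= Z w)%E}).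
Context {c s2 p delta C : R}.
Context (s20 : 0 < s2) (p2 : 2 < p) (d0 : 0 < delta) (C0 : 0 <= C).
Context (inc : @lamperti_increments R d T P F X c s2 p delta C).

Let sum_aux1 (u u' s s' v k k' : R) :
  u + s <= v + k -> u' + s' <= u + k' -> u' + (s + s') <= v + (k + k').
Proof. by lra. Qed.

Let sum_aux2 (u s v k K : R) : 0 <= u -> u + s <= v + k -> k <= K -> s <= v + K.
Proof. by lra. Qed.

Let sum_aux3 (u v : nat -> R) t0 N : (forall t, u t <= u t.+1 + v t) ->
  u t0 <= u (t0 + N)%N + \sum_(t0 <= t < t0 + N) v t.
Proof.
move=> uv; elim: N => [|N IH]; first by rewrite addn0 big_geq// addr0.
apply: (le_trans IH); rewrite addnS big_nat_recr ?leq_addr//=.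
by have := uv (t0 + N)%N; lra.
Qed.

Let mal := measurable_alive FF XF.
Let mhit := measurable_hit FF XF.

Lemma alive_split x t : alive X x t.+1 `&` hit X x t = set0.
Proof.
apply/seteqP; split => // w [[_ /= /andP[_ Xx]] [_ /= xX]].
by move: Xx; rewrite ltNge xX.
Qed.

Lemma hit_level_upper (g n B : R) :
  0 < g -> n < 0 -> c = s2 * (1 - g) / 2 -> g < p -> 1 < B -> `|n| <= g * ln B ->
  exists K, forall x, 0 < x ->
    pr P (hit_level X x) * powlog g n (Num.max x B) <= K.
Proof.
move=> g0 n0 Ec gp B1 nB.
have [A [K [K0 H]]] :=
  powlog_supermartingale SS FF XF XS s20 p2 d0 C0 inc g0 n0 Ec gp B1 nB.
have [Ko hKo] := occupation_bound SS FF XF XS mphi A1 A.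
exists (powlog g n (Num.max 0 B) + K * Ko) => x x0.
pose f z := powlog g n (Num.max z B).
have f0 z : 0 < f z by exact: powlog_gt0.
have fmono z z' : z <= z' -> f z <= f z'.
  move=> zz'; apply: powlog_le.
  - by rewrite lt_max B1 orbT.
  - apply: (le_trans nB); rewrite ler_wpM2l ?(ltW g0)//.
    by rewrite ler_ln ?posrE ?le_max ?lt_max ?lexx ?orbT//; lra.
  - by rewrite ge_max !le_max zz' lexx orbT.
pose u t := \int[P]_(w in alive X x t) f (X t w).
have step t : u t.+1 + f x * pr P (hit X x t) <=
    u t + K * pr P (noret X t `&` [set w | X t w <= A]).
  have [i1 i2 h] := H x t (alive X x t) (F_alive FF XF x t) (fun w => alive_lt x0).
  apply: (@le_trans _ _ (\int[P]_(w in alive X x t) f (X t.+1 w))); last first.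
    apply: (le_trans h); rewrite lerD2l ler_wpM2l//; apply: le_pr.
    - by apply: measurableI => //; exact: (F_measurable FF (F_le_const XF _ _)).
    - apply: measurableI; first exact: (measurable_noret FF XF).
      exact: (F_measurable FF (F_le_const XF _ _)).
    - by move=> w [/alive_noret].
  have sub : alive X x t.+1 `|` hit X x t `<=` alive X x t by move=> w [[]|[]].
  have [i3 h3] := @Rintegral_subset _ _ _ P _ _ (fun w => f (X t.+1 w))
    (measurableU _ _ (mal x t.+1) (mhit x t)) (mal x t) sub (fun w => ltW (f0 _)) i1.
  apply: le_trans h3.
  have sub1 : alive X x t.+1 `<=` alive X x t by exact: alive_sub.
  have sub2 : hit X x t `<=` alive X x t by move=> w [].
  have j1 := integrableS (mal x t) (mal x t.+1) sub1 i1.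
  have j2 := integrableS (mal x t) (mhit x t) sub2 i1.
  rewrite (Rintegral_setUE (mal x t.+1) (mhit x t) (alive_split x t) j1 j2) lerD2l.
  rewrite -(Rintegral_cstE P (f x) (mhit x t)).
  apply: (le_Rintegral (mhit x t) _ j2); first exact: integrableR_cst.
  by move=> w [_ /= xX]; exact: fmono.
have sum N : u N + f x * \sum_(t < N) pr P (hit X x t) <=
    f 0 + K * \sum_(t < N) pr P (noret X t `&` [set w | X t w <= A]).
  elim: N => [|N IH].
    rewrite !big_ord0 !mulr0 !addr0.
    have [_ ->] : integrableR P (alive X x 0) (fun w => f (X 0%N w)) /\ u 0%N =
        f 0 * pr P (alive X x 0).
      by apply: Rintegral_const_on => // w /= ->.
    by rewrite ler_piMr ?pr_le1// ltW.
  rewrite !big_ord_recr/= !mulrDr.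
  exact: sum_aux1 IH (step N).
rewrite -ler_pdivlMr ?powlog_gt0//; apply: (pr_hit_level_le FF XF) => N.
rewrite ler_pdivlMr ?powlog_gt0// [leLHS]mulrC (pr_hits FF XF).
have uN : 0 <= u N by apply: Rintegral_ge0 => w _; exact: ltW.
by apply: (sum_aux2 uN (sum N)); rewrite ler_wpM2l.
Qed.

Lemma noret_vanish (g eta : R) : 0 < g -> c = s2 * (1 - g) / 2 -> g < p -> 0 < eta ->
  exists N0, forall N, (N0 <= N)%N -> pr P (noret X N) <= eta.
Proof.
move=> g0 Ec gp eta0.
pose B : R := expR (1 / g).
have B1 : 1 < B by rewrite /B expR_gt1 divr_gt0.
have nB : `|-1| <= g * ln B by rewrite normrN1 /B expRK mulrC divfK// gt_eqF.
have n0 : -1 < 0 :> R by lra.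
have [K hK] := hit_level_upper g0 n0 Ec gp B1 nB.
have [M [_ hM]] : \forall y \near +oo, powlog (- g) 1 y <= eta / 2 / (`|K| + 1).
  apply: powlog_near0; first lra.
  by rewrite !divr_gt0// ltr_wpDl.
pose x := Num.max B (M + 1).
have x0 : 0 < x by rewrite lt_max (lt_trans _ B1).
have [N0 hN0] := alive_vanish SS FF XF XS mphi A1 x0 (divr_gt0 eta0 (ltr0Sn _ 1)).
exists N0 => N hN.
have mh := measurable_hits FF XF x N.
apply: (@le_trans _ _ (pr P (alive X x N `|` hits X x N))).
  apply: le_pr; [exact: (measurable_noret FF XF) | exact: measurableU | exact: noret_cover].
rewrite prU//; last by rewrite setIC hits_alive.
apply: (@le_trans _ _ (eta / 2 + eta / 2)); last lra.
apply: lerD; first exact: hN0.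
apply: (le_trans (pr_hits_le FF XF x N)).
have xB : Num.max x B = x by apply/max_idPl; rewrite le_max lexx.
have := hK x x0; rewrite xB -ler_pdivlMr ?powlog_gt0// => h.
apply: (le_trans h).
have -> : (powlog g (-1) x)^-1 = powlog (- g) 1 x by rewrite -powlogN opprK.
apply: (@le_trans _ _ ((`|K| + 1) * powlog (- g) 1 x)).
  rewrite ler_wpM2r ?(ltW (powlog_gt0 _ _ _))//.
  by apply: (le_trans (ler_norm K)); rewrite lerDl.
rewrite mulrC -ler_pdivlMr ?ltr_wpDl//.
by apply: hM; rewrite lt_max ltrDl ltr01 orbT.
Qed.

Lemma hit_level_lower (g n : R) : 0 < g -> 0 < n -> c = s2 * (1 - g) / 2 ->
  exists y0, 0 < y0 /\ forall t0 x1 (q : R), 0 < q -> 0 < x1 ->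
    q <= pr P (alive X x1 t0 `&` [set w | y0 <= X t0 w]) ->
    exists2 k, 0 < k & forall x, x1 <= x -> y0 <= x ->
      k <= powlog g n (2 * x) * pr P (hit_level X x).
Proof.
move=> g0 n0 Ec.
have [A0 H0] := powlog_submartingale SS FF XF XS s20 p2 d0 inc g0 n0 Ec.
pose A := Num.max A0 0.
have AA0 : A0 <= A by rewrite le_max lexx.
have [A1' nA _] := H0 A A AA0 (lexx A).
have nA' v : A <= v -> `|n| <= g * ln v.
  move=> Av; apply: (le_trans nA); rewrite ler_wpM2l ?(ltW g0)//.
  by rewrite ler_ln ?posrE//; lra.
have y0A : A <= 2 * A by lra.
move: A AA0 A1' nA nA' y0A => A AA0 A1' nA nA' y0A.
have kpos : 0 < powlog g n (2 * A) - powlog g n A.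
  rewrite subr_gt0 /powlog ltr_expR lnM ?posrE//; last lra.
  have l2 : 0 < ln (2 : R) by apply: ln_gt0; lra.
  have lA : 0 < ln A by exact: ln_gt0.
  have : ln (ln A) <= ln (ln 2 + ln A) by rewrite ler_ln ?posrE; lra.
  rewrite -(ler_pM2l n0) mulrDr.
  have : 0 < g * ln 2 by rewrite mulr_gt0.
  by lra.
exists (2 * A); split; first lra.
move=> t0 x1 q q0 x10 hq.
exists (q * (powlog g n (2 * A) - powlog g n A)); first by rewrite mulr_gt0.
move=> x x1x Ax.
have Axx : A <= x by lra.
have x0 : 0 < x by lra.
have [_ _ H] := H0 A x AA0 Axx.
pose h := truncated_powlog g n A x.
have hb z : 0 <= h z <= powlog g n (2 * x) by exact: truncated_powlog_bound.
have h00 : h 0 = 0.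
  rewrite /h /truncated_powlog (_ : Num.max 0 A = A); last by apply/max_idPr; lra.
  by rewrite (_ : Num.min _ _ = A) ?subrr//; apply/min_idPl; lra.
have hi t D : measurable D -> integrableR P D (fun w => h (X t w)).
  by move=> mD; apply: (integrable_truncated_powlog FF XF).
pose u t := \int[P]_(w in alive X x t) h (X t w).
have step t : u t <= u t.+1 + powlog g n (2 * x) * pr P (hit X x t).
  apply: (le_trans (H t _ (F_alive FF XF x t) (fun w => alive_lt x0))).
  have mZ : measurable (alive X x t `&` [set w | X t.+1 w = 0]).
    by apply: measurableI => //; exact: (F_measurable FF (F_eq XF _ _)).
  have mU := measurableU _ _ (mal x t.+1) (mhit x t).
  have E : alive X x t = (alive X x t.+1 `|` hit X x t) `|`
      (alive X x t `&` [set w | X t.+1 w = 0]).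
    apply/seteqP; split => w; last by move=> [[[]|[]]|[]].
    move=> a; have [xX|Xx] := leP x (X t.+1 w); first by left; right; split.
    have := X_ge0 SS XS t.+1 w; rewrite le_eqVlt => /predU1P[X0|X0].
      by right; split => //=.
    by left; left; split => //=; rewrite X0.
  have D1 : (alive X x t.+1 `|` hit X x t) `&` (alive X x t `&` [set w | X t.+1 w = 0]) = set0.
    apply/seteqP; split => // w [[[_ /= /andP[+ _]]|[_ /= +]] [_ /= E0]]; rewrite E0 ?ltxx//.
    by rewrite leNgt x0.
  rewrite {1}E (Rintegral_setUE mU mZ D1 (hi _ _ mU) (hi _ _ mZ)).
  rewrite (Rintegral_setUE (mal x t.+1) (mhit x t) (alive_split x t) (hi _ _ (mal x t.+1))
     (hi _ _ (mhit x t))).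
  have [_ ->] : integrableR P (alive X x t `&` [set w | X t.+1 w = 0])
      (fun w => h (X t.+1 w)) /\
      \int[P]_(w in alive X x t `&` [set w | X t.+1 w = 0]) h (X t.+1 w) =
      0 * pr P (alive X x t `&` [set w | X t.+1 w = 0]).
    by apply: Rintegral_const_on => // w [_ /= ->].
  rewrite mul0r addr0 lerD2l -(Rintegral_cstE P _ (mhit x t)).
  apply: (le_Rintegral (mhit x t) (hi _ _ (mhit x t))); first exact: integrableR_cst.
  by move=> w _; case/andP: (hb (X t.+1 w)).
have sum N : u t0 <= u (t0 + N)%N + powlog g n (2 * x) * pr P (hit_level X x).
  apply: (le_trans (sum_aux3 t0 N step)); rewrite -mulr_sumr.
  rewrite lerD2l ler_wpM2l ?(ltW (powlog_gt0 _ _ _))//.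
  apply: le_trans (pr_hits_le FF XF x (t0 + N)).
  rewrite (pr_hits FF XF) -(big_mkord xpredT (fun t => pr P (hit X x t))).
  rewrite (@big_cat_nat _ _ _ t0 0 (t0 + N)) ?leq_addr//=.
  by rewrite lerDr; apply: sumr_ge0 => t _; exact: pr_ge0.
have lim : u t0 <= powlog g n (2 * x) * pr P (hit_level X x).
  apply/ler_addgt0Pr => e e0.
  have e0' : 0 < e / powlog g n (2 * x) by rewrite divr_gt0// powlog_gt0.
  have [N0 hN0] := alive_vanish SS FF XF XS mphi A1 x0 e0'.
  apply: (le_trans (sum N0)); rewrite addrC lerD2l.
  apply: (@le_trans _ _ (powlog g n (2 * x) * pr P (alive X x (t0 + N0)))).
    rewrite -(Rintegral_cstE P _ (mal x (t0 + N0))).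
    apply: (le_Rintegral (mal _ _) (hi _ _ (mal _ _))); first exact: integrableR_cst.
    by move=> w _; case/andP: (hb (X (t0 + N0)%N w)).
  by rewrite mulrC -ler_pdivlMr ?powlog_gt0//; apply: hN0; rewrite leq_addl.
apply: le_trans lim.
have mY : measurable (alive X x t0 `&` [set w | 2 * A <= X t0 w]).
  by apply: measurableI => //; exact: (F_measurable FF (F_ge FF XF _ _)).
have [_ hsub] := @Rintegral_subset _ _ _ P _ _ (fun w => h (X t0 w)) mY (mal x t0)
  (@subIsetl _ _ _) (fun w => (andP (hb (X t0 w))).1) (hi _ _ (mal x t0)).
apply: le_trans hsub.
apply: (@le_trans _ _ ((powlog g n (2 * A) - powlog g n A) *
   pr P (alive X x t0 `&` [set w | 2 * A <= X t0 w]))).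
  rewrite mulrC ler_pM2l//; apply: (le_trans hq); apply: le_pr => //.
    by apply: measurableI => //; exact: (F_measurable FF (F_ge FF XF _ _)).
  by move=> w [/(alive_mono x1x)].
rewrite -(Rintegral_cstE P _ mY).
apply: (le_Rintegral mY _ (hi _ _ mY)); first exact: integrableR_cst.
move=> w [_ /= hA]; rewrite /h /truncated_powlog lerD2r.
apply: powlog_le; [lra | exact: nA' |].
by rewrite le_min le_max hA/=; lra.
Qed.

End hitting_estimates.

Section return_times.
Context {R : realType} {T : Type} (X : nat -> T -> R).

Lemma first_time_some (Q : nat -> Prop) n :
  first_time Q = Some n <-> Q n /\ forall k, (k < n)%N -> ~ Q k.
Proof.
rewrite /first_time; case: pselect => [h|nh]; last first.
  by split => // -[Qn _]; exfalso; apply: nh; exists n.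
case: ex_minnP => k /asboolP Qk kmin; split => [[<-]|[Qn nmin]].
  by split => // j jk /asboolP/kmin; rewrite leqNgt jk.
congr Some; apply/eqP; rewrite eqn_leq kmin/=; last exact/asboolP.
by rewrite leqNgt; apply/negP => kn; exact: (nmin _ kn Qk).
Qed.

Lemma first_time_none (Q : nat -> Prop) : first_time Q = None <-> forall n, ~ Q n.
Proof.
rewrite /first_time; case: pselect => [h|nh]; last first.
  by split => // _ n Qn; apply: nh; exists n.
by split => // H; exfalso; have [n Qn] := h; exact: H Qn.
Qed.

Lemma tauS_some n w u : tau X n.+1 w = Some u <->
  exists s, [/\ tau X n w = Some s, (s < u)%N, X u w = 0 &
    forall k, (s < k < u)%N -> X k w <> 0].
Proof.
rewrite /=; case: (tau X n w) => [s|]; last by split => // -[s []].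
rewrite first_time_some; split => [[[su Xu] H]|[s0 [[<-] su Xu H]]].
  by exists s; split => // k /andP[sk ku] Xk; exact: (H k ku).
by split => // k ku [sk Xk]; apply: (H k) => //; rewrite sk ku.
Qed.

Lemma tau_ne_none n w : tau X n.+1 w <> None -> tau X n w <> None.
Proof. by rewrite /=; case: (tau X n w). Qed.

Lemma tau_straddle k w : N_infinite X w -> exists n s u,
  [/\ tau X n w = Some s, tau X n.+1 w = Some u & (s <= k < u)%N].
Proof.
move=> Nw; elim: k => [|k [n [s [u [ts tu /andP[sk ku]]]]]].
  case E: (tau X 1 w) => [u|]; last by have := Nw 1%N.
  have [s [[<-] su _ _]] := (tauS_some 0 w u).1 E.
  by exists 0%N, 0%N, u; split.
have [ku1|ku1] := ltnP k.+1 u.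
  by exists n, s, u; split => //; rewrite (leq_trans sk).
have uk : u = k.+1 by apply/eqP; rewrite eqn_leq ku1 ku.
case E: (tau X n.+2 w) => [v|]; last by have := Nw n.+2.
have [s' []] := (tauS_some n.+1 w v).1 E; rewrite tu => -[<-] uv _ _.
by exists n.+1, u, v; split => //; rewrite uk leqnn -uk uv.
Qed.

(* Unlike [noret], this makes no requirement on [X 0]. *)
Definition before_return t : set T := [set w | forall k, (0 < k <= t)%N -> X k w <> 0].

Lemma before_returnP t w : before_return t w <->
  match tau X 1 w with Some e => (t < e)%N | None => True end.
Proof.
case E: (tau X 1 w) => [e|].
  have [s [[<-] su Xe H]] := (tauS_some 0 w e).1 E.
  split => [h|te k /andP[k0 kt]].
    by rewrite ltnNge; apply/negP => et; apply: (h e) => //; rewrite su.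
  by apply: H; rewrite k0 (leq_ltn_trans kt).
split => // _ k /andP[k0 _] Xk.
by have /first_time_none := E; apply; split; [exact: k0 | exact: Xk].
Qed.

Lemma lt_M1 (a : \bar R) w :
  (a < M1 X w)%E <-> exists2 t, before_return t w & (a < (X t w)%:E)%E.
Proof.
rewrite /M1; split => [/ereal_sup_gt[_ [t /before_returnP bt <-] at']|[t /before_returnP bt]].
  by exists t.
by move=> h; apply: (lt_le_trans h); apply: ereal_sup_ubound; exists t.
Qed.

Lemma le_M1 (x : R) w : tau X 1 w <> None ->
  (x%:E <= M1 X w)%E <-> exists2 t, before_return t w & x <= X t w.
Proof.
move=> tw; split => [xM|[t /before_returnP bt xX]]; last first.
  by apply: (@le_trans _ _ (X t w)%:E); [rewrite lee_fin | apply: ereal_sup_ubound; exists t].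
case E: (tau X 1 w) tw => [e|] // _.
apply: contrapT => H.
have Hx t : (t < e)%N -> X t w < x.
  move=> te; rewrite ltNge; apply/negP => xX; apply: H; exists t => //.
  by apply/before_returnP; rewrite E.
have e0 : (0 < e)%N by have [s [[<-]]] := (tauS_some 0 w e).1 E.
have [b bx hb] : exists2 b, b < x & forall t, (t < e)%N -> X t w <= b.
  exists (\big[Num.max/X 0%N w]_(t < e) X t w).
    by rewrite bigmax_lt ?Hx// => i _; exact: Hx.
  by move=> t te; apply: (le_bigmax_cond _ (fun i : 'I_e => X i w) (j := Ordinal te)).
have : (M1 X w <= b%:E)%E.
  apply: ge_ereal_sup => _ [t ht <-]; rewrite lee_fin hb//.
  by move: ht => /before_returnP/before_returnP; rewrite E.
by move=> /(le_trans xM); rewrite lee_fin leNgt bx.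
Qed.

Lemma M1_lty w : tau X 1 w <> None -> (M1 X w < +oo)%E.
Proof.
move=> tw; rewrite ltNge leye_eq; apply/negP => /eqP E.
case Et: (tau X 1 w) tw => [e|] // _.
have : (((\big[Num.max/X 0%N w]_(t < e) X t w) + 1)%:E <= M1 X w)%E by rewrite E leey.
rewrite le_M1 ?Et// => -[t /before_returnP]; rewrite Et => te.
have := le_bigmax_cond (X 0%N w) (fun i : 'I_e => X i w) (j := Ordinal te) (P := xpredT) isT.
by rewrite /=; lra.
Qed.

Lemma X0_le_M1 w : ((X 0%N w)%:E <= M1 X w)%E.
Proof.
apply: ereal_sup_ubound; exists 0%N => //; apply/before_returnP => k.
by case: k.
Qed.

End return_times.

Section path_measurability.
Context {R : realType} {d : measure_display} {T : measurableType d}.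
Context {X : nat -> T -> R} (mX : forall t, measurable_fun setT (X t)).

Lemma measurable_X_eq t y : measurable [set w | X t w = y].
Proof.
by have := mX t measurableT (measurable_set1 y); rewrite setTI.
Qed.

Lemma measurable_X_ne (I : set nat) :
  measurable [set w | forall k, I k -> X k w <> 0].
Proof.
rewrite (_ : [set _ | _] = \bigcap_(k in I) ~` [set w | X k w = 0]).
  by apply: bigcap_measurableType => k _; apply: measurableC; exact: measurable_X_eq.
by apply/seteqP; split => w H k Ik; exact: H.
Qed.

Lemma measurable_before_return t : measurable (before_return X t).
Proof. exact: (measurable_X_ne [set k | (0 < k <= t)%N]). Qed.

Lemma measurable_X_gt t (r : R) : measurable [set w | r < X t w].
Proof.
have -> : [set w | r < X t w] = setT `&` X t @^-1` [set` `]r, +oo[ ].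
  by rewrite setTI; apply/seteqP; split => w /=; rewrite in_itv/= andbT.
by apply: (mX t measurableT); exact: measurable_itv.
Qed.

Lemma measurable_M1 : measurable_fun setT (M1 X).
Proof.
apply: (measurability _ (ErealGenOInfty.measurableE R)) => //.
move=> _ [_ [r ->] <-]; rewrite setTI.
rewrite (_ : _ @^-1` _ = \bigcup_t (before_return X t `&` [set w | r < X t w])).
  apply: bigcup_measurable => t _.
  by apply: measurableI; [exact: measurable_before_return | exact: measurable_X_gt].
rewrite preimage_itvoy; apply/seteqP; split => w /=.
  by move=> /lt_M1[t bt]; rewrite lte_fin => rX; exists t.
by move=> [t _ [bt /= rX]]; apply/lt_M1; exists t => //; rewrite lte_fin.
Qed.

Lemma measurable_tau_some n s : measurable [set w | tau X n w = Some s].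
Proof.
elim: n s => [|n IH] u.
  case: u => [|u].
    by rewrite (_ : [set _ | _] = setT)//; apply/seteqP; split.
  by rewrite (_ : [set _ | _] = set0)//; apply/seteqP; split => // w.
rewrite (_ : [set _ | _] = \bigcup_(s in [set s | (s < u)%N])
    ([set w | tau X n w = Some s] `&` ([set w | X u w = 0] `&`
     [set w | forall k, [set k | (s < k < u)%N] k -> X k w <> 0]))).
  apply: bigcup_measurable => s _; apply: measurableI => //; apply: measurableI.
    exact: measurable_X_eq.
  exact: measurable_X_ne.
apply/seteqP; split => w.
  by move=> /tauS_some[s [ts su Xu H]]; exists s.
by move=> [s su [ts [Xu H]]]; apply/tauS_some; exists s.
Qed.

Lemma measurable_tau_ne n : measurable [set w | tau X n w <> None].
Proof.
rewrite (_ : [set _ | _] = \bigcup_s [set w | tau X n w = Some s]).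
  by apply: bigcup_measurable => s _; exact: measurable_tau_some.
apply/seteqP; split => w /=; last by move=> [s _ /= ->].
by case E : (tau X n w) => [s|] // _; exists s.
Qed.

Lemma measurable_N_infinite : measurable (N_infinite X).
Proof.
rewrite (_ : N_infinite X = \bigcap_n [set w | tau X n w <> None]).
  by apply: bigcap_measurableType => n _; exact: measurable_tau_ne.
by apply/seteqP; split => [w H n|w H n]; [move=> _; exact: H | exact: (H n I)].
Qed.

Lemma measurable_path (l : seq nat) (e : seq R) :
  measurable [set w | [seq X t w | t <- l] = e].
Proof.
elim: l e => [|t l IH] [|y e].
- by rewrite (_ : [set _ | _] = setT)//; apply/seteqP; split.
- by rewrite (_ : [set _ | _] = set0)//; apply/seteqP; split.
- by rewrite (_ : [set _ | _] = set0)//; apply/seteqP; split.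
rewrite (_ : [set _ | _] = [set w | X t w = y] `&` [set w | [seq X t w | t <- l] = e]).
  by apply: measurableI => //; exact: measurable_X_eq.
by apply/seteqP; split => w /= => [[-> ->]|[-> ->]].
Qed.

Lemma excursionE n w s u : tau X n w = Some s -> tau X n.+1 w = Some u ->
  excursion X n.+1 w = [seq X t w | t <- iota s (u - s)].
Proof. by move=> ts tu; rewrite /excursion -pred_Sn ts tu. Qed.

Lemma measurable_excursion n (e : seq R) : measurable [set w | excursion X n.+1 w = e].
Proof.
rewrite (_ : [set _ | _] = (\bigcup_s \bigcup_u ([set w | tau X n w = Some s] `&`
   ([set w | tau X n.+1 w = Some u] `&` [set w | [seq X t w | t <- iota s (u - s)] = e])))
   `|` (~` [set w | tau X n.+1 w <> None] `&` [set w | e = [::]])).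
  apply: measurableU.
    apply: bigcup_measurable => s _; apply: bigcup_measurable => u _.
    apply: measurableI; first exact: measurable_tau_some.
    by apply: measurableI; [exact: measurable_tau_some | exact: measurable_path].
  apply: measurableI; first by apply: measurableC; exact: measurable_tau_ne.
  have [->|ne] := pselect (e = [::]).
    by rewrite (_ : [set _ | _] = setT)//; apply/seteqP; split.
  by rewrite (_ : [set _ | _] = set0)//; apply/seteqP; split.
apply/seteqP; split => w.
  move=> ee; case tu : (tau X n.+1 w) => [u|].
    have [s [ts _ _ _]] := (tauS_some X n w u).1 tu.
    by left; exists s => //; exists u => //; split => //; split => //; exact: etrans (esym (excursionE ts tu)) ee.
  right; split; first by move=> /(_ tu).
  by rewrite -ee /excursion tu; case: (tau X n.+1.-1 w).
move=> [[s _ [u _ [/= ts [tu ee]]]]|[/= tu ->]].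
  exact: etrans (excursionE ts tu) ee.
have {}tu : tau X n.+1 w = None by apply: contrapT.
by rewrite /excursion tu; case: (tau X _ w).
Qed.

End path_measurability.

Section probability_one.
Context {R : realType} {d : measure_display} {T : measurableType d}.
Context (P : probability T R).

Lemma pr_setT : pr P setT = 1.
Proof. by rewrite /pr probability_setT. Qed.

Lemma pr_setC (A : set T) : measurable A -> pr P (~` A) = 1 - pr P A.
Proof.
move=> mA; have := prU P mA (measurableC mA) (setICr A).
by rewrite setUv pr_setT; lra.
Qed.

Lemma pr_setI1 (A B : set T) : measurable A -> measurable B -> pr P B = 1 ->
  pr P (A `&` B) = pr P A.
Proof.
move=> mA mB B1; have mBc := measurableC mB.
have := prU P (measurableI _ _ mA mB) (measurableI _ _ mA mBc).
rewrite setIACA setICr setI0 => /(_ erefl); rewrite -setIUr setUv setIT => ->.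
have : pr P (A `&` ~` B) <= pr P (~` B).
  by apply: le_pr => //; exact: measurableI.
by have := pr_ge0 P (A `&` ~` B); rewrite pr_setC// B1; lra.
Qed.

Lemma eq_pr_on (A B C : set T) : measurable A -> measurable B -> measurable C ->
  pr P C = 1 -> (forall w, C w -> A w <-> B w) -> pr P A = pr P B.
Proof.
move=> mA mB mC C1 AB; rewrite -(pr_setI1 mA mC C1) -(pr_setI1 mB mC C1).
congr (pr P _); apply/seteqP; split => w [h Cw]; split => //; exact/(AB w Cw).
Qed.

Lemma negligible_pr (A : set T) : measurable A -> P.-negligible A <-> pr P A = 0.
Proof.
move=> mA; split => [/(negligibleP P mA) h|h]; first by rewrite /pr h.
by apply/(negligibleP P mA); have := prE P mA; rewrite h.
Qed.

Lemma pr_bigcap1 (A : nat -> set T) : (forall n, measurable (A n)) ->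
  (forall n, pr P (A n) = 1) -> pr P (\bigcap_n A n) = 1.
Proof.
move=> mA A1; have mI : measurable (\bigcap_n A n) by exact: bigcapT_measurable.
have : P.-negligible (~` \bigcap_n A n).
  rewrite setC_bigcap; apply: negligible_bigcup => n.
  by apply/(negligible_pr (measurableC (mA n))); rewrite pr_setC// A1 subrr.
by move=> /(negligible_pr (measurableC mI)); rewrite pr_setC//; lra.
Qed.

End probability_one.

Section recurrent_excursions.
Context {R : realType} {d : measure_display} {T : measurableType d}.
Context {P : probability T R} {S : set R} {F : nat -> set (set T)} {X : nat -> T -> R}.
Context (SS : state_space S) (FF : filtration F).
Context (XF : forall t, G_measR (F t) (X t)) (XS : forall t w, S (X t w)).
Context (X0 : P [set w | X 0%N w = 0] = 1%E).

Let mX := X_measurable FF XF.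
Let pX0 : pr P [set w | X 0%N w = 0] = 1.
Proof. by rewrite /pr X0. Qed.

Lemma noretE t : noret X t = [set w | X 0%N w = 0] `&` before_return X t.
Proof.
elim: t => [|t IH].
  by apply/seteqP; split => w; [move=> /= ->; split => //= -[] | move=> []].
rewrite [LHS]/= IH; apply/seteqP; split => w.
  move=> [[Xw bw] /= Xt]; split => // k /andP[k0]; rewrite leq_eqVlt => /predU1P[->|kt].
    by move=> E; move: Xt; rewrite E ltxx.
  by apply: bw; rewrite k0.
move=> [Xw bw]; split; first split => //.
  by move=> k /andP[k0 kt]; apply: bw; rewrite k0 (leq_trans kt).
rewrite /= lt_neqAle (X_ge0 SS XS) andbT eq_sym; apply/eqP; apply: bw.
by rewrite /= leqnn.
Qed.

Lemma alive_path x t w : X 0%N w = 0 -> before_return X t w ->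
  (forall k, (k <= t)%N -> X k w < x) -> alive X x t w.
Proof.
move=> Xw; elim: t => [//|t IH] bw xw; split.
  apply: IH => [k /andP[k0 kt]|k kt]; first by apply: bw; rewrite k0 (leq_trans kt).
  by apply: xw; rewrite (leq_trans kt).
rewrite /= xw// andbT lt_neqAle (X_ge0 SS XS) andbT eq_sym; apply/eqP; apply: bw.
by rewrite /= leqnn.
Qed.

Lemma hit_levelP x w : 0 < x -> hit_level X x w <->
  X 0%N w = 0 /\ exists2 t, before_return X t w & x <= X t w.
Proof.
move=> x0; split.
  move=> [N _]; elim: N => [|N IH]; first by rewrite /hits big_ord0.
  rewrite hitsS => -[/IH //|[aw /= xX]].
  have := alive_noret aw; rewrite noretE => -[Xw bw]; split => //; exists N.+1 => //.
  move=> k /andP[k0]; rewrite leq_eqVlt => /predU1P[->|kt].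
    by move=> E; move: xX; rewrite E leNgt x0.
  by apply: bw; rewrite k0.
move=> [Xw [t bt xX]].
have ex : exists t, x <= X t w by exists t.
case: (ex_minnP ex) => -[|s] xs smin; first by move: xs; rewrite Xw leNgt x0.
exists s.+1 => //; rewrite hitsS; right; split => //; apply: alive_path => //.
  move=> k /andP[k0 ks]; apply: bt; rewrite k0/=.
  by rewrite (leq_trans ks)// (leq_trans (leqnSn s)) ?smin.
by move=> k ks; rewrite ltNge; apply/negP => /smin; rewrite leqNgt ltnS ks.
Qed.

Lemma tau1_ae : (forall eta, 0 < eta -> exists N0, forall N, (N0 <= N)%N ->
    pr P (noret X N) <= eta) ->
  pr P [set w | tau X 1 w <> None] = 1.
Proof.
move=> H; have mt := measurable_tau_ne mX 1.
have : pr P (~` [set w | tau X 1 w <> None]) <= 0.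
  apply/ler_addgt0Pr => eta eta0; rewrite add0r.
  have [N0 /(_ N0 (leqnn _)) h] := H _ eta0; apply: le_trans h.
  have mC := measurableC mt.
  have m0 := measurable_X_eq mX 0 0.
  rewrite -(pr_setI1 mC m0 pX0); apply: le_pr.
  - exact: measurableI.
  - exact: (measurable_noret FF XF).
  - move=> w [/contrapT tw Xw]; rewrite noretE; split => //.
    by apply/before_returnP; rewrite tw.
by rewrite pr_setC//; have := pr_le1 P mt; lra.
Qed.

Lemma N_infinite_ae : pr P [set w | tau X 1 w <> None] = 1 ->
  (forall n : nat,
     pr P [set w | tau X n w <> None /\ tau X n.+1 w <> None]
     = pr P [set w | tau X 1 w <> None] * pr P [set w | tau X n w <> None]) ->
  pr P (N_infinite X) = 1.
Proof.
move=> t1 A3b; have : forall n, pr P [set w | tau X n w <> None] = 1.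
  elim=> [|n IH].
    by rewrite (_ : [set _ | _] = setT) ?pr_setT//; apply/seteqP; split.
  have := A3b n; rewrite t1 IH mulr1 => <-; congr (pr P _).
  by apply/seteqP; split => w /= => [h|[]//]; split => //; exact: tau_ne_none.
move=> h; have := pr_bigcap1 (measurable_tau_ne mX) h.
by congr (pr P _ = 1); apply/seteqP; split => [w H n|w H n]; [exact: (H n I) | move=> _; exact: H].
Qed.

Lemma pr_M1_ge x : 0 < x -> pr P [set w | tau X 1 w <> None] = 1 ->
  pr P [set w | (x%:E <= M1 X w)%E] = pr P (hit_level X x).
Proof.
move=> x0 t1.
have mC := measurableI _ _ (measurable_tau_ne mX 1) (measurable_X_eq mX 0 0).
apply: (@eq_pr_on _ _ _ P _ _ _ _ _ mC).
- rewrite -[X in measurable X]setTI.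
  apply: emeasurable_fun_c_infty => //; exact: measurable_M1.
- exact: (measurable_hit_level FF XF).
- by rewrite pr_setI1//; [exact: measurable_tau_ne | exact: measurable_X_eq].
move=> w [/= tw Xw]; split.
  by move=> /(le_M1 _ tw) h; apply/hit_levelP.
by move=> /(hit_levelP _ x0)[_ h]; apply/le_M1.
Qed.

Lemma negligible_path (E : set T) (l : seq nat) :
  (forall e, P.-negligible (E `&` [set w | [seq X t w | t <- l] = e])) ->
  P.-negligible E.
Proof.
elim: l E => [|t l IH] E H.
  by apply: negligibleS (H [::]) => w Ew; split.
apply: IH => e.
have hv v : P.-negligible ((E `&` [set w | [seq X t w | t <- l] = e]) `&` [set w | X t w = v]).
  by apply: negligibleS (H (v :: e)) => w [[Ew /= ee] /= Xv]; split => //=; rewrite ee Xv.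
move: (E `&` _) hv => {E H}E hv.
have fin (k : nat) : P.-negligible (E `&` [set w | X t w <= k%:R]).
  have /finite_seqP[s Es] : finite_set (S `&` [set x | x <= k%:R]) by case: SS.
  have : forall w, X t w <= k%:R -> X t w \in s.
    move=> w Xk; have : (S `&` [set x | x <= k%:R]) (X t w) by split.
    by rewrite Es.
  move: (fun w => X t w <= k%:R) => Q hQ.
  suff : P.-negligible (E `&` [set w | X t w \in s]).
    by apply: negligibleS => w [Ew /= Qw]; split => //=; exact: hQ.
  elim: s {Es hQ} => [|v s IHs].
    apply: negligibleS (negligible_set0 P) => w [_ /=]; by rewrite in_nil.
  apply: negligibleS (negligibleU (hv v) IHs) => w [Ew /=].
  by rewrite in_cons => /predU1P[|] h; [left|right].
apply: negligibleS (negligible_bigcup fin) => w Ew.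
exists (Num.trunc (X t w)).+1 => //; split => //=.
by apply/ltW/truncnS_gt.
Qed.

Lemma excursion_reaches (y : R) k :
  pr P (N_infinite X) = 1 -> 0 < pr P [set w | X k w = y] ->
  (forall (n : nat) (e : seq R),
     pr P (N_infinite X `&` [set w | excursion X n.+1 w = e])
     = pr P (N_infinite X `&` [set w | excursion X 1 w = e])) ->
  exists2 e, y \in e & 0 < pr P (N_infinite X `&` [set w | excursion X 1 w = e]).
Proof.
move=> N1 ypos A3; apply: contrapT => H.
have mN := measurable_N_infinite mX.
have zero n e : y \in e -> P.-negligible (N_infinite X `&` [set w | excursion X n.+1 w = e]).
  move=> ye; have mE : measurable (N_infinite X `&` [set w | excursion X n.+1 w = e]).
    by apply: measurableI => //; exact: (measurable_excursion mX).
  apply/(negligible_pr P mE); rewrite A3; apply/eqP.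
  rewrite eq_le pr_ge0 andbT leNgt; apply/negP => h; apply: H; by exists e.
have E1 : P.-negligible (N_infinite X `&` [set w | X k w = y]).
  apply: (@negligibleS _ _ _ _ (\bigcup_n \bigcup_s \bigcup_u (N_infinite X `&`
    ([set w | X k w = y] `&` ([set w | tau X n w = Some s] `&`
    ([set w | tau X n.+1 w = Some u] `&` [set w | (s <= k < u)%N])))))).
    move=> w [Nw Xw]; have [n [s [u [ts tu sku]]]] := tau_straddle k Nw.
    by exists n => //; exists s => //; exists u.
  apply: negligible_bigcup => n; apply: negligible_bigcup => s; apply: negligible_bigcup => u.
  apply: (@negligible_path _ (iota s (u - s))) => e.
  have [ye|ye] := boolP (y \in e).
    apply: negligibleS (zero n e ye) => w [[Nw [Xw [ts [tu sku]]]] /= ee].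
    by split => //=; rewrite (excursionE ts tu).
  apply: negligibleS (negligible_set0 P) => w [[Nw [/= Xw [ts [tu /andP[sk ku]]]]] /= ee].
  move/negP: ye; apply; rewrite -ee -Xw; apply/mapP; exists k => //.
  by rewrite mem_iota sk subnKC// (leq_trans sk) // ltnW.
have mXy := measurable_X_eq mX k y.
have /(negligible_pr P (measurableI _ _ mN mXy)) := E1.
by rewrite setIC pr_setI1// => E; rewrite E ltxx in ypos.
Qed.

Lemma first_excursion_reaches (y : R) k :
  pr P (N_infinite X) = 1 -> 0 < pr P [set w | X k w = y] ->
  (forall (n : nat) (e : seq R),
     pr P (N_infinite X `&` [set w | excursion X n.+1 w = e])
     = pr P (N_infinite X `&` [set w | excursion X 1 w = e])) ->
  exists t0 x1 q, [/\ 0 < q, 0 < x1 &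
    q <= pr P (alive X x1 t0 `&` [set w | y <= X t0 w])].
Proof.
move=> N1 ypos A3.
have [e ye epos] := excursion_reaches N1 ypos A3.
pose x1 : R := \big[Num.max/0]_(v <- e) v + 1.
exists (index y e), x1, (pr P (N_infinite X `&` [set w | excursion X 1 w = e])).
have b0 : 0 <= \big[Num.max/0]_(v <- e) v by exact: bigmax_ge_id.
split => //; first by rewrite /x1; lra.
have mE := measurableI _ _ (measurable_N_infinite mX) (measurable_excursion mX 0 e).
have m0 := measurable_X_eq mX 0 0.
rewrite -(pr_setI1 mE m0 pX0); apply: le_pr.
- exact: measurableI.
- apply: measurableI; first exact: (measurable_alive FF XF).
  exact: (F_measurable FF (F_ge FF XF _ _)).
move=> w [[Nw /= ee] /= Xw].
case tu : (tau X 1 w) => [u|]; last by have := Nw 1%N; rewrite tu.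
have Ee : [seq X t w | t <- iota 0 u] = e.
  by rewrite -ee (@excursionE _ _ _ X 0 w 0 u)// subn0.
have eu : size e = u by rewrite -Ee size_map size_iota.
have nthe t : (t < u)%N -> nth 0 e t = X t w.
  by move=> tu'; rewrite -Ee (nth_map 0%N) ?size_iota// nth_iota// add0n.
have iu : (index y e < u)%N by rewrite -eu index_mem.
split; last by rewrite /= -(nthe _ iu) nth_index.
apply: alive_path => //; first by apply/before_returnP; rewrite tu.
move=> t ti; have tu' : (t < u)%N by exact: leq_ltn_trans iu.
rewrite -(nthe _ tu') /x1 ltr_pwDr//.
apply: (le_bigmax_seq 0 (nth 0 e t) xpredT id) => //.
by rewrite mem_nth// eu.
Qed.

End recurrent_excursions.

Section tails_and_moments.
Context {R : realType} {d : measure_display} {T : measurableType d}.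
Context {P : probability T R} {M : T -> \bar R}.
Context (mM : measurable_fun setT M).

Let E (k : nat) : set T := [set w | ((2 ^+ k)%:E <= M w)%E].

Let mE k : measurable (E k).
Proof. by rewrite -[X in measurable X]setTI; exact: emeasurable_fun_c_infty. Qed.

Lemma Rintegral_indic_sum (a : nat -> R) (A : nat -> set T) n :
  (forall k, measurable (A k)) ->
  integrableR P setT (fun w => \sum_(k < n) a k * \1_(A k) w) /\
  \int[P]_w (\sum_(k < n) a k * \1_(A k) w) = \sum_(k < n) a k * pr P (A k).
Proof.
move=> mA.
have ind k : integrableR P setT (fun w => a k * \1_(A k) w) /\
    \int[P]_w (a k * \1_(A k) w) = a k * pr P (A k).
  have i0 : integrableR P setT (\1_(A k)) by apply: integrable_indic.
  split; first exact: integrableRZ.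
  by rewrite RintegralZl// /Rintegral integral_indic// setIT.
elim: n => [|n [i1 E1]].
  have [h1 h2] := @Rintegral_const_on _ _ _ P setT (fun w => \sum_(k < 0) a k * \1_(A k) w) 0
    measurableT (fun w _ => big_ord0 _ _ _ _).
  by split => //; rewrite h2 mul0r big_ord0.
have [i2 E2] := ind n.
have EE : (fun w => \sum_(k < n.+1) a k * \1_(A k) w) =
    (fun w => \sum_(k < n) a k * \1_(A k) w + a n * \1_(A n) w).
  by apply/funext => w; rewrite big_ord_recr.
rewrite EE; split; first exact: integrableRD.
by rewrite RintegralD// E1 E2 big_ord_recr.
Qed.

Lemma powR_exprn (x g : R) n : 0 <= x -> (x ^+ n) `^ g = (x `^ g) ^+ n.
Proof.
move=> x0; rewrite -(powR_mulrn n x0) powRAC.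
by rewrite (powR_mulrn n (powR_ge0 x g)).
Qed.

Lemma powR2_gt1 (g : R) : 0 < g -> 1 < (2 : R) `^ g.
Proof.
move=> g0; rewrite /powR gt_eqF// expR_gt1 mulr_gt0// ln_gt0//.
by rewrite ltr1n.
Qed.

Lemma dyadic_sum_le (rho v g : R) n : 0 < g -> rho = 2 `^ g -> 0 <= v ->
  \sum_(k < n) (rho ^+ k - rho ^+ k / rho) * (2 ^+ k <= v)%R%:R <= v `^ g /\
  \sum_(k < n) (rho ^+ k - rho ^+ k / rho) * (2 ^+ k <= v)%R%:R <= rho ^+ n / rho.
Proof.
move=> g0 Erho v0.
have rho0 : 0 < rho by rewrite Erho powR_gt0.
elim: n => [|n [h1 h2]].
  by rewrite !big_ord0; split; [exact: powR_ge0 | rewrite divr_ge0// ltW].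
rewrite !big_ord_recr/=.
have rn : 0 < rho ^+ n by rewrite exprn_gt0.
have r1 : 1 <= rho by rewrite ltW// Erho powR2_gt1.
have E2 : rho ^+ n.+1 / rho = rho ^+ n by rewrite exprS mulrAC divff ?mul1r// gt_eqF.
have [nv|nv] := leP (2 ^+ n) v.
  rewrite mulr1 E2; have h : \sum_(i < n) (rho ^+ i - rho ^+ i / rho) * (2 ^+ i <= v)%R%:R +
     (rho ^+ n - rho ^+ n / rho) <= rho ^+ n by lra.
  split => //; apply: (le_trans h).
  have -> : rho ^+ n = (2 ^+ n) `^ g by rewrite powR_exprn// Erho.
  by apply: ge0_ler_powR; rewrite ?nnegrE ?exprn_ge0// ltW.
rewrite mulr0 addr0; split => //; rewrite E2; apply: (le_trans h2).
by rewrite ler_pdivrMr// ler_peMr// ltW.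
Qed.

Lemma moment_infinite (g x0 : R) : 0 < g -> (forall w, (0 <= M w)%E) ->
  (forall x, x0 <= x -> powlog (- g) (- (1 / 2)) x <= pr P [set w | (x%:E <= M w)%E]) ->
  (\int[P]_w poweR (M w) g = +oo)%E.
Proof.
move=> g0 M0 tail.
have [rho Erho] : exists rho : R, rho = 2 `^ g by eexists; reflexivity.
have rho1 : 1 < rho by rewrite Erho powR2_gt1.
have rho0 : 0 < rho by lra.
have l20 : 0 < ln (2 : R) by rewrite ln_gt0// ltr1n.
have S n : ((\sum_(k < n) (rho ^+ k - rho ^+ k / rho) * pr P (E k))%:E <=
    \int[P]_w poweR (M w) g)%E.
  have [i1 <-] := @Rintegral_indic_sum (fun k => rho ^+ k - rho ^+ k / rho) E n mE.
  rewrite EFin_Rintegral//; apply: ge0_le_integral => //.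
  - move=> w _; rewrite lee_fin; apply: sumr_ge0 => k _; apply: mulr_ge0 => //.
    by rewrite subr_ge0 ler_pdivrMr// ler_peMr ?exprn_ge0// ltW.
  - by have /measurable_int := i1.
  - by apply: (measurableT_comp (measurable_poweR g)).
  - move=> w _; have := M0 w; case Ew: (M w) => [v| |] //=; last first.
      by move=> _; rewrite gt_eqF// leey.
    rewrite lee_fin => v0; rewrite lee_fin.
    have [h _] := dyadic_sum_le n g0 Erho v0; apply: le_trans h.
    apply: ler_sum => k _; rewrite indicE; rewrite le_eqVlt; apply/predU1P; left; congr (_ * _%:R).
    by congr nat_of_bool; apply/idP/idP; rewrite inE /E /= Ew lee_fin.
have [k0 hk0] : exists k0 : nat, forall k, (k0 <= k)%N -> (1 <= k)%N /\ x0 <= 2 ^+ k.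
  exists (Num.trunc `|x0|).+1 => k hk; split; first exact: leq_trans hk.
  apply: (le_trans (ler_norm _)); apply: (@le_trans _ _ k%:R).
    by apply/ltW/(lt_le_trans (truncnS_gt _)); rewrite ler_nat.
  by rewrite -natrX ler_nat ltnW// ltn_expl.
pose a : R := 1 - rho^-1.
have a0 : 0 < a by rewrite subr_gt0 invf_lt1.
have low n : (k0 <= n)%N ->
    a * ((n - k0)%:R * ((n.+1)%:R * ln 2) `^ (- (1 / 2))) <=
    \sum_(k < n) (rho ^+ k - rho ^+ k / rho) * pr P (E k).
  move=> kn.
  rewrite -(big_mkord xpredT (fun k => (rho ^+ k - rho ^+ k / rho) * pr P (E k))).
  rewrite (@big_cat_nat _ _ _ k0 0 n)//=.
  apply: (@le_trans _ _ (\sum_(k0 <= k < n) (rho ^+ k - rho ^+ k / rho) * pr P (E k))).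
    have -> : a * ((n - k0)%:R * ((n.+1)%:R * ln 2) `^ (- (1 / 2))) =
       \sum_(k0 <= k < n) (a * ((n.+1)%:R * ln 2) `^ (- (1 / 2))).
      by rewrite sumr_const_nat -[RHS]mulr_natr -[RHS]mulrA; congr (_ * _); exact: mulrC.
    rewrite !big_nat; apply: ler_sum => k /andP[k0k kn'].
    have [k1 hk] := hk0 k k0k.
    have -> : rho ^+ k - rho ^+ k / rho = a * rho ^+ k by rewrite /a; ring.
    rewrite -mulrA ler_pM2l//.
    have := tail _ hk; have l2k : 1 < (2 : R) ^+ k.
      by rewrite exprn_egt1// -?lt0n// ltr1n.
    rewrite powlogE// powRN.
    have -> : (2 ^+ k) `^ g = rho ^+ k by rewrite powR_exprn// Erho.
    rewrite ler_pdivrMl ?exprn_gt0// => h; apply: le_trans h.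
    rewrite lnXn// -(mulr_natl (ln 2) k) !powRN lef_pV2 ?posrE ?powR_gt0 ?mulr_gt0 ?ltr0n//.
    have l2k0 j : 0 <= j%:R * ln (2 : R) by rewrite mulr_ge0// ltW.
    apply: ge0_ler_powR; [by rewrite divr_ge0|rewrite nnegrE; exact: l2k0|rewrite nnegrE; exact: l2k0|].
    by rewrite ler_pM2r// ler_nat ltnW// ltnW.
  rewrite lerDr; apply: sumr_ge0 => k _; rewrite mulr_ge0 ?pr_ge0//.
  by rewrite subr_ge0 ler_pdivrMr// ler_peMr ?exprn_ge0// ltW.
apply/eqyP => A A0.
have [n [kn hn]] : exists n, (k0 <= n)%N /\
    A <= a * ((n - k0)%:R * ((n.+1)%:R * ln 2) `^ (- (1 / 2))).
  pose B : R := (A / a * (2 * ln 2)) ^+ 2.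
  exists ((2 * k0).+1 + (Num.trunc (B / ln 2)).+1)%N; split.
    by rewrite (leq_trans _ (leq_addr _ _))// leqW// leq_pmull.
  set j := (Num.trunc _).+1.
  set n := (_ + j)%N.
  have nB : B <= n.+1%:R * ln 2.
    rewrite -ler_pdivrMr//; apply: (le_trans (ltW (truncnS_gt _))).
    by rewrite ler_nat /n leqW// leq_addl.
  have nk : n.+1%:R / 2 <= (n - k0)%:R :> R.
    rewrite ler_pdivrMr// -natrM ler_nat /n /j; lia.
  set z := n.+1%:R * ln 2 in nB *.
  have z0 : 0 < z by rewrite mulr_gt0// ltr0n.
  have zz : z `^ (1 / 2) * z `^ (1 / 2) = z.
    rewrite -powRD; last by rewrite (gt_eqF z0) implybT.
    by rewrite (_ : 1 / 2 + 1 / 2 = 1) ?powRr1 ?ltW//; lra.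
  have zh0 : 0 < z `^ (1 / 2) by exact: powR_gt0.
  have sq : A / a * (2 * ln 2) <= z `^ (1 / 2).
    rewrite -(@ler_pXn2r _ 2)// ?nnegrE ?(ltW zh0)//.
      by rewrite [leRHS]expr2 zz.
    by rewrite !mulr_ge0 ?invr_ge0// ltW.
  rewrite mulrC -ler_pdivrMr// powRN.
  apply: (@le_trans _ _ (n.+1%:R / 2 * (z `^ (1 / 2))^-1)); last first.
    by rewrite ler_pM2r ?invr_gt0.
  have -> : n.+1%:R / 2 * (z `^ (1 / 2))^-1 = z `^ (1 / 2) / (2 * ln 2).
    have -> : n.+1%:R = z / ln 2 by rewrite /z mulfK// gt_eqF.
    rewrite -{1}zz; field; by rewrite !gt_eqF.
  by rewrite ler_pdivlMr ?mulr_gt0.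
apply: le_trans (S n); rewrite lee_fin; exact: le_trans hn (low n kn).
Qed.

Lemma geometric_sum_le (th : R) n : 0 < th < 1 -> \sum_(k < n) th ^+ k <= (1 - th)^-1.
Proof.
move=> /andP[t0 t1]; have h : (1 - th) * \sum_(k < n) th ^+ k = 1 - th ^+ n.
  elim: n => [|n IH]; first by rewrite big_ord0 mulr0 expr0 subrr.
  by rewrite big_ord_recr/= mulrDr IH exprS; ring.
rewrite -[leRHS]mulr1 -ler_pdivrMl ?invr_gt0 ?subr_gt0// invrK h.
by rewrite gerBl exprn_ge0// ltW.
Qed.

Lemma moment_finite (be be' g' K Kb : R) (C : set T) :
  measurable C -> pr P C = 1 ->
  0 < be' -> be <= be' -> be' < g' ->
  (forall w, (0 <= M w)%E) ->
  (forall w, C w -> (M w < +oo)%E) ->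
  (forall w, C w -> (M w < 1)%E -> (poweR (M w) be <= Kb%:E)%E) ->
  (forall x, 1 <= x -> pr P [set w | (x%:E <= M w)%E] <= K * x `^ (- g')) ->
  (\int[P]_w poweR (M w) be < +oo)%E.
Proof.
move=> mC C1 b0 bb' bg M0 Mfin Msmall tail.
have K0 : 0 <= K.
  have := tail 1 (lexx _); rewrite powR1 mulr1; apply: le_trans; exact: pr_ge0.
pose f (k : nat) w : \bar R := ((2 ^+ k.+1) `^ be' * \1_(E k) w)%:E.
have f0 k w : (0 <= f k w)%E by rewrite lee_fin mulr_ge0 ?powR_ge0.
have mf k : measurable_fun setT (f k).
  by apply/measurable_EFinP; apply: measurable_funM => //; exact: measurable_indic.
pose th : R := 2 `^ (be' - g').
have th0 : 0 < th by exact: powR_gt0.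
have th1 : th < 1.
  have h : 1 < (2 : R) `^ (g' - be') by apply: powR2_gt1; rewrite subr_gt0.
  by rewrite /th -opprB powRN invf_lt1// powR_gt0.
have If k : (\int[P]_w f k w <= (2 `^ be' * K * th ^+ k)%:E)%E.
  have -> : (\int[P]_w f k w = ((2 ^+ k.+1) `^ be' * pr P (E k))%:E)%E.
    rewrite /f; under eq_integral do rewrite EFinM.
    rewrite ge0_integralZl_EFin ?powR_ge0//.
    - by rewrite integral_indic// setIT EFinM -prE.
    - by apply/measurable_EFinP; exact: measurable_indic.
  rewrite lee_fin; apply: (@le_trans _ _ ((2 ^+ k.+1) `^ be' * (K * (2 ^+ k) `^ (- g')))).
    by rewrite ler_wpM2l ?powR_ge0//; apply: tail; rewrite exprn_ege1// ler1n.
  have -> : (2 ^+ k.+1 : R) `^ be' = 2 `^ be' * (2 `^ be') ^+ k.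
    by rewrite powR_exprn// exprS.
  have -> : (2 ^+ k : R) `^ (- g') = (2 `^ (- g')) ^+ k.
    by rewrite powR_exprn.
  have -> : th = 2 `^ be' * 2 `^ (- g').
    by rewrite /th powRD// pnatr_eq0 implybT.
  by rewrite exprMn; rewrite le_eqVlt; apply/predU1P; left; ring.
have Kb0 : 0 <= Num.max Kb 0 by rewrite le_max lexx orbT.
have key : (\int[P]_w poweR (M w) be <=
    \int[P]_w ((Num.max Kb 0)%:E + \sum_(k <oo) f k w))%E.
  apply: ae_ge0_le_integral => //.
  - by move=> w _; exact: poweR_ge0.
  - by apply: (measurableT_comp (measurable_poweR be)).
  - by move=> w _; apply: adde_ge0 => //; apply: nneseries_ge0.
  - apply: emeasurable_funD => //.
    by apply: ge0_emeasurable_sum => // k w _ _; exact: f0.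
  exists (~` C); split; [exact: measurableC | | ].
    apply/(negligibleP P (measurableC mC))/(negligible_pr P (measurableC mC)).
    by rewrite pr_setC// C1 subrr.
  apply: subsetC => w Cw /= _.
  have sge0 : (0 <= \sum_(k <oo) f k w)%E by apply: nneseries_ge0.
  have [M1w|M1w] := ltP (M w) 1%E.
    apply: (le_trans (Msmall w Cw M1w)); apply: (@le_trans _ _ (Num.max Kb 0)%:E).
      by rewrite lee_fin le_max lexx.
    by rewrite leeDl.
  apply: (@le_trans _ _ (\sum_(k <oo) f k w)%E); last by rewrite leeDr.
  have := Mfin w Cw; move: M1w; case Ew: (M w) => [v| |] //=.
  rewrite lee_fin => v1 _.
  have ex : exists k, v < 2 ^+ k.
    exists (Num.trunc v).+1; apply: (lt_le_trans (truncnS_gt v)).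
    by rewrite -natrX ler_nat ltnW// ltn_expl.
  case: (ex_minnP ex) => -[|k] vk kmin; first by move: vk; rewrite expr0 ltNge v1.
  apply: (@le_trans _ _ (f k w)).
    rewrite /f lee_fin.
    have -> : \1_(E k) w = 1 :> R.
      rewrite indicE mem_set// /E/= Ew lee_fin leNgt; apply/negP => /kmin.
      by rewrite ltnn.
    rewrite mulr1; apply: (@le_trans _ _ (v `^ be')); first exact: ler_powR.
    by apply: ge0_ler_powR; rewrite ?nnegrE ?exprn_ge0// ?ltW// (lt_le_trans ltr01).
  have := @nneseries_lim_ge _ (fun k => f k w) xpredT 0 k.+1 (fun k _ _ => f0 k w).
  rewrite big_nat_recr//=; apply: le_trans; rewrite leeDr//.
  by apply: sume_ge0 => i _; exact: f0.
apply: (le_lt_trans key).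
rewrite ge0_integralD//; last 2 first.
- by move=> w _; apply: nneseries_ge0.
- by apply: ge0_emeasurable_sum => // k w _ _; exact: f0.
apply: lte_add_pinfty.
  exact: integrable_lty (integrableR_cst P (Num.max Kb 0) measurableT).
rewrite integral_nneseries//.
apply: (@le_lt_trans _ _ (2 `^ be' * K * (1 - th)^-1)%:E); last exact: ltry.
apply: lime_le; first by apply: is_cvg_nneseries => k _ _; apply: integral_ge0.
apply: nearW => n.
apply: (@le_trans _ _ (\sum_(0 <= k < n) (2 `^ be' * K * th ^+ k)%:E)%E).
  by apply: lee_sum => k _.
rewrite sumEFin lee_fin big_mkord -mulr_sumr ler_wpM2l ?mulr_ge0 ?powR_ge0//.
by apply: geometric_sum_le; rewrite th0.
Qed.

End tails_and_moments.

Section final_estimates.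
Context {R : realType}.
Implicit Types K eps g x : R.

Lemma powlog00 x : powlog 0 0 x = 1.
Proof. by rewrite /powlog !mul0r addr0 expR0. Qed.

Lemma near_lnpow_ge K eps : 0 < eps -> \forall x \near +oo, K <= powlog 0 eps x.
Proof.
move=> eps0; near=> x.
have l1 : 1 <= ln x by near: x; exact: near_ln_ge.
have lx : expR (ln (`|K| + 1) / eps) <= ln x by near: x; exact: near_ln_ge.
have K0 : 0 < `|K| + 1 by rewrite ltr_wpDl.
apply: (@le_trans _ _ (`|K| + 1)); first by apply: (le_trans (ler_norm K)); rewrite lerDl.
rewrite -[leLHS]lnK ?posrE// /powlog ler_expR mul0r add0r mulrC -ler_pdivrMr//.
by rewrite -[leLHS]expRK ler_ln ?posrE ?expR_gt0//; lra.
Unshelve. all: by end_near. Qed.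

Lemma positive_state_lb (S : set R) : state_space S ->
  exists2 b, 0 < b & forall y, S y -> y < 1 -> y = 0 \/ b <= y.
Proof.
move=> [_ Spos Sfin _]; have /finite_seqP[s Es] := Sfin 1.
suff [b b0 H] : exists2 b, 0 < b & forall y, y \in s -> 0 < y -> b <= y.
  exists b => // y Sy y1; have := Spos y Sy; rewrite le_eqVlt => /predU1P[|y0]; first by left.
  right; apply: H => //; have : (S `&` [set x | x <= 1]) y by split => //=; exact: ltW.
  by rewrite Es.
elim: s {Es} => [|z s [b b0 H]]; first by exists 1.
exists (if 0 < z then Num.min z b else b); first by case: ifP => // z0; rewrite lt_min z0.
move=> y; rewrite in_cons => /predU1P[-> z0|ys y0].
  by rewrite z0 ge_min lexx.
by case: ifP => _; rewrite ?ge_min H ?orbT.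
Qed.

Lemma powR_small_bound (b v be : R) : 0 < b -> v < 1 -> v = 0 \/ b <= v ->
  v `^ be <= 1 + b `^ be.
Proof.
move=> b0 v1 [->|bv].
  rewrite /powR eqxx ler_wpDr ?powR_ge0//; by case: (be == 0).
have v0 : 0 < v by lra.
have bb := powR_ge0 b be.
have [be0|be0] := leP 0 be.
  apply: (@le_trans _ _ 1); last by rewrite lerDl.
  rewrite -(powRr0 v); apply: ger_powR => //; rewrite v0/=; exact: ltW.
apply: (@le_trans _ _ (b `^ be)); last by rewrite lerDr.
rewrite -[be]opprK !(powRN _ (- be)) lef_pV2 ?posrE ?powR_gt0//.
by apply: ge0_ler_powR; rewrite ?nnegrE ?oppr_ge0// ltW.
Qed.

End final_estimates.

Theorem theorem2p3 (R : realType) (d : measure_display) (T : measurableType d)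
  (P : probability T R) (S : set R) (F : nat -> set (set T)) (X : nat -> T -> R)
  (m : R -> R -> nat) (phi : R -> R -> R) (c s2 r p delta C : R) :
  (* (A0) *)
  state_space S ->
  filtration F ->
  (forall t, G_measR (F t) (X t)) ->
  (forall t w, S (X t w)) ->
  P [set w | X 0%N w = 0] = 1%E ->
  (* (A1) *)
  (forall x y, S x -> S y -> (0 < m x y)%N /\ 0 < phi x y) ->
  (forall y, S y -> forall t, exists Z : T -> \bar R,
     cond_exp_nng P (F t) (fun w => ((X (t + m (X t w) y)%N w == y)%:R)%:E) Z /\
     {ae P, forall w, ((phi (X t w) y)%:E <= Z w)%E}) ->
  (* (A2), first moment: E[Delta_t | F_t] = E[Delta_t^+ | F_t] - E[Delta_t^- | F_t] *)
  (exists Zp Zm : nat -> T -> \bar R,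
     [/\ (forall t, cond_exp_nng P (F t)
                     (fun w => (Num.max (X t.+1 w - X t w) 0)%:E) (Zp t)),
         (forall t, cond_exp_nng P (F t)
                     (fun w => (Num.max (X t w - X t.+1 w) 0)%:E) (Zm t)) &
         forall eps : R, 0 < eps -> exists x0 : R, forall t,
           {ae P, forall w, x0 <= X t w ->
              [/\ Zp t w \is a fin_num, Zm t w \is a fin_num &
                  `|fine (Zp t w) - fine (Zm t w) - c / X t w|
                     <= eps / (X t w * ln (X t w))]}]) ->
  (* (A2), second moment *)
  0 < s2 ->
  (exists Z2 : nat -> T -> \bar R,
     (forall t, cond_exp_nng P (F t)
                 (fun w => ((X t.+1 w - X t w) ^+ 2)%:E) (Z2 t)) /\
     forall eps : R, 0 < eps -> exists x0 : R, forall t,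
       {ae P, forall w, x0 <= X t w ->
          Z2 t w \is a fin_num /\ `|fine (Z2 t w) - s2| <= eps / ln (X t w)}) ->
  (* (A3)(a): on {N = oo}, the excursions are i.i.d.
     (independence and identical distribution under P[ . | N = oo ],
      multiplied out so as to avoid dividing by P[N = oo]) *)
  (forall (k : nat) (e : nat -> seq R),
     pr P (N_infinite X `&` [set w | forall i, (i < k)%N -> excursion X i.+1 w = e i])
       * pr P (N_infinite X) ^+ k
     = pr P (N_infinite X)
       * \prod_(i < k) pr P (N_infinite X `&` [set w | excursion X i.+1 w = e i])) ->
  (forall (n : nat) (e : seq R),
     pr P (N_infinite X `&` [set w | excursion X n.+1 w = e])
     = pr P (N_infinite X `&` [set w | excursion X 1 w = e])) ->
  (* (A3)(b): P[eta_{n+1} < oo | tau_n < oo] = P[eta_1 < oo] *)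
  (forall n : nat,
     pr P [set w | tau X n w <> None /\ tau X n.+1 w <> None]
     = pr P [set w | tau X 1 w <> None] * pr P [set w | tau X n w <> None]) ->
  (* r = -2c/s^2 > -1 *)
  r = - (2 * c) / s2 ->
  -1 < r ->
  (* (M_p) with p > max(2, 1 + r) *)
  Num.max 2 (1 + r) < p ->
  0 < delta ->
  (exists Zq : nat -> T -> \bar R,
     (forall t, cond_exp_nng P (F t)
                 (fun w => (`|X t.+1 w - X t w| `^ p)%:E) (Zq t)) /\
     (forall t, {ae P, forall w, (Zq t w <= (C * (1 + X t w) `^ (p - 2 - delta))%:E)%E})) ->
  (* conclusion *)
  (forall eps : R, 0 < eps -> exists x0 : R, forall x : R, x0 <= x ->
     x `^ (-1 - r) * (ln x) `^ (- eps)
       <= pr P [set w | (x%:E <= M1 X w)%E]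
       <= x `^ (-1 - r) * (ln x) `^ (1 + eps)) /\
  (\int[P]_w poweR (M1 X w) (1 + r) = +oo)%E /\
  (forall eps : R, 0 < eps -> (\int[P]_w poweR (M1 X w) (1 + r - eps) < +oo)%E).
Proof.
move=> SS FF XF XS X0 mphi A1 hA2a s20 hA2b _ A3id A3b Er r1 hp d0 hMp.
have [p2 gp] : 2 < p /\ 1 + r < p by move: hp; rewrite gt_max => /andP[].
have g0 : 0 < 1 + r by lra.
have Ec : c = s2 * (1 - (1 + r)) / 2 by rewrite Er; field; rewrite gt_eqF.
have inc : @lamperti_increments R d T P F X c s2 p delta `|C|.
  apply: (lamperti_incrementsP FF XF p2 (normr_ge0 C) hA2a hA2b).
  case: hMp => Zq [cq hq]; exists Zq; split => // t.
  apply: filterS (hq t) => w h; apply: (le_trans h); rewrite lee_fin.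
  by rewrite ler_wpM2r ?powR_ge0// ler_norm.
have [g Eg] : exists g, g = 1 + r by exists (1 + r).
rewrite -Eg in g0 gp Ec *.
have C0 := normr_ge0 C.
have mX := X_measurable FF XF.
have mM1 : measurable_fun setT (M1 X) by exact: measurable_M1.
have t1 : pr P [set w | tau X 1 w <> None] = 1.
  apply: (tau1_ae SS FF XF XS X0) => eta eta0.
  exact: (noret_vanish SS FF XF XS mphi A1 s20 p2 d0 C0 inc g0 Ec gp eta0).
have N1 := N_infinite_ae FF XF t1 A3b.
have tailE x : 0 < x -> pr P [set w | (x%:E <= M1 X w)%E] = pr P (hit_level X x).
  by move=> x0; exact: (pr_M1_ge SS FF XF XS X0 x0 t1).
have mtail x : measurable [set w | (x%:E <= M1 X w)%E].
  by rewrite -[X in measurable X]setTI; exact: emeasurable_fun_c_infty.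
pose B : R := expR (1 / g).
have B1 : 1 < B by rewrite /B expR_gt1 divr_gt0.
have nB : `|-1| <= g * ln B by rewrite normrN1 /B expRK mulrC divfK// gt_eqF.
have m1lt0 : -1 < 0 :> R by lra.
have [K hK] := hit_level_upper SS FF XF XS mphi A1 s20 p2 d0 C0 inc g0 m1lt0 Ec gp B1 nB.
have upper x : B <= x -> pr P [set w | (x%:E <= M1 X w)%E] <= `|K| * powlog (- g) 1 x.
  move=> Bx; have x0 : 0 < x by lra.
  have xB : Num.max x B = x by apply/max_idPl.
  rewrite tailE// -[1]opprK powlogN ler_pdivlMr ?powlog_gt0//.
  by have h := hK x x0; rewrite xB in h; apply: (le_trans h); exact: ler_norm.
have lower n : 0 < n -> exists2 k, 0 < k & exists x0, forall x, x0 <= x ->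
    k <= powlog g n x * pr P [set w | (x%:E <= M1 X w)%E].
  move=> n0.
  have [y0 [y00 H]] := hit_level_lower SS FF XF XS mphi A1 s20 p2 d0 inc g0 n0 Ec.
  have [y Sy y0y] : exists2 y, S y & y0 < y by case: SS => _ _ _; exact.
  have S0 : S 0 by case: SS.
  have FX0 : F 0%N [set w | X 0%N w = 0] := F_eq XF 0 0.
  have ypos : 0 < pr P [set w | X (m 0 y) w = y].
    have := transition_prob FF XF mphi A1 FX0 S0 Sy (fun w h => h).
    have -> : pr P [set w | X 0%N w = 0] = 1 by rewrite /pr X0.
    rewrite mulr1 add0n; have [_ phi0] := mphi 0 y S0 Sy.
    move=> h; apply: (lt_le_trans phi0); apply: (le_trans h); apply: le_pr.
    - by apply: measurableI; exact: measurable_X_eq.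
    - exact: measurable_X_eq.
    - by move=> w [].
  have [t0 [x1 [q [q0 x10 hq]]]] := first_excursion_reaches SS FF XF XS X0 N1 ypos A3id.
  have [|k k0 hk] := H t0 x1 q q0 x10.
    apply: (le_trans hq); apply: le_pr.
    - apply: measurableI; first exact: (measurable_alive FF XF).
      exact: (F_measurable FF (F_ge FF XF _ _)).
    - apply: measurableI; first exact: (measurable_alive FF XF).
      exact: (F_measurable FF (F_ge FF XF _ _)).
    - by move=> w [aw /= yX]; split => //=; exact: le_trans (ltW y0y) yX.
  have [D D0 hD] := powlog_doubling_ex g n.
  exists (k / D); first by rewrite divr_gt0.
  exists (Num.max 4 (Num.max x1 y0)) => x; rewrite !ge_max => /andP[x4 /andP[x1x y0x]].
  have x0 : 0 < x := lt_le_trans (ltr0Sn _ 3) x4.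
  have x2 : x / 2 <= 2 * x <= 2 * x by lra.
  rewrite tailE// ler_pdivrMr//; apply: (le_trans (hk x x1x y0x)).
  by rewrite [leRHS]mulrAC ler_wpM2r ?pr_ge0// [leRHS]mulrC; exact: hD.
have Epow x e : 1 < x -> x `^ (-1 - r) * ln x `^ e = powlog (- g) e x.
  by move=> x1; rewrite powlogE//; congr (_ `^ _ * _); rewrite Eg; ring.
have M0 w : (0 <= M1 X w)%E.
  apply: le_trans (X0_le_M1 X w); rewrite lee_fin; exact: (X_ge0 SS XS).
have tails eps : 0 < eps -> exists x0 : R, 1 < x0 /\ forall x : R, x0 <= x ->
    powlog (- g) (- eps) x <= pr P [set w | (x%:E <= M1 X w)%E] /\
    pr P [set w | (x%:E <= M1 X w)%E] <= powlog (- g) (1 + eps) x.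
  move=> eps0; have e20 : 0 < eps / 2 by rewrite divr_gt0.
  have [k k0 [x0 hx0]] := lower (eps / 2) e20.
  have [m1 [_ hm1]] := near_lnpow_ge `|K| eps0.
  have [m2 [_ hm2]] := near_lnpow_ge k^-1 e20.
  exists (Num.max (Num.max (m1 + 1) (m2 + 1)) (Num.max x0 B)); split.
    by rewrite !lt_max B1 !orbT.
  move=> x; rewrite !ge_max => /andP[/andP[m1x m2x] /andP[x0x Bx]].
  split.
    have h := hx0 x x0x.
    have k2 : k^-1 <= powlog 0 (eps / 2) x by apply: hm2; lra.
    have E : powlog (- g) (- eps) x * (powlog g (eps / 2) x * powlog 0 (eps / 2) x) = 1.
      rewrite -!powlogD -[RHS](@powlog00 R x); apply: eq_powlog; first by ring.
      by field.
    have P1 := powlog_gt0 g (eps / 2) x; have P2 := powlog_gt0 0 (eps / 2) x.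
    have P12 : 0 < powlog g (eps / 2) x * powlog 0 (eps / 2) x by rewrite mulr_gt0.
    rewrite -(ler_pM2r P12) E.
    apply: (@le_trans _ _ (k * k^-1)); first by rewrite divff// gt_eqF.
    rewrite mulrA [X in _ <= X * _]mulrC.
    by apply: ler_pM => //; [exact: ltW | rewrite invr_ge0 ltW].
  apply: (le_trans (upper x Bx)).
  have -> : powlog (- g) (1 + eps) x = powlog 0 eps x * powlog (- g) 1 x.
    by apply: powlog_split; ring.
  by rewrite ler_wpM2r ?(ltW (powlog_gt0 _ _ _))//; apply: hm1; lra.
split; [|split].
- move=> eps eps0; have [x0 [x01 h]] := tails eps eps0; exists x0 => x x0x.
  have x1 : 1 < x by lra.
  have [h1 h2] := h x x0x.
  by rewrite !Epow// h1 h2.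
- have [|x0 [_ h]] := tails (1 / 2); first by rewrite divr_gt0.
  by apply: (moment_infinite mM1 (x0 := x0) g0 M0) => x /h[].
- move=> eps eps0.
  pose be' := Num.max (g - eps) (g / 2).
  have [be'0 bebe' be'g] : [/\ 0 < be', g - eps <= be' & be' < g].
    by rewrite /be' lt_max le_max lexx gt_max; split; rewrite ?divr_gt0 ?orbT//; lra.
  move: be' be'0 bebe' be'g => be' be'0 bebe' be'g.
  pose g' := (be' + g) / 2.
  have [g'1 g'2] : be' < g' /\ g' < g by rewrite /g'; lra.
  move: g' g'1 g'2 => g' g'1 g'2.
  have gg' : g' - g < 0 by rewrite subr_lt0.
  have g'0 : 0 < g' := lt_trans be'0 g'1.
  have K10 : 0 < (`|K| + 1)^-1 by rewrite invr_gt0 ltr_wpDl.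
  have [m1 [_ hm1]] := powlog_near0 1 gg' K10.
  pose x0 := Num.max (m1 + 1) B.
  have x0B : B <= x0 by rewrite le_max lexx orbT.
  have x0m : m1 < x0 by rewrite lt_max ltrDl ltr01.
  move: x0 x0B x0m => x0 x0B x0m.
  have [b b0 hb] := positive_state_lb SS.
  have mC := measurable_tau_ne mX 1.
  apply: (@moment_finite _ _ _ P (M1 X) mM1 _ be' g' (x0 `^ g') (1 + b `^ (g - eps)) _
    mC t1 be'0 bebe' g'1 M0).
  + by move=> w; exact: M1_lty.
  + move=> w tw; have := M0 w; case Ew : (M1 X w) => [v| |] //=.
    rewrite lee_fin lte_fin => v0 v1; rewrite lee_fin.
    apply: powR_small_bound => //; apply: hb => //.
    have : (v%:E <= M1 X w)%E by rewrite Ew.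
    move=> /(le_M1 _ tw)[t bt vX].
    have : ((X t w)%:E <= M1 X w)%E by apply/(le_M1 _ tw); exists t.
    rewrite Ew lee_fin => Xv.
    by have -> : v = X t w by apply/eqP; rewrite eq_le vX Xv.
  + move=> x x1; have x00 : 0 < x := lt_le_trans ltr01 x1.
    have [xx0|x0x] := leP x x0.
      apply: (le_trans (pr_le1 P (mtail x))).
      rewrite powRN ler_pdivlMr ?powR_gt0// mul1r.
      apply: ge0_ler_powR; rewrite ?nnegrE// ltW//; exact: lt_le_trans xx0.
    apply: (le_trans (upper x (le_trans x0B (ltW x0x)))).
    have -> : powlog (- g) 1 x = powlog (g' - g) 1 x * powlog (- g') 0 x.
      by apply: powlog_split; ring.
    rewrite (powlog_powR (- g'))// mulrA ler_wpM2r ?powR_ge0//.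
    apply: (@le_trans _ _ 1).
      apply: (@le_trans _ _ ((`|K| + 1) * powlog (g' - g) 1 x)).
        by rewrite ler_wpM2r ?(ltW (powlog_gt0 _ _ _))// lerDl.
      rewrite -ler_pdivlMl ?ltr_wpDl// mulr1; exact: (hm1 x (lt_trans x0m x0x)).
    rewrite -(powRr0 x0); apply: ler_powR; [exact/ltW/(lt_le_trans B1) | exact: ltW].
Qed.
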